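(* For $n\in\mathbb N$ and $1\le i\le n$ let $\mathbf X_{i,n}=(X^{(1)}_{i,n},X^{(2)}_{i,n})$ be bivariate Gaussian random vectors with mean zero, independent within each row $n$, with covariance matrix $$\operatorname{Cov}(\mathbf X_{i,n})=\begin{pmatrix}\sigma_{i,n,1}^2&\sigma_{i,n,1,2}\\ \sigma_{i,n,1,2}&\sigma_{i,n,2}^2\end{pmatrix},\qquad \sigma_{i,n,j}^2>0\ (j=1,2),$$ where $\sigma_{i,n,j}>0$, and let $\rho_{i,n}=\sigma_{i,n,1,2}/(\sigma_{i,n,1}\sigma_{i,n,2})$. Let $b_n$ be the solution of $b_n=n\phi(b_n)$, $\phi$ the standard normal density, and define the probability measure on $[0,\infty]\times\mathbb R^2$ $$\eta_n=\frac1n\sum_{i=1}^n\delta_{\left(\sqrt{b_n^2(1-\rho_{i,n})/2},\ b_n^2(1-1/\sigma_{i,n,1}),\ b_n^2(1-1/\sigma_{i,n,2})\right)}.$$ Suppose that for some $\varepsilon>0$ $$\sup_{n\in\mathbb N}\int_{[0,\infty]\times\mathbb R^2}\left[e^{\theta(1+\varepsilon)}+e^{\gamma(1+\varepsilon)}\right]\eta_n(d(\lambda,\theta,\gamma))<\infty .$$ If, as $n\to\infty$, $\eta_n$ converges weakly to some probability measure $\eta$ on $[0,\infty]\times\mathbb R^2$, then the normalized componentwise maximum $$\max_{i=1,\dots,n}b_n(\mathbf X_{i,n}-b_n)$$ converges in distribution to a random vector with distribution function $F_\eta$ given, for $x,y\in\mathbb R$, by $$-\log F_\eta(x,y)=\int_{[0,\infty]\times\mathbb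 R^2}\left[\Phi\Big(\lambda+\frac{y-x+\theta-\gamma}{2\lambda}\Big)e^{-(x-\theta)}+\Phi\Big(\lambda-\frac{y-x+\theta-\gamma}{2\lambda}\Big)e^{-(y-\gamma)}\right]\eta(d(\lambda,\theta,\gamma)).$$
   Context: $\Phi$ is the standard normal distribution function. $\delta_a$ is the Dirac measure at $a$. $[0,\infty]$ carries the metric $d(x,y)=|e^{-x}-e^{-y}|$ (with $e^{-\infty}=0$), which makes it compact; weak convergence on $[0,\infty]\times\mathbb R^2$ is with respect to the corresponding product topology. Operations between a vector and the scalar $b_n$, and the maximum of vectors, are componentwise. The integrand in $-\log F_\eta$ at $\lambda=0$ and $\lambda=\infty$ is understood as its limit as $\lambda\to0$ and $\lambda\to\infty$, i.e. it equals $e^{-\min(x-\theta,\,y-\gamma)}$ at $\lambda=0$ and $e^{-(x-\theta)}+e^{-(y-\gamma)}$ at $\lambda=\infty$. *)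

(* Defs.v *)
From HB Require Import structures.
From mathcomp Require Import all_boot all_order all_algebra.
From mathcomp Require Import all_classical all_reals all_analysis measurable_realfun.

Set Implicit Arguments.
Unset Strict Implicit.
Unset Printing Implicit Defensive.

Import Order.TTheory GRing.Theory Num.Theory.
Import numFieldNormedType.Exports.

Local Open Scope classical_set_scope.
Local Open Scope ring_scope.

(* Types carrying both a sigma-algebra and a topology.  Compatibility of the
   two is not part of the structure; in the instances used here (R, [0, +oo]
   and their products) the sigma-algebra is the Borel one, the product
   sigma-algebra being Borel because the factors are second countable. *)
#[short(type="topMeasurableType")]
HB.structure Definition TopMeasurable d :=
  {T of Measurable d T & Topological T}.

HB.instance Definition _ (R : realType) := Measurable.on (Real.sort R).
HB.instance Definition _ d1 d2
    (T1 : topMeasurableType d1) (T2 : topMeasurableType d2) :=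
  Measurable.on (T1 * T2)%type.

Definition weak_cvg d (T : topMeasurableType d) (R : realType)
    (mu_ : nat -> probability T R) (mu : probability T R) : Prop :=
  forall f : T -> R, continuous f -> (exists M : R, forall x, `|f x| <= M) ->
    (\int[mu_ n]_x (f x)%:E)%E @[n --> \oo] --> (\int[mu]_x (f x)%:E)%E.

(* [0, +oo], with the metric d(x, y) = |e^(-x) - e^(-y)|: the initial
   (pseudo)metric along [expN], see [ball_ennreal]. *)
Record ennreal (R : realType) := Ennreal {
  ennval : \bar R ;
  ennval_ge0 : (0 <= ennval)%E }.

HB.instance Definition _ (R : realType) := [isSub for @ennval R].
HB.instance Definition _ (R : realType) := [Choice of ennreal R by <:].
HB.instance Definition _ (R : realType) :=
  isPointed.Build (ennreal R) (Ennreal (lexx 0%E)).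

Definition ennreal_of (R : realType) (r : R) (r0 : 0 <= r) : ennreal R :=
  @Ennreal R r%:E r0.

Definition expN (R : realType) (x : ennreal R) : R :=
  fine (expeR (- ennval x)).

HB.instance Definition _ (R : realType) :=
  PseudoMetric.copy (ennreal R) (initial_topology (@expN R)).

Lemma ball_ennreal (R : realType) (x y : ennreal R) (e : R) :
  ball x e y = (`|expN x - expN y| < e) :> Prop.
Proof. by []. Qed.

HB.instance Definition _ (R : realType) :=
  Measurable.copy (ennreal R) (g_sigma_algebraType (@open (ennreal R))).

Definition Phi (R : realType) (x : R) : R := fine (normal_prob 0 1 `]-oo, x]).

(* [normal_prob m 0] is a junk value in the library, hence the Dirac measure
   for the degenerate normal law. *)
Definition normal_law (R : realType) (m s : R) : set R -> \bar R :=
  if s == 0 then \d_m else normal_prob m s.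

Definition gaussian d (T : measurableType d) (R : realType)
    (P : probability T R) (Y : T -> R) : Prop :=
  exists m s : R, 0 <= s /\
    forall A, measurable A -> P (Y @^-1` A) = normal_law m s A.

(* Possibly degenerate: correlations -1 and 1 are allowed. *)
Definition gaussian_vector d (T : measurableType d) (R : realType)
    (P : probability T R) (X : T -> R * R) : Prop :=
  forall u v : R, gaussian P (fun w => u * (X w).1 + v * (X w).2).

Definition mutually_independent d d' (T : measurableType d)
    (T' : measurableType d') (R : realType) (P : probability T R)
    (I : finType) (X : I -> T -> T') : Prop :=
  forall (J : {set I}) (A : I -> set T'), (forall i, measurable (A i)) ->
    P (\bigcap_(i in [set` J]) (X i @^-1` A i)) =
    (\prod_(i in J) P (X i @^-1` A i))%E.

Section empirical_measure.
Local Open Scope ereal_scope.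
Context d (T : measurableType d) (R : realType) (n : nat).
Variable z : 'I_n.+1 -> T.

(* The measure (1 / N) (\d_(z_0) + ... + \d_(z_(N - 1))) with N = n + 1. *)
Definition empirical (A : set T) : \bar R :=
  (n.+1%:R^-1)%R%:E * \sum_(i < n.+1) \d_(z i) A.

Let empiricalE : empirical =
  mscale ((n.+1%:R^-1)%:nng : {nonneg R})%R (msum (fun k => \d_(z (inord k))) n.+1).
Proof.
apply/funext => A; rewrite /empirical /mscale /msum/=; congr (_ * _).
by apply: eq_bigr => i _; rewrite inord_val.
Qed.

Let empirical0 : empirical set0 = 0.
Proof. by rewrite empiricalE measure0. Qed.

Let empirical_ge0 A : 0 <= empirical A.
Proof. by rewrite empiricalE measure_ge0. Qed.

Let empirical_sigma_additive : semi_sigma_additive empirical.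
Proof. by rewrite empiricalE; exact: measure_semi_sigma_additive. Qed.

HB.instance Definition _ := isMeasure.Build _ _ _ empirical
  empirical0 empirical_ge0 empirical_sigma_additive.

Let empirical_setT : empirical [set: T] = 1.
Proof.
rewrite /empirical (eq_bigr (fun=> 1)); last by move=> i _; rewrite diracT.
by rewrite sumEFin -EFinM sumr_const card_ord mulVf// pnatr_eq0.
Qed.

HB.instance Definition _ :=
  Measure_isProbability.Build _ _ _ empirical empirical_setT.

End empirical_measure.

Section normalized_maximum.
Context d (T : measurableType d) (R : realType) (n : nat).
Variables (b : R) (X : 'I_n.+1 -> {mfun T >-> (R * R)%type}).

(* The componentwise maximum over i of b (X_i - b). *)
Definition normalized_max (w : T) : R * R :=
  (\big[Num.max/b * ((X ord0 w).1 - b)]_(i < n.+1) (b * ((X i w).1 - b)),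
   \big[Num.max/b * ((X ord0 w).2 - b)]_(i < n.+1) (b * ((X i w).2 - b))).

Let measurable_bigmax (f : 'I_n.+1 -> T -> R) (g : T -> R) :
  (forall i, measurable_fun setT (f i)) -> measurable_fun setT g ->
  measurable_fun setT (fun w => \big[Num.max/g w]_(i < n.+1) f i w).
Proof.
move=> mf mg; elim: (index_enum _) => [|i s IH].
  by under eq_fun do rewrite big_nil.
by under eq_fun do rewrite big_cons; exact: measurable_maxr.
Qed.

Let measurable_affine (h : R * R -> R) i : measurable_fun setT h ->
  measurable_fun setT (fun w => b * (h (X i w) - b)).
Proof.
move=> mh; apply: measurable_funM => //; apply: measurable_funB => //.
by apply: measurableT_comp => //; exact: measurable_funPT.
Qed.

Let measurable_normalized_max : measurable_fun setT normalized_max.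
Proof.
apply/measurable_fun_pairP; split; apply: measurable_bigmax => [i|];
  exact: measurable_affine.
Qed.

HB.instance Definition _ := isMeasurableFun.Build _ _ _ _ normalized_max
  measurable_normalized_max.

End normalized_maximum.

(* The integrand of -log F_eta at z = (lambda, (theta, gamma)), extended by its
   limits to lambda = 0 and lambda = +oo. *)
Definition integrandF (R : realType) (x y : R)
    (z : ennreal R * (R * R)) : R :=
  let theta := z.2.1 in let gamma := z.2.2 in
  match ennval z.1 with
  | r%:E =>
    if r == 0 then expR (- Num.min (x - theta) (y - gamma))
    else Phi (r + (y - x + theta - gamma) / (2 * r)) * expR (- (x - theta))
       + Phi (r - (y - x + theta - gamma) / (2 * r)) * expR (- (y - gamma))
  | _ => expR (- (x - theta)) + expR (- (y - gamma))
  end.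

Definition corr (R : realType) (sigma1 sigma2 sigma12 : R) : R :=
  sigma12 / (sigma1 * sigma2).

Definition eta_row (R : realType) (n : nat) (b : R)
    (sigma1 sigma2 sigma12 : 'I_n.+1 -> R) :
    probability (ennreal R * (R * R))%type R :=
  empirical R (fun i =>
    (ennreal_of (sqrtr_ge0
       (b ^+ 2 * (1 - corr (sigma1 i) (sigma2 i) (sigma12 i)) / 2)),
     (b ^+ 2 * (1 - (sigma1 i)^-1), b ^+ 2 * (1 - (sigma2 i)^-1)))).

(* Main.v *)
Require Import Defs.
From HB Require Import structures.
From mathcomp Require Import all_boot all_order all_algebra.
From mathcomp Require Import all_classical all_reals all_analysis.
From mathcomp Require Import measurable_realfun.
From mathcomp Require Import ring lra.

Set Implicit Arguments.
Unset Strict Implicit.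
Unset Printing Implicit Defensive.

Import Order.TTheory GRing.Theory Num.Theory.
Import numFieldNormedType.Exports.

Local Open Scope classical_set_scope.
Local Open Scope ring_scope.

(** Put k = b_n^-2.  Conditioning the standardized pair on its first component
    gives, exactly and for every row, n P(X_i <= b_n + (x, y) / b_n fails) =
    [hr_exponent k lambda x' y'] with x' = x - theta - k x theta (and similarly
    y'), an integral against e^{-t - k t^2 / 2} dt which is jointly continuous
    in (k, lambda, x', y'), with lambda in the compactified half line, and which
    is the integrand of -log F_eta at k = 0.  Since [0, +oo] is compact this
    convergence is uniform for theta, gamma in bounded sets, and the moment
    condition controls the rest, so the row averages converge to the integral
    V(x, y) against eta, each term being negligible.  By independence the
    distribution functions then converge to exp(-V).  As V(x + h, y + h) =
    e^{-h} V(x, y) there is no loss of mass, so exp(-V) is the distribution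
    function of a probability measure, obtained by Caratheodory extension from
    the semiring of half-open rectangles.

    The definition of Gaussian vectors only gives the laws of linear forms; that
    these determine the probabilities of quadrants is proved by expanding
    trigonometric polynomials that approximate indicator functions, which avoids
    the general uniqueness theorem for characteristic functions. *)

(** * The standard normal distribution function *)

(** Degenerate correlations shape the formulas. At [lambda = 0] and at correlation -1 the
    conditional variance vanishes, so a kernel of the form [Phi (w / c)] would divide by zero. The
    function [cprob c w] includes [c = 0] and is continuous on [c >= 0] except at the origin; the
    limit kernel meets the origin only for [lambda = 0] and [t = y'], one point of the integration
    variable, which dominated convergence ignores. Weak convergence of [eta_n] does not apply
    directly, since the functions averaged over row n change with n and are unbounded in theta and
    gamma. Cutoffs in theta and gamma alone reduce matters to a fixed bounded continuous integrand.
    The surplus [eps] in the moment condition serves twice: half of it absorbs the factor [1 + k x]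
    that rescaling puts on theta, the other half makes the tail small. For the limit law only
    quadrant probabilities are known to converge. Positivity and additivity on rectangles are
    inherited from the row laws by passing to the limit; the explicit form of [V] is needed only for
    right continuity and for the behaviour at infinity. *)

Section Phi_theory.
Context {R : realType}.
Notation mu := (@lebesgue_measure R).
Implicit Types (x y c w L : R).

Lemma Phi_cdf x : (Phi x)%:E = normal_prob 0 1 `]-oo, x]%classic.
Proof.
by rewrite /Phi fineK// ge0_fin_numE// (le_lt_trans (probability_le1 _ _)) ?ltry.
Qed.

Lemma Phi_ge0 x : 0 <= Phi x.
Proof. by rewrite -lee_fin Phi_cdf. Qed.

Lemma Phi_le1 x : Phi x <= 1.
Proof. by rewrite -lee_fin Phi_cdf; exact: probability_le1. Qed.

(** As a random variable under the standard normal law the identity has distribution function [Phi],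
    so the general limits of distribution functions at infinity apply. *)
Let id_rv : measurableTypeR R -> R := idfun.

#[local] HB.instance Definition _ :=
  @isMeasurableFun.Build _ _ _ _ id_rv (@measurable_id _ _ setT).

Lemma Phi_cvgy : Phi x @[x --> +oo] --> (1 : R).
Proof.
have := cvg_cdfy1 (id_rv : {RV (@normal_prob R 0 1) >-> R}).
move/fine_cvgP => [_]; apply: cvg_trans; apply: near_eq_cvg.
by apply: nearW => x; rewrite /= /cdf /distribution /pushforward/=.
Qed.

Lemma Phi_cvgNy : Phi x @[x --> -oo] --> (0 : R).
Proof.
have := cvg_cdfNy0 (id_rv : {RV (@normal_prob R 0 1) >-> R}).
move/fine_cvgP => [_]; apply: cvg_trans; apply: near_eq_cvg.
by apply: nearW => x; rewrite /= /cdf /distribution /pushforward/=.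
Qed.

Lemma is_derive_Phi x : is_derive x 1 (@Phi R) (normal_pdf 0 1 x).
Proof.
have -> : @Phi R = fun y => (\int[mu]_(t in `]-oo, y]) (normal_pdf 0 1 t))%R.
  by apply/funext => y; rewrite /Phi /normal_prob /Rintegral.
have xx1 : x < x + 1 by rewrite ltrDl.
have ipdf : mu.-integrable [set` `]-oo, x + 1]] (EFin \o normal_pdf 0 1).
  by apply: (integrableS _ _ _ (@integrable_normal_pdf R 0 1)).
have [||dF dFE] := continuous_FTC1 xx1 ipdf.
- by rewrite ltNyr.
- by apply: continuous_normal_pdf; rewrite oner_neq0.
- by apply: DeriveDef; [exact: dF|rewrite -derive1E].
Qed.

Lemma continuous_Phi : continuous (@Phi R).
Proof.
move=> x; apply: differentiable_continuous; apply/derivable1_diffP.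
by have := is_derive_Phi x => -[].
Qed.

(** Distribution function at [w] of [c] times a standard normal variable. The inequality is not
    divided by [c], so that [c = 0], a unit jump at 0, is covered as well. *)
Definition cprob c w := fine (normal_prob 0 1 [set y : R | c * y <= w]).

Lemma measurable_cprob_set c w : measurable [set y : R | c * y <= w].
Proof.
have -> : [set y : R | c * y <= w] = [set: R] `&` ( *%R c) @^-1` `]-oo, w].
  by rewrite setTI; apply/seteqP; split => y /=; rewrite in_itv.
exact: (measurable_realfun.mulrl_measurable c).
Qed.

Lemma cprobE c w : (cprob c w)%:E = normal_prob 0 1 [set y : R | c * y <= w].
Proof.
rewrite /cprob fineK// ge0_fin_numE// (le_lt_trans (probability_le1 _ _)) ?ltry//.
exact: measurable_cprob_set.
Qed.

Lemma cprob_ge0 c w : 0 <= cprob c w.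
Proof. by rewrite -lee_fin cprobE. Qed.

Lemma cprob_le1 c w : cprob c w <= 1.
Proof.
by rewrite -lee_fin cprobE; apply: probability_le1; exact: measurable_cprob_set.
Qed.

Lemma cprob_gt0 c w : 0 < c -> cprob c w = Phi (w / c).
Proof.
move=> c0; congr (fine (normal_prob _ _ _)).
by apply/seteqP; split=> y /=; rewrite in_itv/= ler_pdivlMr// mulrC.
Qed.

Lemma cprob0 w : cprob 0 w = ((0 <= w)%R)%:R.
Proof.
rewrite /cprob; have [w0|w0] := leP 0 w.
  rewrite (_ : [set _ | _] = setT) ?probability_setT//.
  by apply/seteqP; split => y //=; rewrite mul0r.
rewrite (_ : [set _ | _] = set0) ?measure0//.
by apply/seteqP; split => y //=; rewrite mul0r leNgt w0.
Qed.

(** This bound and the next one compare [w / c] with [L] without dividing; they remain true for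
    [c = 0] and give the limits of [cprob] when the ratio is unbounded or undefined. *)
Lemma Phi_le_cprob c w L : 0 <= c -> c * L <= w -> Phi L <= cprob c w.
Proof.
move=> c0 cLw; rewrite -lee_fin Phi_cdf cprobE le_measure ?inE//.
  exact: measurable_cprob_set.
move=> y /=; rewrite in_itv/= => yL; apply: le_trans cLw.
exact: ler_wpM2l.
Qed.

Lemma cprob_le_Phi c w L : 0 <= c -> w < c * L -> cprob c w <= Phi L.
Proof.
move=> c0 cLw; rewrite -lee_fin Phi_cdf cprobE le_measure ?inE//.
  exact: measurable_cprob_set.
move=> y /=; rewrite in_itv/= => yw; rewrite leNgt; apply/negP => Ly.
by have := lt_le_trans (le_lt_trans yw cLw) (ler_wpM2l c0 (ltW Ly)); rewrite ltxx.
Qed.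

End Phi_theory.

(** * The extended half line and the conditional exceedance probability *)

Section ennreal_theory.
Context {R : realType}.
Implicit Type l : ennreal R.

Lemma expN_ge0 l : 0 <= expN l.
Proof. by rewrite /expN fine_ge0// expeR_ge0. Qed.

Lemma expN_EFin r (r0 : (0 <= r%:E)%E) : expN (@Ennreal R r%:E r0) = expR (- r).
Proof. by []. Qed.

Lemma expN_infty l : ennval l = +oo%E -> expN l = 0.
Proof. by rewrite /expN => ->. Qed.

(** Topology and Borel sets of the half line come from [expN], so a point is recovered from its
    image under [expN]. *)
Lemma ennvalE l : ennval l = if expN l == 0 then +oo%E else (- ln (expN l))%:E.
Proof.
case: l => -[r r0|i|i]; last by exfalso; move: i; rewrite leeNy_eq.
  by rewrite expN_EFin gt_eqF ?expR_gt0//= expRK opprK.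
by rewrite expN_infty// eqxx.
Qed.

(** At infinity this is the default value [- ln 0 = 0]; it represents the point only when
    [expN l != 0]. *)
Definition ennval_real l : R := - ln (expN l).

Lemma ennval_real_ge0 l : 0 <= ennval_real l.
Proof.
case: l => -[r r0|i|i]; last by exfalso; move: i; rewrite leeNy_eq.
  by rewrite /ennval_real expN_EFin expRK opprK -lee_fin.
by rewrite /ennval_real expN_infty// ln0// oppr0.
Qed.

Lemma expN_le1 l : expN l <= 1.
Proof.
have := ennval_real_ge0 l; rewrite /ennval_real oppr_ge0.
have [/eqP ->//|l0] := boolP (expN l == 0).
by rewrite -ln1 ler_ln// ?posrE// lt0r l0 expN_ge0.
Qed.

Lemma ennval_fin l : expN l != 0 -> ennval l = (ennval_real l)%:E.
Proof. by rewrite ennvalE => /negbTE ->. Qed.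

Lemma cvg_expN (T : Type) (F : set_system T) {FF : Filter F}
  (f : T -> ennreal R) l : f x @[x --> F] --> l -> expN (f x) @[x --> F] --> expN l.
Proof.
move=> fl; apply/cvgrPdist_lt => e e0.
exact: (fl _ (nbhsx_ballx l e e0)).
Qed.

End ennreal_theory.

Section huesler_reiss.
Context {R : realType}.
Notation mu := (@lebesgue_measure R).
Implicit Types (k x y t c w L : R) (l : ennreal R).

(** The second hypothesis expresses that [w n / c n] tends to [+oo], in a form that makes sense when
    some [c n] are 0. *)
Lemma cprob_cvg1 (c w : nat -> R) : (forall n, 0 <= c n) ->
  (forall L, \forall n \near \oo, c n * L <= w n) ->
  cprob (c n) (w n) @[n --> \oo] --> (1 : R).
Proof.
move=> c0 cw; apply/cvgrPdist_le => e e0.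
have [L LP] : exists L, 1 - e < @Phi R L.
  have /cvgr_gt : @Phi R x @[x --> +oo] --> (1:R) := Phi_cvgy.
  move=> /(_ (1 - e)); rewrite ltrBlDr ltrDl => /(_ e0) [M [_ MP]].
  by exists (M + 1); apply: MP; rewrite ltrDl.
near=> n.
have cL : c n * L <= w n by near: n; exact: cw.
rewrite ger0_norm ?subr_ge0 ?cprob_le1// lerBlDr addrC -lerBlDr.
by rewrite (le_trans (ltW LP))// Phi_le_cprob.
Unshelve. all: by end_near. Qed.

Lemma cprob_cvg0 (c w : nat -> R) : (forall n, 0 <= c n) ->
  (forall L, \forall n \near \oo, w n < c n * L) ->
  cprob (c n) (w n) @[n --> \oo] --> (0 : R).
Proof.
move=> c0 cw; apply/cvgrPdist_le => e e0.
have [L LP] : exists L, @Phi R L < e.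
  have /cvgr_lt : @Phi R x @[x --> -oo] --> (0:R) := Phi_cvgNy.
  move=> /(_ e e0) [M [_ MP]].
  by exists (M - 1); apply: MP; rewrite ltrBlDr ltrDl.
near=> n.
have cL : w n < c n * L by near: n; exact: cw.
by rewrite sub0r normrN ger0_norm ?cprob_ge0// (le_trans _ (ltW LP))// cprob_le_Phi.
Unshelve. all: by end_near. Qed.

(** If [c' = 0] and [w' != 0], the ratio of the parameters diverges with the sign of [w'], and the
    limit 1 or 0 is the value of the unit jump. If [c' > 0], continuity of [Phi] suffices. *)
Lemma cprob_cvg (c w : nat -> R) (c' w' : R) : (forall n, 0 <= c n) ->
  c n @[n --> \oo] --> c' -> w n @[n --> \oo] --> w' ->
  (c' != 0) || (w' != 0) ->
  cprob (c n) (w n) @[n --> \oo] --> cprob c' w'.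
Proof.
move=> c0 cc ww.
have c'0 : 0 <= c' by apply: (cvgr_to_ge cc); exact: nearW.
move: (c'0); rewrite le_eqVlt => /predU1P[c'E|c'gt0 _].
  rewrite -c'E eqxx/= => w'0; rewrite cprob0.
  have cL L : c n * L @[n --> \oo] --> (0 : R).
    by rewrite -(mul0r L) c'E; exact: cvgMr_tmp.
  have [w'ge0|w'lt0] /= := leP 0 w'.
    apply: cprob_cvg1 => // L.
    have w'gt0 : 0 < w' by rewrite lt0r w'0.
    near=> n; apply: (@le_trans _ _ (w' / 2)).
      by near: n; have /cvgr_le := (cL L); apply; lra.
    by near: n; have /cvgr_ge := ww; apply; lra.
  apply: cprob_cvg0 => // L.
  near=> n; apply: (@lt_trans _ _ (w' / 2)).
    by near: n; have /cvgr_lt := ww; apply; lra.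
  by near: n; have /cvgr_gt := (cL L); apply; lra.
rewrite cprob_gt0//.
have : Phi (w n / c n) @[n --> \oo] --> Phi (w' / c').
  apply: continuous_cvg; first exact: continuous_Phi.
  by apply: cvgM => //; apply: cvgV => //; rewrite gt_eqF.
apply: cvg_trans; apply: near_eq_cvg; near=> n.
by rewrite cprob_gt0//; near: n; have /cvgr_gt := cc; apply.
Unshelve. all: by end_near. Qed.

(** For [k = b^-2] and [b = n phi(b)] this is [(n / b) phi(b + t / b)], the rescaled normal density
    around the level [b]. *)
Definition hr_weight k t := expR (- t - k * t ^+ 2 / 2).

(* [hr_kernel (b^-2) l y t] is the conditional probability that
   [b (Z2 - b) <= y] given [b (Z1 - b) = t], where [Z] is a standard Gaussian
   pair with correlation [1 - 2 l^2 / b^2]; at [k = 0] it is its limit as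
   [b -> oo]. *)
Definition hr_kernel k l y t : R :=
  if ennval l is r%:E then
    cprob (2 * r * Num.sqrt (1 - k * r ^+ 2)) (y - t + 2 * r ^+ 2 * (1 + k * t))
  else 1.

Lemma hr_kernel_ge0 k l y t : 0 <= hr_kernel k l y t.
Proof. by rewrite /hr_kernel; case: (ennval l) => // r; exact: cprob_ge0. Qed.

Lemma hr_kernel_le1 k l y t : hr_kernel k l y t <= 1.
Proof. by rewrite /hr_kernel; case: (ennval l) => // r; exact: cprob_le1. Qed.

(** For [l' = 0] the limit kernel is the indicator of [t <= y'], which jumps at [t = y']; hence the
    last hypothesis. For [l'] infinite the quadratic term of the threshold beats the scale, which
    grows at most linearly in [r]. *)
Lemma hr_kernel_cvg (k y : nat -> R) (l : nat -> ennreal R) l' y' t :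
  (forall n, 0 <= k n) -> (forall n r, ennval (l n) = r%:E -> k n * r ^+ 2 <= 1) ->
  k n @[n --> \oo] --> (0 : R) -> y n @[n --> \oo] --> y' ->
  l n @[n --> \oo] --> l' -> t != y' ->
  hr_kernel (k n) (l n) (y n) t @[n --> \oo] --> hr_kernel 0 l' y' t.
Proof.
move=> k0 kl kcvg ycvg /cvg_expN lcvg ty.
pose r n := ennval_real (l n).
pose c n := 2 * r n * Num.sqrt (1 - k n * r n ^+ 2).
pose w n := y n - t + 2 * r n ^+ 2 * (1 + k n * t).
have c0 n : 0 <= c n by rewrite /c !mulr_ge0// ennval_real_ge0.
have hrE n : expN (l n) != 0 -> hr_kernel (k n) (l n) (y n) t = cprob (c n) (w n).
  by move=> l0; rewrite /hr_kernel (ennval_fin l0).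
have [/eqP l'0|l'0] := boolP (expN l' == 0).
  have -> : hr_kernel 0 l' y' t = 1 by rewrite /hr_kernel ennvalE l'0 eqxx.
  (* Indices with [l n] infinite have kernel 1, which is [cprob 0 0]; with this replacement the
     whole sequence has the form [cprob]. *)
  pose c1 n := if expN (l n) == 0 then 0 else c n.
  pose w1 n := if expN (l n) == 0 then 0 else w n.
  have : cprob (c1 n) (w1 n) @[n --> \oo] --> (1 : R).
    apply: cprob_cvg1 => [n|L]; first by rewrite /c1; case: ifP.
    pose M := `|y' - t| + 1.
    have M0 : 1 <= M by rewrite /M; have := normr_ge0 (y' - t); lra.
    (* For [r >= B] and [r >= 1] one has [r^2 >= r B >= 2 r |L| + M]. This pays for the scale, at
       most [2 r], times [|L|] and for [y - t >= - M]. *)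
    pose B := 2 * `|L| + M.
    have B0 : 1 <= B by rewrite /B; have := normr_ge0 L; lra.
    near=> n; rewrite /c1 /w1; case: ifPn => [_|l0]; first by rewrite mul0r.
    have rB : B <= r n.
      rewrite /r /ennval_real lerNr -(expRK (- B)) ler_ln ?posrE ?expR_gt0//.
        near: n; have /cvgr_le := lcvg; apply.
        by rewrite l'0 expR_gt0.
      by rewrite lt0r l0 expN_ge0.
    have yM : - M <= y n - t.
      near: n; have /cvgr_ge : y n - t @[n --> \oo] --> y' - t
        by apply: cvgB => //; exact: cvg_cst.
      apply; rewrite /M; have := ler_norm (- (y' - t)); rewrite normrN; lra.
    have kt : 1 / 2 <= 1 + k n * t.
      near: n; have /cvgr_ge : 1 + k n * t @[n --> \oo] --> 1 + 0 * t.
        by apply: cvgD; [exact: cvg_cst|exact: cvgMr_tmp].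
      by apply; lra.
    apply: (@le_trans _ _ (2 * r n * `|L|)).
      apply: (@le_trans _ _ (c n * `|L|)).
        by rewrite ler_wpM2l// ler_norm.
      rewrite ler_wpM2r// /c ler_piMr// ?mulr_ge0 ?ennval_real_ge0//.
      rewrite -[leRHS]sqrtr1 ler_wsqrtr// lerBlDr lerDl mulr_ge0//.
      exact: sqr_ge0.
    have r1 : 1 <= r n by lra.
    have rr : r n * B <= r n * r n by rewrite ler_wpM2l//; lra.
    have rM : M <= r n * M by rewrite ler_peMl//; lra.
    have : r n ^+ 2 * 1 <= r n ^+ 2 * (2 * (1 + k n * t)).
      by rewrite ler_wpM2l ?sqr_ge0//; lra.
    rewrite /w /B in rr *; rewrite expr2; nra.
  apply: cvg_trans; apply: near_eq_cvg; apply: nearW => n.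
  rewrite /c1 /w1; case: ifPn => [l0|l0]; last by rewrite hrE.
  by rewrite cprob0 lexx /hr_kernel ennvalE l0.
have lgt0 : 0 < expN l' by rewrite lt0r l'0 expN_ge0.
have rcvg : r n @[n --> \oo] --> ennval_real l'.
  by apply: cvgN; apply: continuous_cvg => //; exact: continuous_ln.
have -> : hr_kernel 0 l' y' t = cprob (2 * ennval_real l')
    (y' - t + 2 * ennval_real l' ^+ 2).
  by rewrite /hr_kernel (ennval_fin l'0) !mul0r subr0 sqrtr1 mulr1 addr0 mulr1.
have rrcvg : r n ^+ 2 @[n --> \oo] --> ennval_real l' ^+ 2.
  by rewrite expr2; under eq_fun do rewrite expr2; exact: cvgM.
have : cprob (c n) (w n) @[n --> \oo] -->
    cprob (2 * ennval_real l') (y' - t + 2 * ennval_real l' ^+ 2).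
  apply: cprob_cvg => //.
  - rewrite -[X in _ --> X]mulr1; apply: cvgM; first exact: cvgMl_tmp.
    rewrite -[X in _ --> X]sqrtr1; apply: continuous_cvg; first exact: sqrt_continuous.
    rewrite -[X in _ --> X]subr0; apply: cvgB; first exact: cvg_cst.
    by rewrite -(mul0r (ennval_real l' ^+ 2)); exact: cvgM.
  - apply: cvgD; first by apply: cvgB => //; exact: cvg_cst.
    rewrite -[X in _ --> X]mulr1; apply: cvgM; first exact: cvgMl_tmp.
    rewrite -[X in _ --> X]addr0; apply: cvgD; first exact: cvg_cst.
    by rewrite -(mul0r t); exact: cvgMr_tmp.
  - have [/eqP|//] := boolP (2 * _ == 0) => /eqP.
    rewrite mulf_eq0 pnatr_eq0/= => /eqP ->.
    by rewrite expr0n/= mulr0 addr0 subr_eq0 eq_sym.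
apply: cvg_trans; apply: near_eq_cvg; near=> n; rewrite hrE//.
by near: n; have /cvgr_neq0 := lcvg; apply.
Unshelve. all: by end_near. Qed.

End huesler_reiss.

(** * The exponent function and its continuity *)

Section huesler_reiss_integral.
Context {R : realType}.
Notation mu := (@lebesgue_measure R).
Implicit Types (k x y t c w L : R) (l : ennreal R).
Local Notation hr_weight := (@hr_weight R).

Lemma measurable_hr_weight k : measurable_fun setT (hr_weight k).
Proof.
apply: measurableT_comp => //; apply: measurable_funB.
  exact: oppr_measurable.
by apply: measurable_funM => //; apply: measurable_funM => //; exact: measurable_funX.
Qed.

Lemma measurable_hr_kernel k l y : measurable_fun setT (hr_kernel k l y).
Proof.
rewrite /hr_kernel; case: (ennval l) => // r.
pose c := 2 * r * Num.sqrt (1 - k * r ^+ 2).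
apply: (@measurableT_comp _ _ _ _ _ _ (cprob c)); last first.
  apply: measurable_funD; first exact: measurable_funB.
  by apply: measurable_funM => //; apply: measurable_funD => //; exact: measurable_funM.
apply: nondecreasing_measurable => // w w' ww'.
rewrite -lee_fin !cprobE le_measure ?inE//; [exact: measurable_cprob_set..|].
by move=> z /= /le_trans; apply.
Qed.

Lemma hr_weight_ge0 k t : 0 <= hr_weight k t.
Proof. exact: expR_ge0. Qed.

Lemma hr_weight_le k t : 0 <= k -> hr_weight k t <= expR (- t).
Proof. by move=> k0; rewrite ler_expR gerDl oppr_le0 divr_ge0// mulr_ge0// sqr_ge0. Qed.

Lemma hr_weight0 t : hr_weight 0 t = expR (- t).
Proof. by rewrite /hr_weight !mul0r subr0. Qed.

Lemma integral_expRN_y x : (\int[mu]_(t in `]x, +oo[) (expR (- t))%:E = (expR (- x))%:E)%E.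
Proof.
have dF t : is_derive t 1 (fun z : R => - expR (- z)) (expR (- t)).
  have := @is_derive1_comp R (fun z => - expR z) (fun z => - z) t (- expR (- t)) (-1) _ _.
  by rewrite mulrN1 opprK; apply.
rewrite integral_itv_obnd_cbnd; last first.
  by apply/measurable_EFinP; apply: measurable_funTS; exact: measurableT_comp.
rewrite (@ge0_continuous_FTC2y R _ (fun z : R => - expR (- z)) x 0).
- by rewrite sub0e -EFinN opprK.
- by move=> t _; exact: expR_ge0.
- apply: continuous_subspaceT => t.
  by apply: continuous_comp; [exact: opp_continuous|exact: continuous_expR].
- by rewrite -oppr0; apply: cvgN; exact: cvgr_expR.
- by move=> t _; case: (dF t).
- apply: cvg_at_right_filter; apply: cvgN; apply: continuous_cvg.
    exact: continuous_expR.
  exact: opp_continuous.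
- by move=> t _; rewrite derive1E; exact: derive_val.
Qed.

Local Open Scope ereal_scope.

Definition hr_tail k x := \int[mu]_(t in `]x, +oo[) (hr_weight k t)%:E.

Definition hr_joint k l x y :=
  \int[mu]_(t in `]x, +oo[) (hr_weight k t * hr_kernel k l y t)%:E.

(** The failure of the two bounds is split into disjoint events: the second coordinate exceeds its
    bound ([hr_tail]), or only the first one does ([hr_joint]). The roles of the coordinates differ
    because one conditions on the first. *)
Definition hr_exponent k l x y := hr_tail k y + hr_joint k l x y.

Let meas_w k (D : set R) : measurable_fun D (fun t => (hr_weight k t)%:E).
Proof. by apply: measurable_funTS; apply/measurable_EFinP; exact: measurable_hr_weight. Qed.

Let meas_wk k l y (D : set R) :
  measurable_fun D (fun t => (hr_weight k t * hr_kernel k l y t)%:E).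
Proof.
apply: measurable_funTS; apply/measurable_EFinP; apply: measurable_funM.
  exact: measurable_hr_weight.
exact: measurable_hr_kernel.
Qed.

Let meas_e (D : set R) : measurable_fun D (fun t : R => (expR (- t))%:E).
Proof. by apply: measurable_funTS; apply/measurable_EFinP; exact: measurableT_comp. Qed.

Lemma hr_tail_ge0 k x : 0 <= hr_tail k x.
Proof. by apply: integral_ge0 => t _; rewrite lee_fin hr_weight_ge0. Qed.

Lemma hr_joint_ge0 k l x y : 0 <= hr_joint k l x y.
Proof.
by apply: integral_ge0 => t _; rewrite lee_fin mulr_ge0 ?hr_weight_ge0 ?hr_kernel_ge0.
Qed.

Lemma hr_exponent_ge0 k l x y : 0 <= hr_exponent k l x y.
Proof. by rewrite adde_ge0 ?hr_tail_ge0 ?hr_joint_ge0. Qed.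

Lemma hr_tail_le k x : (0 <= k)%R -> hr_tail k x <= (expR (- x))%:E.
Proof.
move=> k0; rewrite -integral_expRN_y; apply: ge0_le_integral => //.
- by move=> t _; rewrite lee_fin hr_weight_ge0.
- exact: meas_w.
- exact: meas_e.
- by move=> t _; rewrite lee_fin hr_weight_le.
Qed.

Lemma hr_joint_le k l x y : (0 <= k)%R -> hr_joint k l x y <= (expR (- x))%:E.
Proof.
move=> k0; rewrite -integral_expRN_y; apply: ge0_le_integral => //.
- by move=> t _; rewrite lee_fin mulr_ge0 ?hr_weight_ge0 ?hr_kernel_ge0.
- exact: meas_wk.
- exact: meas_e.
- move=> t _; rewrite lee_fin (le_trans _ (hr_weight_le t k0))//.
  by rewrite ler_piMr ?hr_weight_ge0 ?hr_kernel_le1.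
Qed.

Lemma hr_exponent_le k l x y : (0 <= k)%R ->
  hr_exponent k l x y <= (expR (- x) + expR (- y))%:E.
Proof. by move=> k0; rewrite addrC EFinD leeD ?hr_tail_le ?hr_joint_le. Qed.

Lemma hr_exponent_fin_num k l x y : (0 <= k)%R -> hr_exponent k l x y \is a fin_num.
Proof.
move=> k0; rewrite ge0_fin_numE ?hr_exponent_ge0//.
by rewrite (le_lt_trans (hr_exponent_le _ _ _ k0))// ltry.
Qed.

Lemma hr_tail0 x : hr_tail 0 x = (expR (- x))%:E.
Proof. by rewrite /hr_tail; under eq_integral do rewrite hr_weight0; exact: integral_expRN_y. Qed.

(** Dominated convergence with a moving endpoint. A convergent sequence [x] is bounded below by some
    [B], so [exp (- t)] on []B, +oo[] dominates; the point [x'] joins the exceptional set because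
    the indicators of []x n, +oo[] need not converge there. *)
Lemma cvg_integral_tail (x : R^nat) x' (f : nat -> R -> R) (g : R -> R) (A : set R) :
  finite_set A ->
  (forall n, measurable_fun setT (f n)) -> measurable_fun setT g ->
  (forall n t, 0 <= f n t <= expR (- t))%R ->
  x n @[n --> \oo] --> x' ->
  (forall t, ~ A t -> f n t @[n --> \oo] --> g t) ->
  \int[mu]_(t in `]x n, +oo[) (f n t)%:E @[n --> \oo] -->
  \int[mu]_(t in `]x', +oo[) (g t)%:E.
Proof.
move=> fA mf mg f01 xx' fg.
have [B BP] : exists B, forall n, (B <= x n)%R.
  have /cvg_seq_bounded[M [_ MP]] : cvgn x by apply/cvg_ex; exists x'.
  exists (- (M + 1))%R => n.
  have := MP (M + 1)%R; rewrite ltrDl ltr01 => /(_ isT n Logic.I).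
  by move=> /=; rewrite ler_norml => /andP[].
pose h := (fun t : R => (expR (- t))%:E) \_ `]B, +oo[.
under eq_fun do rewrite integral_mkcond.
rewrite integral_mkcond.
have mh : measurable_fun setT h by apply/(measurable_restrictT _ _).1.
have [|||||_ _] := @dominated_convergence _ _ R mu setT measurableT
  (fun n => (fun t => (f n t)%:E) \_ `]x n, +oo[)
  ((fun t => (g t)%:E) \_ `]x', +oo[) h; last exact.
- move=> n; apply/(measurable_restrictT _ _).1 => //.
  by apply: measurable_funTS; apply/measurable_EFinP; exact: mf.
- apply/(measurable_restrictT _ _).1 => //.
  by apply: measurable_funTS; apply/measurable_EFinP; exact: mg.
- have cA : countable (A `|` [set x']).
    by apply: finite_set_countable; rewrite finite_setU; split.
  exists (A `|` [set x']); split.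
  + by apply: countable_measurable.
  + exact: countable_lebesgue_measure0.
  move=> t /=; apply: contra_notP => /not_orP[nAt tx'] _.
  rewrite /patch !mem_setE !in_itv/= !andbT.
  have [x't|tx'1] := ltP x' t.
    have : (f n t)%:E @[n --> \oo] --> (g t)%:E by apply: cvg_EFin; [exact: nearW|exact: fg].
    apply: cvg_trans; apply: near_eq_cvg; near=> n.
    rewrite mem_setE in_itv/= andbT ifT//.
    by near: n; have /cvgr_lt := xx'; apply.
  apply: cvg_near_cst; near=> n.
  rewrite mem_setE in_itv/= andbT ifF//; apply/negbTE; rewrite -leNgt ltW//.
  near: n; have /cvgr_gt := xx'; apply.
  by rewrite lt_neqAle tx'1 andbT; apply/eqP.
- rewrite /h -integrable_mkcond//; apply/integrableP; split; first exact: meas_e.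
  under eq_integral do rewrite /= ger0_norm ?expR_ge0//.
  by rewrite integral_expRN_y ltry.
- apply: aeW => t n _; rewrite /h /patch !mem_setE !in_itv/= !andbT.
  have /andP[f0 f1] := f01 n t.
  case: ifPn => [xt|_]; last by rewrite abse0; case: ifP.
  by rewrite ifT ?(le_lt_trans (BP n))// lee_fin ger0_norm.
Unshelve. all: by end_near. Qed.

Lemma hr_weight_cvg (k : R^nat) t : k n @[n --> \oo] --> (0 : R)%R ->
  hr_weight (k n) t @[n --> \oo] --> hr_weight 0 t.
Proof.
move=> kcvg; apply: continuous_cvg; first exact: continuous_expR.
apply: cvgB; first exact: cvg_cst.
by apply: cvgMr_tmp; exact: cvgMr_tmp.
Qed.

Lemma hr_exponent_cvg (k x y : R^nat) (l : nat -> ennreal R) l' x' y' :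
  (forall n, 0 <= k n)%R -> (forall n r, ennval (l n) = r%:E -> k n * r ^+ 2 <= 1)%R ->
  k n @[n --> \oo] --> (0 : R)%R ->
  x n @[n --> \oo] --> x' -> y n @[n --> \oo] --> y' ->
  l n @[n --> \oo] --> l' ->
  hr_exponent (k n) (l n) (x n) (y n) @[n --> \oo] --> hr_exponent 0 l' x' y'.
Proof.
move=> k0 kl kcvg xcvg ycvg lcvg; apply: cvgeD => //.
- by rewrite fin_num_adde_defr// hr_tail0.
- apply: (@cvg_integral_tail y y' _ _ set0) => //.
  + by move=> n; exact: measurable_hr_weight.
  + exact: measurable_hr_weight.
  + by move=> n t; rewrite hr_weight_ge0 hr_weight_le.
  + by move=> t _; exact: hr_weight_cvg.
- apply: (@cvg_integral_tail x x' _ _ [set y']) => //.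
  + by move=> n; apply: measurable_funM; [exact: measurable_hr_weight|exact: measurable_hr_kernel].
  + by apply: measurable_funM; [exact: measurable_hr_weight|exact: measurable_hr_kernel].
  + move=> n t; rewrite mulr_ge0 ?hr_weight_ge0 ?hr_kernel_ge0//=.
    rewrite (le_trans _ (hr_weight_le t (k0 n)))//.
    by rewrite ler_piMr ?hr_weight_ge0 ?hr_kernel_le1.
  + move=> t /= /eqP ty'; apply: cvgM; first exact: hr_weight_cvg.
    exact: hr_kernel_cvg.
Qed.

End huesler_reiss_integral.

(** * The integrand of the limiting exponent *)

Section huesler_reiss_closed_form.
Context {R : realType}.
Notation mu := (@lebesgue_measure R).
Implicit Types (x y t r : R) (l : ennreal R).

(** With [u = (y - t) / (2 r)] one has [(r + u)^2 - (r - u)^2 = 4 r u = 2 (y - t)], which accounts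
    for the two exponential factors. This identity cancels the density terms in the derivative of
    the antiderivative below. *)
Lemma expR_normal_pdf r y t : r != 0 ->
  expR (- t) * normal_pdf 0 1 (r + (y - t) / (2 * r)) =
  expR (- y) * normal_pdf 0 1 (r - (y - t) / (2 * r)).
Proof.
move=> r0; rewrite normal_pdfE ?oner_neq0// /normal_fun.
rewrite mulrCA -expRD [RHS]mulrCA -expRD; congr (_ * expR _).
by rewrite !subr0 expr1n -[1 *+ 2]/(2%:R); field.
Qed.

Lemma is_derive_Phi_affine a c t :
  is_derive t 1 (fun z : R => Phi (a + c * z)) (normal_pdf 0 1 (a + c * t) * c).
Proof.
apply: (@is_derive1_comp R (@Phi R) (fun z => a + c * z)).
  exact: is_derive_Phi.
apply: is_derive_eq.
by rewrite add0r mul1r /GRing.scale/= mulr1.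
Qed.

Lemma is_derive_expRN t : is_derive t 1 (fun z : R => expR (- z)) (- expR (- t)).
Proof.
have := @is_derive1_comp R expR (fun z => - z) t (expR (- t)) (-1) _ _.
by rewrite mulrN1; apply.
Qed.

Lemma hr_joint0_gt0 l x y r : ennval l = r%:E -> 0 < r ->
  hr_joint 0 l x y =
  (Phi (r + (y - x) / (2 * r)) * expR (- x) +
   Phi (r - (y - x) / (2 * r)) * expR (- y) - expR (- y))%:E.
Proof.
move=> lr r0.
pose f t := expR (- t) * Phi (r + (y - t) / (2 * r)).
(* An antiderivative of [f]: the first term comes from integrating [exp (- t)] by parts, and by the
   density identity the second removes the remaining density. It tends to [- expR (- y)] at
   infinity. *)
pose F t := - (expR (- t) * Phi (r + (y - t) / (2 * r)))
            - expR (- y) * Phi (r - (y - t) / (2 * r)).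
pose c := (2 * r)^-1.
have r20 : 2 * r != 0 by rewrite mulf_neq0 ?pnatr_eq0// gt_eqF.
have fE t : f t = expR (- t) * Phi (r + y * c + (- c) * t).
  by rewrite /f /c; congr (_ * Phi _); field; rewrite gt_eqF.
have FE : F = (fun t => - (expR (- t) * Phi (r + y * c + (- c) * t))
            - expR (- y) * Phi (r - y * c + c * t)).
  apply/funext => t; rewrite /F /c.
  by congr (- (_ * Phi _) - _ * Phi _); field; rewrite gt_eqF.
have dF t : is_derive t 1 F (f t).
  rewrite FE; have d1 := is_derive_Phi_affine (r + y * c) (- c) t.
  have d2 := is_derive_Phi_affine (r - y * c) c t.
  have d3 := is_derive_expRN t.
  apply: is_derive_eq.
  have /(_ r y t) := expR_normal_pdf; rewrite gt_eqF// => /(_ isT).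
  have -> : r + (y - t) / (2 * r) = r + y * c + - c * t.
    by rewrite /c; field; rewrite gt_eqF.
  have -> : r - (y - t) / (2 * r) = r - y * c + c * t.
    by rewrite /c; field; rewrite gt_eqF.
  rewrite fE /GRing.scale/=; move: (Phi _) (expR (-t)) (normal_pdf _ _ _) (normal_pdf _ _ _) (expR (-y)).
  move=> p1 e1 n1 n2 e2 h.
  have -> : - (e1 * (n2 * - c) + p1 * - e1) - e2 * (n1 * c) =
    c * (e1 * n2 - e2 * n1) + e1 * p1 by ring.
  by rewrite h subrr mulr0 add0r.
have cf : continuous f.
  move=> t; apply: cvgM.
    by apply: continuous_comp; [exact: opp_continuous|exact: continuous_expR].
  apply: continuous_cvg; first exact: continuous_Phi.
  apply: cvgD; first exact: cvg_cst.
  by apply: cvgMr_tmp; apply: cvgB; [exact: cvg_cst|exact: cvg_id].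
have cF : {for x, continuous F}.
  by apply: differentiable_continuous; apply/derivable1_diffP; case: (dF x).
rewrite /hr_joint.
have -> : (\int[mu]_(t in `]x, +oo[) (hr_weight 0 t * hr_kernel 0 l y t)%:E =
           \int[mu]_(t in `]x, +oo[) (f t)%:E)%E.
  apply: eq_integral => t _; congr EFin; rewrite hr_weight0 /hr_kernel lr.
  rewrite !mul0r subr0 sqrtr1 mulr1 addr0 mulr1 cprob_gt0 ?mulr_gt0//.
  by congr (_ * Phi _); field; rewrite gt_eqF.
rewrite integral_itv_obnd_cbnd; last first.
  by apply/measurable_EFinP; apply: measurable_funTS; exact: continuous_measurable_fun.
rewrite (@ge0_continuous_FTC2y R f F x (- expR (- y))).
- by rewrite -EFinB; congr EFin; rewrite /F; ring.
- by move=> t _; rewrite mulr_ge0 ?expR_ge0 ?Phi_ge0.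
- exact: continuous_subspaceT.
- rewrite /F.
  have -> : - expR (- y) = - (0 : R) - expR (- y) * 1 by ring.
  apply: cvgB.
    apply: cvgN.
    apply: (@squeeze_cvgr _ _ _ _ (cst 0) (fun t => expR (- t))).
    + apply: nearW => t; rewrite mulr_ge0 ?expR_ge0 ?Phi_ge0//=.
      by rewrite ler_piMr ?expR_ge0 ?Phi_le1.
    + exact: cvg_cst.
    + exact: cvgr_expR.
  apply: cvgMl_tmp.
  apply: (@cvg_comp _ _ _ (fun t => r - (y - t) / (2 * r)) (@Phi R) _ (+oo : set_system R)).
    apply/cvgryPge => A; near=> t.
    have : y + 2 * r * (A - r) <= t by near: t; apply: nbhs_pinfty_ge; rewrite num_real.
    move=> h; rewrite -[leRHS]opprK lerNr opprB lerBlDr ler_pdivrMr ?mulr_gt0//.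
    by nra.
  exact: Phi_cvgy.
- by move=> t _; case: (dF t).
- exact: cvg_at_right_filter.
- by move=> t _; rewrite derive1E; have [] := dF t.
Unshelve. all: by end_near. Qed.

(** At [lambda = 0] the kernel is the indicator of [t <= y], so the joint part lives on the points
    of []x, +oo[] up to [y] and the tail on []y, +oo[]; together they fill []min(x, y), +oo[]. *)
Lemma hr_joint0_eq0 l x y : ennval l = 0%E ->
  (hr_tail 0 y + hr_joint 0 l x y = (expR (- Num.min x y))%:E)%E.
Proof.
move=> l0; rewrite -integral_expRN_y.
have -> : `](Num.min x y), +oo[%classic =
    `]y, +oo[ `|` (`]x, +oo[ `&` `]-oo, y]).
  apply/seteqP; split => t /=; rewrite !in_itv/= !andbT gt_min.
    have [yt _|ty /orP[|//] xt] := ltP y t; first by left.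
    by right.
  by move=> [->|[->]]; rewrite ?orbT.
rewrite ge0_integral_setU//=.
- congr (_ + _)%E; first by apply: eq_integral => t _; rewrite hr_weight0.
  rewrite setIC integral_mkcondl; apply: eq_integral => t _.
  rewrite hr_weight0 /hr_kernel l0 /= expr0n/= !(mulr0, mul0r) addr0 cprob0.
  rewrite /patch mem_setE in_itv/= subr_ge0.
  by case: ifPn => _; rewrite ?mulr1 ?mulr0.
- by apply: measurableI.
- by apply/measurable_EFinP; apply: measurable_funTS; exact: measurableT_comp.
- apply/disj_setPS => t /= []; rewrite !in_itv/= andbT => yt [_].
  by rewrite leNgt yt.
Qed.

(** The [expR (- y)] subtracted in the closed form of [hr_joint] is exactly [hr_tail 0 y]. The
    conventions at 0 and infinity thus appear as values of a single integral formula, and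
    continuity, bounds and positivity can be read off it. *)
Lemma integrandFE x y (z : ennreal R * (R * R)) :
  (integrandF x y z)%:E = hr_exponent 0 z.1 (x - z.2.1) (y - z.2.2).
Proof.
case: z => l [th ga] /=; rewrite /hr_exponent /integrandF/=.
case lE : (ennval l) => [r| |].
- have r_ge0 : 0 <= r by rewrite -lee_fin -lE; exact: ennval_ge0.
  have [r0|r0] := eqVneq r 0.
    by rewrite hr_joint0_eq0// lE r0.
  have rgt0 : 0 < r by rewrite lt0r r0.
  rewrite (hr_joint0_gt0 _ _ lE)// hr_tail0 -EFinD; congr EFin.
  have -> : y - ga - (x - th) = y - x + th - ga by ring.
  by ring.
- rewrite hr_tail0 /hr_joint addrC EFinD; congr (_ + _)%E.
  rewrite -integral_expRN_y; apply: eq_integral => t _.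
  by rewrite hr_weight0 /hr_kernel lE mulr1.
- by exfalso; have := ennval_ge0 l; rewrite lE leeNy_eq.
Qed.

Lemma integrandF_ge0 x y (z : ennreal R * (R * R)) : 0 <= integrandF x y z.
Proof. by rewrite -lee_fin integrandFE hr_exponent_ge0. Qed.

Lemma integrandF_le x y (z : ennreal R * (R * R)) :
  integrandF x y z <= expR (- (x - z.2.1)) + expR (- (y - z.2.2)).
Proof. by rewrite -lee_fin integrandFE hr_exponent_le. Qed.

(** Only the tail part is kept. Together with its mirror image this makes the limiting distribution
    function vanish when either coordinate tends to minus infinity. *)
Lemma integrandF_ge2 x y (z : ennreal R * (R * R)) :
  expR (- (y - z.2.2)) <= integrandF x y z.
Proof. by rewrite -lee_fin integrandFE -hr_tail0 leeDl// hr_joint_ge0. Qed.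

(** Conditioning on the first coordinate hides this symmetry; it is visible only in the closed
    form. *)
Lemma integrandF_sym x y l th ga :
  integrandF x y (l, (th, ga)) = integrandF y x (l, (ga, th)).
Proof.
rewrite /integrandF/=; case: (ennval l) => [r| |]; [|exact: addrC..].
case: ifP => _; first by rewrite minC.
rewrite addrC; congr (Phi _ * _ + Phi _ * _).
  by rewrite -mulNr; congr (_ + _ / _); ring.
by rewrite -[X in r + X]opprK -mulNr; congr (_ - _ / _); ring.
Qed.

Lemma integrandF_ge1 x y (z : ennreal R * (R * R)) :
  expR (- (x - z.2.1)) <= integrandF x y z.
Proof. by case: z => l [th ga]; rewrite integrandF_sym; exact: (integrandF_ge2 y x (l, (ga, th))). Qed.

Lemma integrandFD x y h (z : ennreal R * (R * R)) :
  integrandF (x + h) (y + h) z = expR (- h) * integrandF x y z.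
Proof.
have e u v : expR (- (u + h - v)) = expR (- h) * expR (- (u - v)).
  by rewrite -expRD; congr expR; ring.
rewrite /integrandF; case: (ennval z.1) => [r| |]; rewrite ?e ?mulrDr//.
case: ifP => _.
  rewrite -expRD; congr expR; rewrite /Num.min.
  have -> : (x + h - z.2.1 < y + h - z.2.2) = (x - z.2.1 < y - z.2.2).
    by rewrite addrAC [y + h - _]addrAC ltrD2r.
  by case: ifP => _; ring.
have -> : y + h - (x + h) = y - x by ring.
by ring.
Qed.

End huesler_reiss_closed_form.

(** * Images, densities and affine maps of normal laws *)

(** Measurability is passed as a proof, so the image along a function without a bundled structure is
    still available as a measure. *)
Definition image_measure d d' (T : measurableType d) (T' : measurableType d')
  (R : realType) (m : {measure set T -> \bar R}) (f : T -> T')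
  (mf : measurable_fun setT f) : {measure set T' -> \bar R}.
Proof. by refine (pushforward m f : {measure set T' -> \bar R}). Defined.

Lemma image_measureE d d' (T : measurableType d) (T' : measurableType d')
    (R : realType) (m : {measure set T -> \bar R}) (f : T -> T')
    (mf : measurable_fun setT f) A : image_measure m mf A = m (f @^-1` A).
Proof. by []. Qed.

Lemma ge0_integral_image_measure d d' (T : measurableType d) (T' : measurableType d')
    (R : realType) (m : {measure set T -> \bar R}) (f : T -> T')
    (mf : measurable_fun setT f) (D : set T') (g : T' -> \bar R) :
  measurable D -> measurable_fun D g -> (forall y, (0 <= g y)%E) ->
  (\int[image_measure m mf]_(y in D) g y = \int[m]_(x in f @^-1` D) g (f x))%E.
Proof. by move=> mD mg g0; exact: (ge0_integral_pushforward mf). Qed.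

Section density.
Local Open Scope ereal_scope.
Context d (T : measurableType d) (R : realType).
Variables (mu nu : {measure set T -> \bar R}) (p : T -> R).
Hypotheses (mp : measurable_fun setT p) (p0 : forall x, (0 <= p x)%R).
Hypothesis nuE : forall A, measurable A -> nu A = \int[mu]_(x in A) (p x)%:E.

Import HBNNSimple.

Let integral_nnsfun_density (f : {nnsfun T >-> R}) :
  \int[nu]_x (f x)%:E = \int[mu]_x ((f x)%:E * (p x)%:E).
Proof.
under [LHS]eq_integral do rewrite fimfunE -fsumEFin//.
rewrite [LHS]ge0_integral_fsum//; last 2 first.
  - by move=> r; exact/measurable_EFinP/measurableT_comp.
  - by move=> n x _; rewrite EFinM nnfun_muleindic_ge0.
under [RHS]eq_integral.
  move=> x xD; rewrite fimfunE -fsumEFin// muleC ge0_mule_fsumr; last first.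
    by move=> r; rewrite EFinM nnfun_muleindic_ge0.
  over.
rewrite [RHS]ge0_integral_fsum//; last 2 first.
  - move=> r; apply: emeasurable_funM; first exact/measurable_EFinP.
    exact/measurable_EFinP/measurableT_comp.
  - move=> n x _; apply: mule_ge0; first by rewrite lee_fin.
    exact: nnfun_muleindic_ge0.
apply: eq_fsbigr => r _.
have mr : measurable (f @^-1` [set r]) by exact: measurable_sfunP.
rewrite integralZl_indic_nnsfun// integral_indic// setIT nuE//.
have [r0|r0] := ltP r 0%R.
  rewrite preimage_nnfun0// integral_set0 mule0; apply/esym/integral0_eq => x _.
  by rewrite indicE in_set0 mulr0 mule0.
rewrite -ge0_integralZl//; last 2 first.
- by apply: measurable_funTS; exact/measurable_EFinP.
- by move=> x _; rewrite lee_fin.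
rewrite integral_mkcond; apply: eq_integral => x _.
rewrite /patch indicE; case: ifPn => _; first by rewrite mulr1 muleC.
by rewrite mulr0 mule0.
Qed.

(** Simple functions increasing to [f], with monotone convergence on both sides, reduce the formula
    to indicators, where it is the hypothesis on [nu]. *)
Lemma ge0_integral_density (f : T -> \bar R) : measurable_fun setT f ->
  (forall x, 0 <= f x) -> \int[nu]_x f x = \int[mu]_x (f x * (p x)%:E).
Proof.
move=> mf f0.
pose f_ := nnsfun_approx measurableT mf.
transitivity (lim (\int[nu]_x (f_ n x)%:E @[n --> \oo])).
  rewrite -monotone_convergence//=.
  - apply: eq_integral => ? /[!inE] xD; apply/esym/cvg_lim => //=.
    exact: cvg_nnsfun_approx.
  - by move=> n; exact/measurable_EFinP/measurable_funTS.
  - by move=> n ? _; rewrite lee_fin.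
  - by move=> ? _ ? ? mn; rewrite lee_fin; exact/lefP/nd_nnsfun_approx.
transitivity (lim (\int[mu]_x ((f_ n x)%:E * (p x)%:E) @[n --> \oo])).
  by apply: congr_lim; apply/funext => n /=; exact: integral_nnsfun_density.
rewrite -monotone_convergence//=.
- apply: eq_integral => x /[!inE] xD; apply/cvg_lim => //=.
  by apply: cvgeZr => //; exact: cvg_nnsfun_approx.
- by move=> n; apply: emeasurable_funM; apply/measurable_EFinP.
- by move=> n x _; rewrite mule_ge0 ?lee_fin.
- move=> x _ m n mn; rewrite lee_wpmul2r ?lee_fin//.
  exact/lefP/nd_nnsfun_approx.
Qed.

End density.

Section normal_law_theory.
Context {R : realType}.
Notation mu := (@lebesgue_measure R).
Implicit Types (x y z m s a b c w : R).

(** By uniqueness of Lebesgue measure: [s] times its image under [t |-> m + s t] gives half-open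
    intervals their length. *)
Lemma ge0_integral_affine m s (f : R -> \bar R) : 0 < s ->
  measurable_fun setT f -> (forall x, (0 <= f x)%E) ->
  (\int[mu]_t f (m + s * t)%R = s^-1%:E * \int[mu]_x f x)%E.
Proof.
move=> s0 mf f0.
pose F (t : R) := m + s * t.
have mF : measurable_fun (setT : set (measurableTypeR R)) (F : _ -> measurableTypeR R).
  by apply: measurable_funD => //; exact: measurable_funM.
have sn0 : (0 <= s)%R by exact: ltW.
have muE A : measurable A -> mu A = mscale (NngNum sn0) (image_measure mu mF) A.
  apply: lebesgue_measure_unique => _ [[u v] _ <-].
  change (mu `]u, v]%classic = (s%:E * mu (F @^-1` `]u, v]%classic))%E).
  have -> : F @^-1` `]u, v]%classic = `]((u - m) / s), ((v - m) / s)]%classic.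
    apply/seteqP; split => t /=; rewrite !in_itv/= /F.
      by rewrite ltr_pdivrMr// ler_pdivlMr// mulrC ltrBlDl lerBrDl.
    by rewrite ltr_pdivrMr// ler_pdivlMr// mulrC ltrBlDl lerBrDl.
  rewrite !lebesgue_measure_itv/= !lte_fin ltr_pM2r ?invr_gt0// ltrD2r.
  case: ifPn => uv; last by rewrite mule0.
  by rewrite -!EFinB -EFinM; congr EFin; field; rewrite gt_eqF.
rewrite [X in (_ * X)%E](eq_measure_integral (mscale (NngNum sn0) (image_measure mu mF))).
  rewrite ge0_integral_mscale//= muleA -EFinM mulVf ?gt_eqF// mul1e.
  by rewrite ge0_integral_image_measure.
by move=> A mA _; exact: muE.
Qed.

Lemma normal_prob_itv m s z : 0 < s ->
  normal_prob m s `]-oo, z]%classic = (Phi ((z - m) / s))%:E.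
Proof.
move=> s0; rewrite Phi_cdf /normal_prob [in LHS]integral_mkcond [in RHS]integral_mkcond.
have mf : measurable_fun setT ((fun x => (normal_pdf m s x)%:E) \_ `]-oo, z]).
  apply/(measurable_restrictT _ _).1 => //; apply: measurable_funTS.
  by apply/measurable_EFinP; exact: measurable_normal_pdf.
have f0 x : (0 <= ((fun x => (normal_pdf m s x)%:E) \_ `]-oo, z]) x)%E.
  by rewrite /patch; case: ifPn => // _; rewrite lee_fin normal_pdf_ge0.
have /(congr1 (fun e => s%:E * e)%E) := ge0_integral_affine m s0 mf f0.
rewrite muleA -EFinM divff ?gt_eqF// mul1e => <-.
rewrite -ge0_integralZl//; last 2 first.
- apply: (@measurableT_comp _ _ _ _ _ _ _ _ (fun t => m + s * t)) mf _.
  by apply: measurable_funD => //; exact: measurable_funM.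
- by rewrite lee_fin ltW.
apply: eq_integral => t _; rewrite /patch !mem_setE !in_itv/=.
rewrite ler_pdivlMr// lerBrDl mulrC; case: ifPn => _; last by rewrite mule0.
rewrite -EFinM; congr EFin; rewrite !normal_pdfE ?oner_neq0 ?gt_eqF//.
rewrite mulrA; congr (_ * expR _); last by field; rewrite gt_eqF.
rewrite /normal_peak expr1n mul1r -!mulrnAr sqrtrM ?sqr_ge0// sqrtr_sqr gtr0_norm//.
by rewrite invfM mulrA divff ?mul1r// gt_eqF.
Qed.

Lemma normal_probN (A : set R) : measurable A ->
  normal_prob 0 1 (-%R @^-1` A) = normal_prob 0 1 A :> \bar R.
Proof.
move=> mA; rewrite /normal_prob.
have pdfN t : normal_pdf 0 1 t = normal_pdf 0 1 (- t) :> R.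
  by rewrite !normal_pdfE ?oner_neq0// /normal_fun !subr0 sqrrN.
have mN : measurable_fun (setT : set (measurableTypeR R)) (-%R : _ -> measurableTypeR R).
  exact: oppr_measurable.
rewrite [RHS](eq_measure_integral (image_measure mu mN)); last first.
  by move=> B mB _; exact/esym/lebesgue_measureN.
rewrite ge0_integral_image_measure//=.
- by apply: eq_integral => t _; rewrite pdfN.
- by apply: measurable_funTS; apply/measurable_EFinP; exact: measurable_normal_pdf.
- by move=> y; rewrite lee_fin normal_pdf_ge0.
Qed.

Lemma cprobN c w : cprob (- c) w = cprob c w.
Proof.
rewrite /cprob; congr fine.
rewrite -[RHS]normal_probN; last exact: measurable_cprob_set.
by congr normal_prob; apply/seteqP; split => t /=; rewrite mulrN mulNr.
Qed.

Lemma cprob_norm c w : cprob `|c| w = cprob c w.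
Proof. by have [//|_] := ger0P c; rewrite cprobN. Qed.

Lemma normal_law_mean_itv m s z : 0 <= s ->
  normal_law m s `]-oo, z]%classic = (cprob s (z - m))%:E.
Proof.
rewrite le_eqVlt /normal_law => /predU1P[<-|s0].
  rewrite eqxx cprob0 diracE mem_setE in_itv/= subr_ge0.
  by [].
by rewrite gt_eqF// normal_prob_itv// cprob_gt0.
Qed.

Lemma Phi0 : Phi 0 = 2^-1 :> R.
Proof.
have : normal_prob 0 1 `]0, +oo[%classic = (1 - normal_prob 0 1 `]-oo, (0%R:R)]%classic)%E :> \bar R.
  by rewrite -probability_setC// setCitvl.
have -> : normal_prob 0 1 `]0, +oo[%classic = normal_prob 0 1 `]-oo, (0:R)]%classic :> \bar R.
  rewrite -[RHS]normal_probN//.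
  have -> : -%R @^-1` `]-oo, (0:R)]%classic = `[0, +oo[%classic.
    by apply/seteqP; split => t /=; rewrite !in_itv/= oppr_le0 andbT.
  rewrite /normal_prob integral_itv_obnd_cbnd//.
  by apply: measurable_funTS; apply/measurable_EFinP; exact: measurable_normal_pdf.
rewrite -Phi_cdf -EFinB => -[]; lra.
Qed.

End normal_law_theory.

(** * Uniqueness from half lines, and the first two moments of the standard normal law *)

Section normal_moments.
Context {R : realType}.
Notation mu := (@lebesgue_measure R).
Notation N01 := (@normal_prob R 0 1).
Implicit Types (x y z m s a b c w : R).

(** Subtracting half lines, legitimate by finiteness, gives agreement on half-open intervals. These
    form a generating class stable under intersection, and the [](- k), k]] exhaust the line. *)
Lemma measure_itvNy_unique (m1 m2 : {measure set (measurableTypeR R) -> \bar R}) :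
  (forall z, m1 `]-oo, z]%classic = m2 `]-oo, z]%classic) ->
  (forall z, (m1 `]-oo, z]%classic < +oo)%E) ->
  forall A, measurable A -> m1 A = m2 A.
Proof.
move=> m12 m1oo A mA.
have itvE u v : `]u, v]%classic = `]-oo, v] `\` `]-oo, u] :> set R.
  by rewrite -[RHS]setCK setCD setCitvl setUC -[LHS]setCK setCitv.
have m2oo z : (m2 `]-oo, z]%classic < +oo)%E by rewrite -m12.
pose g (k : nat) : set R := `](- k%:R), k%:R]%classic.
have gT : \bigcup_k g k = setT.
  apply/seteqP; split => // x _; have xk := archi_boundP (normr_ge0 x).
  exists (Num.bound `|x|) => //; rewrite /g /= in_itv/=; move: xk; rewrite ltr_norml => /andP[-> /ltW ->].
  by [].
have go k : ocitv (g k) by exact: is_ocitv.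
have ocE B : ocitv B -> m1 B = m2 B.
  move=> [[u v] _ <-] /=.
  have [uv|vu] := leP u v; last by rewrite set_itv_ge ?measure0// bnd_simp -leNgt ltW.
  rewrite itvE !measureD//= setIidr; last by apply: subset_itvl; rewrite bnd_simp.
  by rewrite !m12.
have goo k : (m1 (g k) < +oo)%E.
  rewrite (le_lt_trans _ (m1oo k%:R))// le_measure ?inE//.
    exact: measurable_itv.
  by move=> x; rewrite /g /= !in_itv/= => /andP[].
exact: (@measure_unique _ R (measurableTypeR R) (@ocitv R) g erefl (@ocitvI R) go gT
  m1 m2 ocE goo A mA).
Qed.

(** [Phi t - t phi(t)] is an antiderivative of [t^2 phi(t)]; by evenness the integral is twice its
    increment [1 - 1/2] over the positive half line. *)
Lemma integral_normal_sqr : (\int[N01]_t (t ^+ 2)%:E = 1)%E.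
Proof.
have pdf_diff (t : R) : is_derive t 1 (normal_pdf 0 1 : R -> R) (- t * normal_pdf 0 1 t).
  rewrite normal_pdfE ?oner_neq0// /normal_fun.
  have d1 : is_derive t 1 (fun z : R => - (z - 0) ^+ 2 / (1 ^+ 2 *+ 2)) (- t).
    apply: is_derive_eq.
    rewrite /GRing.scale/= !subr0 !expr1n -[1 *+ 2]/(2%:R :> R); by field.
  have := @is_derive1_comp R expR _ t _ _ (is_derive_expR _) d1.
  move=> d2; apply: is_derive_eq; rewrite /GRing.scale/=; ring.
rewrite (ge0_integral_density (mu := mu) (p := normal_pdf 0 1))//; last 4 first.
- exact: measurable_normal_pdf.
- by move=> x; exact: normal_pdf_ge0.
- by apply/measurable_EFinP; exact: measurable_funX.
- by move=> x; rewrite lee_fin sqr_ge0.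
pose f (t : R) := t ^+ 2 * normal_pdf 0 1 t.
pose F (t : R) := Phi t - t * normal_pdf 0 1 t.
under eq_integral do rewrite -EFinM.
have f0 t : 0 <= f t by rewrite mulr_ge0 ?sqr_ge0 ?normal_pdf_ge0.
have cpdf : continuous (normal_pdf 0 1 : R -> R).
  by apply: continuous_normal_pdf; rewrite oner_neq0.
have cf : continuous f by move=> t; apply: cvgM; [exact: sqr_continuous|exact: cpdf].
have fN t : f (- t) = f t.
  by rewrite /f sqrrN !normal_pdfE ?oner_neq0// /normal_fun !subr0 sqrrN.
rewrite (_ : (fun t => _) = (fun t => (f t)%:E))//.
rewrite ge0_symfun_integralT//; last by move=> t; rewrite /= fN.
have -> : [set x : R | 0 <= x] = `[0, +oo[%classic.
  by apply/seteqP; split => t /=; rewrite in_itv/= andbT.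
have dF (t : R) : is_derive t 1 F (f t).
  have d1 := is_derive_Phi t; have d2 := pdf_diff t.
  apply: is_derive_eq; rewrite /f /GRing.scale/=; ring.
rewrite (@ge0_continuous_FTC2y R f F 0 1).
- by rewrite /F mul0r subr0 Phi0 -EFinB -EFinM; congr EFin; field.
- by move=> t _.
- exact: continuous_subspaceT.
- rewrite /F -[X in _ --> X]subr0; apply: cvgB; first exact: Phi_cvgy.
  (* From [expR u >= 1 + u] at [u = t^2 / 2] one gets [exp (- t^2 / 2) <= 2 / t^2], so [t phi(t)] is
     of order at most [1 / t]. *)
  apply: (@squeeze_cvgr _ _ _ _ (cst 0) (fun t => (2 * normal_peak 1) * t^-1)).
  + near=> t.
    have t0 : 0 < t by near: t; apply: nbhs_pinfty_gt; rewrite num_real.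
    apply/andP; split; first by rewrite /cst mulr_ge0 ?normal_pdf_ge0// ltW.
    rewrite normal_pdfE ?oner_neq0// /normal_fun subr0 expr1n.
    have : expR (- t ^+ 2 / (1 *+ 2)) <= 2 / t ^+ 2.
      rewrite mulNr expRN -[leRHS]invrK lef_pV2 ?posrE ?expR_gt0 ?invr_gt0 ?divr_gt0 ?exprn_gt0//.
      rewrite invfM invrK -[1 *+ 2]/(2%:R :> R).
      have := @expR_ge1Dx R (t ^+ 2 / 2); have := sqr_ge0 t; lra.
    move=> h.
    apply: (@le_trans _ _ (t * (normal_peak 1 * (2 / t ^+ 2)))).
      by rewrite ler_pM2l// ler_wpM2l// normal_peak_ge0.
    rewrite le_eqVlt; apply/orP; left; apply/eqP; field; exact: lt0r_neq0.
  + exact: cvg_cst.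
  + rewrite -[X in _ --> X](mulr0 (2 * normal_peak 1)); apply: cvgMl_tmp.
    rewrite gtr0_cvgV0; first exact: cvg_id.
    by apply: nbhs_pinfty_gt; rewrite num_real.
- by move=> t _; case: (dF t).
- apply: cvg_at_right_filter; apply: differentiable_continuous.
  by apply/derivable1_diffP; case: (dF 0).
- by move=> t _; rewrite derive1E; have [] := dF t.
Unshelve. all: by end_near. Qed.

Lemma integrable_normal_sqr : N01.-integrable setT (fun t => (t ^+ 2)%:E).
Proof.
apply/integrableP; split; first by apply/measurable_EFinP; exact: measurable_funX.
under eq_integral do rewrite gee0_abs ?lee_fin ?sqr_ge0//.
by rewrite integral_normal_sqr ltry.
Qed.

Lemma integrable_normal_id : N01.-integrable setT (fun t => t%:E).
Proof.
have : N01.-integrable setT (fun t => (t ^+ 2)%:E + (cst 1 t)%:E)%E.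
  apply: integrableD => //; first exact: integrable_normal_sqr.
  exact: finite_measure_integrable_cst.
apply: le_integrable => //=; first exact/measurable_EFinP.
move=> t _ /=.
rewrite lee_fin [leRHS]ger0_norm ?addr_ge0 ?sqr_ge0//.
rewrite -(ger0_norm (sqr_ge0 t)) normrX; have := normr_ge0 t; nra.
Qed.

(** Reflection invariance makes this finite integral equal to its own opposite. *)
Lemma integral_normal_id : (\int[N01]_t t%:E = 0)%E.
Proof.
have mN : measurable_fun (setT : set (measurableTypeR R)) (-%R : _ -> measurableTypeR R).
  exact: oppr_measurable.
have iN : N01.-integrable setT (EFin \o (-%R : R -> R)).
  have -> : EFin \o (-%R : R -> R) = (fun t => - t%:E)%E by [].
  by apply: integrableN; exact: integrable_normal_id.
have h : (\int[N01]_t t%:E = - \int[N01]_t t%:E)%E.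
  rewrite {1}(eq_measure_integral (image_measure N01 mN)); last first.
    by move=> A mA _; exact/esym/normal_probN.
  rewrite [LHS](integral_pushforward mN)//.
  rewrite -integralN; last first.
    by apply: integrable_add_def => //; exact: integrable_normal_id.
  by apply: eq_integral => t _.
have fin : (\int[N01]_t t%:E)%E \is a fin_num.
  by apply: integrable_fin_num => //; exact: integrable_normal_id.
move: h; rewrite -(fineK fin) -EFinN => -[] h.
by congr EFin; lra.
Qed.

End normal_moments.

(** * Linear forms of Gaussian pairs *)

Section normal_rv.
Context d (T : measurableType d) (R : realType) (P : probability T R).
Notation N01 := (@normal_prob R 0 1).
Implicit Types (Y : {mfun T >-> R}) (m s z : R).

(** The law of [m + s N] with [N] standard normal; through [cprob] the degenerate case [s = 0] needs
    no separate treatment. *)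
Definition normal_cdf (Y : T -> R) m s :=
  0 <= s /\ forall z, P (Y @^-1` `]-oo, z]) = (cprob s (z - m))%:E.

Lemma gaussian_normal_cdf (Y : T -> R) : gaussian P Y -> exists m s, normal_cdf Y m s.
Proof.
move=> [m [s [s0 Ys]]]; exists m, s; split => // z.
by rewrite Ys// normal_law_mean_itv.
Qed.

Lemma measurable_affine m s :
  measurable_fun (setT : set (measurableTypeR R)) (fun t => m + s * t : measurableTypeR R).
Proof. by apply: measurable_funD => //; exact: measurable_funM. Qed.

Lemma normal_cdf_law Y m s (A : set R) : normal_cdf Y m s -> measurable A ->
  P (Y @^-1` A) = N01 [set t | A (m + s * t)].
Proof.
move=> [s0 Ys] mA.
have mY : measurable_fun setT (Y : T -> measurableTypeR R).
  exact: (@measurable_funPT _ _ _ _ Y).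
apply: (@measure_itvNy_unique R (image_measure P mY)
  (image_measure N01 (@measurable_affine m s))) => //.
- move=> z; transitivity (cprob s (z - m))%:E; first exact: Ys.
  rewrite cprobE image_measureE.
  by congr normal_prob; apply/seteqP; split => t /=; rewrite in_itv/= lerBrDl.
- move=> z; have -> : image_measure P mY `]-oo, z]%classic = (cprob s (z - m))%:E.
    exact: Ys.
  exact: ltry.
Qed.

Lemma integral_normal_cst m : (\int[N01]__ m%:E = m%:E)%E.
Proof.
by rewrite integral_cst// [X in (_ * X)%E](_ : _ = 1%E) ?mule1//; exact: probability_setT.
Qed.

Lemma ge0_integral_normal_cdf Y m s (g : R -> \bar R) : normal_cdf Y m s ->
  measurable_fun setT g -> (forall y, (0 <= g y)%E) ->
  (\int[P]_w g (Y w) = \int[N01]_t g (m + s * t)%R)%E.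
Proof.
move=> Yms mg g0.
have mY : measurable_fun setT (Y : T -> measurableTypeR R).
  exact: (@measurable_funPT _ _ _ _ Y).
have := @ge0_integral_image_measure _ _ _ _ _ P _ mY setT g measurableT mg g0.
rewrite preimage_setT => <-.
have := @ge0_integral_image_measure _ _ _ _ _ N01 _ (@measurable_affine m s) setT g measurableT mg g0.
rewrite preimage_setT => <-.
by apply: eq_measure_integral => A mA _; exact: normal_cdf_law.
Qed.

Lemma integrable_normal_affine m s : N01.-integrable setT (fun t => (m + s * t)%:E).
Proof.
have -> : (fun t => (m + s * t)%:E) = (fun t : R => m%:E + s%:E * t%:E)%E.
  by apply/funext => t; rewrite EFinD EFinM.
apply: integrableD => //; first exact: finite_measure_integrable_cst.
by apply: integrableZl => //; exact: integrable_normal_id.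
Qed.

Lemma integral_normal_cdf Y m s : normal_cdf Y m s ->
  (\int[P]_w (Y w)%:E = m%:E)%E.
Proof.
move=> Yms.
have mY : measurable_fun setT (Y : T -> measurableTypeR R).
  exact: (@measurable_funPT _ _ _ _ Y).
have mE : measurable_fun (setT : set (measurableTypeR R)) (EFin : measurableTypeR R -> \bar R).
  exact/measurable_EFinP.
have iY : P.-integrable setT (EFin \o Y).
  apply/integrableP; split; first by apply/measurable_EFinP; exact: measurable_funPT.
  have mabs : measurable_fun setT (fun y : R => `|y%:E|%E).
    exact: measurableT_comp.
  rewrite (@ge0_integral_normal_cdf Y m s (fun y => `|y%:E|%E))//.
  by have /integrableP[] := integrable_normal_affine m s.
have := @integral_pushforward _ _ _ _ _ _ mY P setT EFin mE iY measurableT.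
rewrite preimage_setT => /= <-.
transitivity (\int[image_measure N01 (@measurable_affine m s)]_x x%:E)%E.
  apply: eq_measure_integral => A mA _; exact: normal_cdf_law.
have := @integral_pushforward _ _ _ _ _ _ (@measurable_affine m s) N01 setT EFin mE
  (integrable_normal_affine m s) measurableT.
rewrite preimage_setT => /= ->.
under eq_integral do rewrite EFinD EFinM.
rewrite integralD//; last 2 first.
- exact: finite_measure_integrable_cst.
- by apply: integrableZl => //; exact: integrable_normal_id.
rewrite integral_normal_cst integralZl//; last exact: integrable_normal_id.
by rewrite integral_normal_id mule0 adde0.
Qed.

Lemma integral_normal_sqrZ (c : R) : 0 <= c ->
  (\int[N01]_t (c%:E * (t ^+ 2)%:E) = c%:E)%E.
Proof.
move=> c0; rewrite ge0_integralZl//.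
- by rewrite integral_normal_sqr mule1.
- by apply/measurable_EFinP; exact: measurable_funX.
- by move=> t _; rewrite lee_fin sqr_ge0.
Qed.

Lemma expectation_normal_cdf Y m s : normal_cdf Y m s -> ('E_P[Y] = m%:E)%E.
Proof. by move=> Yms; rewrite unlock; exact: integral_normal_cdf Yms. Qed.

(** Square integrability is a consequence of normality here; it opens the calculus of variances and
    covariances of sums. *)
Lemma Lfun2_normal_cdf Y m s : normal_cdf Y m s -> (Y : T -> R) \in Lfun P 2%:E.
Proof.
move=> Yms; rewrite inE; apply/andP; split; rewrite inE/=; first exact: measurable_funPT.
rewrite /finite_norm unlock; apply: poweR_lty.
have mg : measurable_fun setT (fun y : R => (y ^+ 2)%:E).
  by apply/measurable_EFinP; exact: measurable_funX.
have -> : (\int[P]_x `|(EFin \o Y) x| `^ 2 = \int[P]_w ((Y w) ^+ 2)%:E)%E.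
  by apply: eq_integral => w _; rewrite /= powR_mulrn// real_normK ?num_real.
rewrite (@ge0_integral_normal_cdf Y m s (fun y => (y ^+ 2)%:E))//; last first.
  by move=> y; rewrite lee_fin sqr_ge0.
apply: (@le_lt_trans _ _ (\int[N01]_t ((2 * m ^+ 2)%:E + (2 * s ^+ 2)%:E * (t ^+ 2)%:E))%E).
  apply: ge0_le_integral => //.
  - by move=> t _; rewrite lee_fin sqr_ge0.
  - apply/measurable_EFinP; apply: measurable_funX; exact: measurable_affine.
  - by apply/measurable_EFinP; apply: measurable_funD => //; apply: measurable_funM => //; exact: measurable_funX.
  - move=> t _; rewrite -EFinM -EFinD lee_fin -subr_ge0.
    by have := sqr_ge0 (m - s * t); nra.
rewrite ge0_integralD//=; last 3 first.
- by move=> t _; rewrite lee_fin mulr_ge0// sqr_ge0.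
- move=> t _; rewrite -EFinM lee_fin; apply: mulr_ge0; last exact: sqr_ge0.
  by rewrite mulr_ge0// sqr_ge0.
- by apply/measurable_EFinP; apply: measurable_funM => //; exact: measurable_funX.
rewrite integral_normal_cst integral_normal_sqrZ; first exact: ltry.
by apply: mulr_ge0 => //; exact: sqr_ge0.
Qed.

Lemma variance_normal_cdf Y m s : normal_cdf Y m s -> ('V_P[Y] = (s ^+ 2)%:E)%E.
Proof.
move=> Yms; rewrite /variance covariance.unlock (expectation_normal_cdf Yms)/= unlock.
have mg : measurable_fun setT (fun y : R => ((y - m) ^+ 2)%:E).
  by apply/measurable_EFinP; apply: measurable_funX; exact: measurable_funB.
transitivity (\int[P]_w ((Y w - m) ^+ 2)%:E)%E.
  by apply: eq_integral => w _; rewrite expr2.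
rewrite (@ge0_integral_normal_cdf Y m s (fun y => ((y - m) ^+ 2)%:E))//; last first.
  by move=> y; rewrite lee_fin sqr_ge0.
under eq_integral do rewrite addrAC subrr add0r exprMn EFinM.
by rewrite integral_normal_sqrZ// sqr_ge0.
Qed.

End normal_rv.

Section gaussian_pair.
Context d (T : measurableType d) (R : realType) (P : probability T R).
Variables (X : {mfun T >-> (R * R)%type}) (s1 s2 s12 : R).
Hypothesis X_gauss : gaussian_vector P X.
Hypotheses (X_mean1 : ('E_P[fst \o X] = 0)%E) (X_mean2 : ('E_P[snd \o X] = 0)%E).
Hypotheses (X_var1 : ('V_P[fst \o X] = (s1 ^+ 2)%:E)%E)
  (X_var2 : ('V_P[snd \o X] = (s2 ^+ 2)%:E)%E).
Hypothesis X_cov : covariance P (fst \o X) (snd \o X) = s12%:E.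

Let q (u v : R) := u ^+ 2 * s1 ^+ 2 + v ^+ 2 * s2 ^+ 2 + 2 * u * v * s12.

(** A normal law is fixed by mean and variance. For a linear form of the pair, linearity gives mean
    0 and bilinearity of the covariance gives variance [q u v]. *)
Lemma gaussian_pair_cdf u v :
  0 <= q u v /\
  forall z, P [set w | u * (X w).1 + v * (X w).2 <= z] = (cprob (Num.sqrt (q u v)) z)%:E.
Proof.
have mX1 : measurable_fun setT (fst \o X).
  by apply: measurableT_comp => //; exact: (@measurable_funPT _ _ _ _ X).
have mX2 : measurable_fun setT (snd \o X).
  by apply: measurableT_comp => //; exact: (@measurable_funPT _ _ _ _ X).
have mY a b : measurable_fun setT (fun w => a * (X w).1 + b * (X w).2).
  by apply: measurable_funD; apply: measurable_funM.
pose Y a b : {mfun T >-> R} := HB.pack (fun w => a * (X w).1 + b * (X w).2)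
  (isMeasurableFun.Build _ _ _ _ _ (mY a b)).
have YL2 a b : (Y a b : T -> R) \in Lfun P 2%:E.
  have [m [s Ys]] := gaussian_normal_cdf (X_gauss a b).
  exact: (@Lfun2_normal_cdf _ _ _ P (Y a b) m s Ys).
have X1L2 : (fst \o X) \in Lfun P 2%:E.
  have -> : (fst \o X) = (Y 1 0 : T -> R).
    by apply/funext => w /=; rewrite mul1r mul0r addr0.
  exact: YL2.
have X2L2 : (snd \o X) \in Lfun P 2%:E.
  have -> : (snd \o X) = (Y 0 1 : T -> R).
    by apply/funext => w /=; rewrite mul1r mul0r add0r.
  exact: YL2.
have L21 := @Lfun_subset12 _ _ _ P (fin_num_measure P _ measurableT).
have [m [s [s0 Ys]]] := gaussian_normal_cdf (X_gauss u v).
have YE : (Y u v : T -> R) = (u \o* (fst \o X) \+ v \o* (snd \o X))%R.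
  by apply/funext => w /=; rewrite [_ * u]mulrC [_ * v]mulrC.
have uX : (u \o* (fst \o X))%R \in Lfun P 2%:E by apply: Lfun_scale; rewrite // ler1n.
have vX : (v \o* (snd \o X))%R \in Lfun P 2%:E by apply: Lfun_scale; rewrite // ler1n.
have m0 : m = 0.
  have := @expectation_normal_cdf _ _ _ P (Y u v) m s (conj s0 Ys).
  rewrite YE expectationD ?L21// !expectationZl ?L21// X_mean1 X_mean2 !mule0 adde0.
  by move=> [].
have sE : s ^+ 2 = q u v.
  have := @variance_normal_cdf _ _ _ P (Y u v) m s (conj s0 Ys).
  rewrite YE varianceD// !varianceZ// X_var1 X_var2.
  rewrite (covarianceZl u (L21 _ X1L2) (L21 _ vX) (Lfun2_mul_Lfun1 X1L2 vX)).
  rewrite (covarianceZr v (L21 _ X1L2) (L21 _ X2L2) (Lfun2_mul_Lfun1 X1L2 X2L2)).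
  rewrite X_cov -!EFinM -!EFinD => -[] <-; rewrite /q; ring.
rewrite -sE; split; first exact: sqr_ge0.
move=> z; rewrite sqrtr_sqr ger0_norm// -[X in cprob s X]subr0 -[X in _ - X]m0 -Ys.
by congr (P _); apply/seteqP; split => w /=; rewrite in_itv.
Qed.

Hypotheses (s1_gt0 : 0 < s1) (s2_gt0 : 0 < s2).
Let rho := corr s1 s2 s12.

Let q_corr u v : q (u / s1) (v / s2) = u ^+ 2 + v ^+ 2 + 2 * u * v * rho.
Proof. by rewrite /q /rho /corr; field; rewrite !gt_eqF. Qed.

(** The sum and the difference of the standardized coordinates have variances [2 + 2 rho] and
    [2 - 2 rho], which are nonnegative. *)
Lemma corr_le1 : -1 <= rho <= 1.
Proof.
have [+ _] := gaussian_pair_cdf (1 / s1) (1 / s2).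
have [+ _] := gaussian_pair_cdf (1 / s1) (-1 / s2).
by rewrite !q_corr; lra.
Qed.

Lemma standardized_pair_cdf u v z :
  P [set w | u * ((X w).1 / s1) + v * ((X w).2 / s2) <= z] =
  (cprob (Num.sqrt (u ^+ 2 + v ^+ 2 + 2 * u * v * rho)) z)%:E.
Proof.
rewrite -q_corr; have [_ <-] := gaussian_pair_cdf (u / s1) (v / s2).
by congr (P _); apply/seteqP; split => w /=; rewrite !mulrA ![_ / _ * _]mulrAC.
Qed.

End gaussian_pair.

(** * Linear forms determine the law of a pair *)

Section trigonometric_polynomials.
Context {R : realType}.
Implicit Types (x y u v a c : R).

(** Each generator depends on a single linear form, so its integral is determined by the laws of
    linear forms. The phase [c] covers sines, and the product-to-sum formula makes the class an
    algebra. *)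
Inductive trigpoly : (R * R -> R) -> Prop :=
| trigpoly_cos u v c : trigpoly (fun p => cos (u * p.1 + v * p.2 + c))
| trigpolyD f g : trigpoly f -> trigpoly g -> trigpoly (fun p => f p + g p)
| trigpolyZ a f : trigpoly f -> trigpoly (fun p => a * f p).

Lemma trigpoly_ext f g : trigpoly f -> f =1 g -> trigpoly g.
Proof. by move=> tf /funext <-. Qed.

Lemma trigpoly_cst a : trigpoly (fun=> a).
Proof.
apply: (trigpoly_ext (trigpolyZ a (trigpoly_cos 0 0 0))) => p.
by rewrite !mul0r !addr0 cos0 mulr1.
Qed.

Lemma trigpolyM f g : trigpoly f -> trigpoly g -> trigpoly (fun p => f p * g p).
Proof.
move=> tf; elim: tf g => [u v c g|f1 f2 t1 IH1 t2 IH2 g tg|a f1 t1 IH1 g tg].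
- elim=> [u' v' c'|g1 g2 t1 IH1 t2 IH2|a g1 t1 IH1].
  + apply: (trigpoly_ext (trigpolyD
      (trigpolyZ (2^-1) (trigpoly_cos (u + u') (v + v') (c + c')))
      (trigpolyZ (2^-1) (trigpoly_cos (u - u') (v - v') (c - c'))))) => p.
    have -> : (u + u') * p.1 + (v + v') * p.2 + (c + c') =
      (u * p.1 + v * p.2 + c) + (u' * p.1 + v' * p.2 + c') by ring.
    have -> : (u - u') * p.1 + (v - v') * p.2 + (c - c') =
      (u * p.1 + v * p.2 + c) - (u' * p.1 + v' * p.2 + c') by ring.
    by rewrite cosD cosB; field.
  + by apply: (trigpoly_ext (trigpolyD IH1 IH2)) => p; rewrite mulrDr.
  + by apply: (trigpoly_ext (trigpolyZ a IH1)) => p; rewrite mulrCA.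
- by apply: (trigpoly_ext (trigpolyD (IH1 _ tg) (IH2 _ tg))) => p; rewrite mulrDl.
- by apply: (trigpoly_ext (trigpolyZ a (IH1 _ tg))) => p; rewrite mulrA.
Qed.

Lemma trigpolyX f n : trigpoly f -> trigpoly (fun p => f p ^+ n).
Proof.
move=> tf; elim: n => [|n IH]; first exact: trigpoly_cst.
by apply: (trigpoly_ext (trigpolyM tf IH)) => p; rewrite exprS.
Qed.

(* Converges to the indicator function of [x < 0] off [0]: for [0 <= s <= 1],
   (1 - s^N)^(2^N) tends to 1 if s < 1/2 and to 0 if s > 1/2; N is a square so
   that s may approach 1/2 at speed 1/j. *)
Definition trig_step (j : nat) x : R :=
  (1 - ((1 + sin (x / j.+1%:R)) / 2) ^+ (j.+1 ^ 2)) ^+ (2 ^ (j.+1 ^ 2)).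

Lemma trigpoly_step j (u v c : R) :
  trigpoly (fun p => trig_step j (u * p.1 + v * p.2 + c)).
Proof.
apply: trigpolyX.
have tsin : trigpoly (fun p => sin ((u * p.1 + v * p.2 + c) / j.+1%:R)).
  apply: (trigpoly_ext (trigpoly_cos (u / j.+1%:R) (v / j.+1%:R) (c / j.+1%:R - pi / 2))) => p.
  by rewrite addrA cosBpihalf; congr sin; rewrite !mulrDl !(mulrAC _ _^-1).
apply: (trigpoly_ext (trigpolyD (trigpoly_cst 1) (trigpolyZ (-1)
  (trigpolyX (j.+1 ^ 2) (trigpolyZ 2^-1 (trigpolyD (trigpoly_cst 1) tsin)))))) => p.
by rewrite mulN1r [2^-1 * _]mulrC.
Qed.

Let base j x := (1 + sin (x / j.+1%:R)) / 2.

Let base01 j x : 0 <= base j x <= 1.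
Proof.
rewrite /base; have := sin_geN1 (x / j.+1%:R); have := sin_le1 (x / j.+1%:R); lra.
Qed.

Let power01 j x : 0 <= base j x ^+ (j.+1 ^ 2) <= 1.
Proof.
by have /andP[b0 b1] := base01 j x; rewrite exprn_ge0// exprn_ile1.
Qed.

Lemma trig_step01 j x : 0 <= trig_step j x <= 1.
Proof.
have /andP[b0 b1] := power01 j x.
by rewrite exprn_ge0 ?subr_ge0// exprn_ile1// ?subr_ge0// gerBl.
Qed.

Lemma sin_ge_half : \forall h \near (0:R)^'+, h / 2 <= sin h.
Proof.
have h1 : h^-1 *: (sin (h *: 1 + 0) - sin 0) @[h --> (0:R)^'] --> 'D_1 (@sin R) 0.
  exact: derivable_sin.
have dE : 'D_1 (@sin R) 0 = 1 by rewrite derive_val cos0.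
rewrite dE in h1.
have /cvgr_ge : h^-1 *: (sin (h *: 1 + 0) - sin 0) @[h --> (0:R)^'+] --> (1:R).
  exact: cvg_dnbhs_at_right h1.
move=> /(_ (1 / 2)) hh; near=> h.
have : 1 / 2 <= h^-1 *: (sin (h *: 1 + 0) - sin 0).
  by near: h; apply: hh; lra.
have h0 : 0 < h by near: h; exact: nbhs_right_gt.
by rewrite /GRing.scale/= mulr1 addr0 sin0 subr0 ler_pdivlMl//; lra.
Unshelve. all: by end_near. Qed.

Lemma near_natr_ge (M c : R) : 0 < c -> \forall j \near \oo, M <= j.+1%:R * c.
Proof.
move=> c0; exists (Num.bound (`|M| / c)) => //= j jb.
have := archi_boundP (divr_ge0 (normr_ge0 M) (ltW c0)).
rewrite ltr_pdivrMr// => h.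
apply: (le_trans (ler_norm M)); apply: (le_trans (ltW h)).
rewrite ler_pM2r// ler_nat; exact: leq_trans jb _.
Qed.

(** With [N = (j+1)^2], the product [N sin (x / (j+1))] grows at least like [(j+1) x / 2]; an
    exponent [N] linear in [j] would leave it bounded. *)
Lemma sin_seq_ge x : 0 < x ->
  \forall j \near \oo, j.+1%:R * x / 2 <= j.+1%:R ^+ 2 * sin (x / j.+1%:R).
Proof.
move=> x0.
have xj : x / j.+1%:R @[j --> \oo] --> (0:R)^'+.
  move=> A [e /= e0 eA]; change (\forall j \near \oo, A (x / j.+1%:R)).
  have xe : 0 < x / e by rewrite divr_gt0.
  near=> j; apply: eA => /=; last by rewrite divr_gt0.
  rewrite sub0r normrN ger0_norm ?divr_ge0 ?ltW//.
  rewrite ltr_pdivrMr ?ltr0n// mulrC.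
  have : x + 1 <= j.+1%:R * e by near: j; exact: near_natr_ge.
  by apply: lt_le_trans; rewrite ltrDl.
have := xj _ sin_ge_half.
move=> h; near=> j.
have : x / j.+1%:R / 2 <= sin (x / j.+1%:R) by near: j.
have n0 : 0 < j.+1%:R :> R by rewrite ltr0n.
move=> /(ler_wpM2l (sqr_ge0 j.+1%:R)); apply: le_trans.
by rewrite le_eqVlt; apply/orP; left; apply/eqP; field; exact: lt0r_neq0.
Unshelve. all: by end_near. Qed.

Let bernoulli (p : R) n : 0 <= p <= 1 -> 1 - n%:R * p <= (1 - p) ^+ n.
Proof.
move=> /andP[p0 p1]; elim: n => [|n IH]; first by rewrite mul0r subr0 expr0.
rewrite exprS; have := ler_wpM2l (_ : 0 <= 1 - p) IH.
rewrite subr_ge0 => /(_ p1); apply: le_trans.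
have : 0 <= n%:R * p * p by rewrite !mulr_ge0.
by rewrite -natr1; nra.
Qed.

(** The limit of [(1 - s^N)^(2^N)] is decided by [2^N s^N]. Since [2 s = 1 + sin], this product
    tends to 0 or to infinity according to the sign of [x]. *)
Let powE j x : 2 ^+ (j.+1 ^ 2) * base j x ^+ (j.+1 ^ 2) =
  (1 + sin (x / j.+1%:R)) ^+ (j.+1 ^ 2).
Proof. by rewrite -exprMn /base mulrC divfK. Qed.

Lemma cvg_expR_seq x : 0 < x -> expR (- (j.+1%:R * x / 2)) @[j --> \oo] --> (0:R).
Proof.
move=> x0.
have : j.+1%:R * (x / 2) @[j --> \oo] --> +oo.
  apply/cvgryPge => M; apply: near_natr_ge; rewrite divr_gt0//.
move=> h; have := @cvg_comp _ _ _ (fun j => j.+1%:R * (x / 2)) (fun z => expR (- z)) _ _ _ h (@cvgr_expR R).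
by apply: cvg_trans; apply: near_eq_cvg; apply: nearW => j /=; rewrite mulrA.
Qed.

Lemma trig_step_cvg1 x : x < 0 -> trig_step j x @[j --> \oo] --> (1:R).
Proof.
move=> x0; pose z := - x; have z0 : 0 < z by rewrite oppr_gt0.
apply: (@squeeze_cvgr _ _ _ _ (fun j => 1 - expR (- (j.+1%:R * z / 2))) (cst 1)).
- near=> j; have /andP[_ ->] := trig_step01 j x; rewrite andbT.
  (* Bernoulli leaves [1 - 2^N s^N], where [2^N s^N = (1 - sin (z / (j+1)))^N <= exp (- N sin (z /
     (j+1)))]. *)
  apply: le_trans (bernoulli _ (power01 j x)).
  rewrite lerD2l lerN2 natrX powE.
  have hs : j.+1%:R * z / 2 <= j.+1%:R ^+ 2 * sin (z / j.+1%:R).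
    by near: j; exact: sin_seq_ge.
  have -> : x / j.+1%:R = - (z / j.+1%:R) by rewrite /z mulNr opprK.
  rewrite sinN.
  apply: (@le_trans _ _ (expR (- sin (z / j.+1%:R)) ^+ (j.+1 ^ 2))).
    apply: lerXn2r; rewrite ?nnegrE ?expR_ge0 ?subr_ge0 ?sin_le1//.
    exact: expR_ge1Dx.
  rewrite -expRM_natl ler_expR mulrN lerN2.
  by rewrite natrX.
- rewrite -[X in _ --> X]subr0; apply: cvgB; first exact: cvg_cst.
  exact: cvg_expR_seq.
- exact: cvg_cst.
Unshelve. all: by end_near. Qed.

Lemma trig_step_cvg0 x : 0 < x -> trig_step j x @[j --> \oo] --> (0:R).
Proof.
move=> x0.
apply: (@squeeze_cvgr _ _ _ _ (cst 0) (fun j => expR (- (j.+1%:R * x / 2)))).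
- near=> j; have /andP[-> _] := trig_step01 j x; rewrite /=.
  have hs : j.+1%:R * x / 2 <= j.+1%:R ^+ 2 * sin (x / j.+1%:R).
    by near: j; exact: sin_seq_ge.
  have /andP[p0 p1] := power01 j x.
  set p := base j x ^+ (j.+1 ^ 2) in p0 p1.
  (* [(1 - p)^(2^N) <= exp (- 2^N p)], and [2^N p = (1 + sin (x / (j+1)))^N] is at least
     [N sin (x / (j+1))]. *)
  apply: (@le_trans _ _ (expR (- p) ^+ (2 ^ (j.+1 ^ 2)))).
    apply: lerXn2r; rewrite ?nnegrE ?expR_ge0 ?subr_ge0//.
    exact: expR_ge1Dx.
  rewrite -expRM_natl ler_expR mulrN lerN2 natrX powE.
  apply: (le_trans hs).
  set s := sin _.
  have s0 : 0 <= s.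
    have : 0 <= j.+1%:R ^+ 2 * s by apply: le_trans hs; rewrite !mulr_ge0// ltW.
    by rewrite pmulr_rge0// exprn_gt0.
  have : forall m : nat, m%:R * s <= (1 + s) ^+ m.
    elim=> [|m IH]; first by rewrite mul0r.
    rewrite exprS -natr1 mulrDl mul1r [leRHS]mulrDl mul1r lerD//.
    by rewrite ler_peMr// exprn_ege1// lerDl.
  by move=> /(_ (j.+1 ^ 2)%N); rewrite natrX.
- exact: cvg_cst.
- exact: cvg_expR_seq.
Unshelve. all: by end_near. Qed.

End trigonometric_polynomials.

Section linear_forms_determine_rectangles.
Context {R : realType}.
Variables mu nu : probability (R * R)%type R.
Implicit Types (u v z a c : R).
Hypothesis linear_forms : forall u v z,
  mu [set p | u * p.1 + v * p.2 <= z] = nu [set p | u * p.1 + v * p.2 <= z].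

Let mlin u v : measurable_fun (setT : set (R * R)%type)
  (fun p => u * p.1 + v * p.2 : measurableTypeR R).
Proof. by apply: measurable_funD; apply: measurable_funM. Qed.

Let linE (m : probability (R * R)%type R) u v z :
  m [set p | u * p.1 + v * p.2 <= z] = image_measure m (mlin u v) `]-oo, z]%classic.
Proof.
by rewrite image_measureE; congr (m _); apply/seteqP; split => p /=; rewrite in_itv.
Qed.

(** The images of both measures under the linear form agree on half lines, hence as measures on the
    line, and the integrand factors through that form. *)
Let integral_cos u v c :
  (\int[mu]_p (cos (u * p.1 + v * p.2 + c))%:E =
   \int[nu]_p (cos (u * p.1 + v * p.2 + c))%:E)%E.
Proof.
pose g (y : R) := (cos (y + c))%:E.
have mg : measurable_fun (setT : set (measurableTypeR R)) (g : measurableTypeR R -> \bar R).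
  apply/measurable_EFinP; apply: (@measurableT_comp _ _ _ _ _ _ (@cos R)).
    by apply: continuous_measurable_fun; exact: continuous_cos.
  exact: measurable_funD.
have ig (m : probability (R * R)%type R) : m.-integrable setT (fun p => g (u * p.1 + v * p.2)).
  apply: measurable_bounded_integrable => //.
  - by rewrite (le_lt_trans (probability_le1 _ _))// ltry.
  - by have := measurableT_comp mg (mlin u v) => /measurable_EFinP.
  - exists 1; split => // M M1 p _ /=.
    by rewrite (le_trans (cos_max _))// ltW.
have E (m : probability (R * R)%type R) :
    (\int[m]_p g (u * p.1 + v * p.2)%R = \int[image_measure m (mlin u v)]_y g y)%E.
  have := @integral_pushforward _ _ _ _ _ _ (mlin u v) m setT g mg.
  by rewrite preimage_setT => /(_ (ig m) measurableT) <-.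
rewrite -[LHS]/(\int[mu]_p g (u * p.1 + v * p.2)%R)%E.
rewrite -[RHS]/(\int[nu]_p g (u * p.1 + v * p.2)%R)%E !E.
apply: eq_measure_integral => A mA _.
apply: measure_itvNy_unique => // z; first by rewrite -!linE.
rewrite image_measureE (@le_lt_trans _ _ 1%E) ?ltry//.
by apply: probability_le1; rewrite -[X in measurable X]setTI; exact: mlin.
Qed.

Let trigpolyP (f : R * R -> R) : trigpoly f ->
  [/\ forall m : probability (R * R)%type R, m.-integrable setT (fun p => (f p)%:E) &
   (\int[mu]_p (f p)%:E = \int[nu]_p (f p)%:E)%E].
Proof.
elim=> [u v c|f1 f2 _ [i1 e1] _ [i2 e2]|a f1 _ [i1 e1]].
- split; last exact: integral_cos.
  move=> m; apply: measurable_bounded_integrable => //.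
  + by rewrite (le_lt_trans (probability_le1 _ _))// ltry.
  + apply: (@measurableT_comp _ _ _ _ _ _ (@cos R)).
      by apply: continuous_measurable_fun; exact: continuous_cos.
    by apply: measurable_funD => //; exact: mlin.
  + exists 1; split => // M M1 p _ /=.
    by rewrite (le_trans (cos_max _))// ltW.
- split=> [m|]; first exact: (integrableD _ (i1 m) (i2 m)).
  under eq_integral do rewrite EFinD.
  rewrite (integralD _ (i1 mu) (i2 mu))// e1 e2 -(integralD _ (i1 nu) (i2 nu))//.
- split=> [m|]; first exact: (integrableZl measurableT a (i1 m)).
  under eq_integral do rewrite EFinM.
  by rewrite (integralZl measurableT (i1 mu)) e1 -(integralZl measurableT (i1 nu)).
Qed.

(** A product of two [trig_step] functions is a trigonometric polynomial with values in [[0, 1]]. It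
    converges to the indicator of the quadrant off the lines [p.1 = a] and [p.2 = c], which must
    therefore be null. *)
Lemma linear_forms_rectangle a c :
  mu [set p | p.1 = a] = 0%E -> mu [set p | p.2 = c] = 0%E ->
  nu [set p | p.1 = a] = 0%E -> nu [set p | p.2 = c] = 0%E ->
  mu [set p | p.1 <= a /\ p.2 <= c] = nu [set p | p.1 <= a /\ p.2 <= c].
Proof.
move=> mu1 mu2 nu1 nu2.
pose A := [set p : R * R | p.1 <= a /\ p.2 <= c].
have mle (h : R * R -> R) x : measurable_fun setT h -> measurable [set p | h p <= x].
  move=> mh; have -> : [set p | h p <= x] = setT `&` h @^-1` `]-oo, x].
    by rewrite setTI; apply/seteqP; split => p /=; rewrite in_itv.
  exact: mh.
have mA : measurable A by apply: measurableI; exact: mle.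
have meq (h : R * R -> R) x : measurable_fun setT h -> measurable [set p | h p = x].
  move=> mh; have -> : [set p | h p = x] = setT `&` h @^-1` [set x] by rewrite setTI.
  exact: mh.
pose f j (p : R * R) := trig_step j (p.1 - a) * trig_step j (p.2 - c).
have tf j : trigpoly (f j).
  apply: trigpolyM.
    by apply: (trigpoly_ext (trigpoly_step j 1 0 (- a))) => p; rewrite mul1r mul0r addr0.
  by apply: (trigpoly_ext (trigpoly_step j 0 1 (- c))) => p; rewrite mul1r mul0r add0r.
have f01 j p : 0 <= f j p <= 1.
  rewrite /f; have /andP[u0 u1] := trig_step01 j (p.1 - a).
  have /andP[v0 v1] := trig_step01 j (p.2 - c).
  by rewrite mulr_ge0// mulr_ile1.
have cvgf (p : R * R) : p.1 <> a -> p.2 <> c -> f j p @[j --> \oo] --> (\1_A p : R).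
  move=> p1 p2; rewrite indicE.
  have [p1a|ap1] := ltP p.1 a; last first.
    rewrite memNset; last by move=> [/= h _]; apply: p1; apply/eqP; rewrite eq_le h ap1.
    apply: (@squeeze_cvgr _ _ _ _ (cst 0) (fun j => trig_step j (p.1 - a))).
    - apply: nearW => j; have /andP[-> _] := f01 j p.
      by rewrite /f ler_piMr//; have /andP[] := trig_step01 j (p.2 - c);
        have /andP[] := trig_step01 j (p.1 - a).
    - exact: cvg_cst.
    - by apply: trig_step_cvg0; rewrite subr_gt0 lt_neqAle ap1 andbT eq_sym; apply/eqP.
  have [p2c|cp2] := ltP p.2 c; last first.
    rewrite memNset; last by move=> [/= _ h]; apply: p2; apply/eqP; rewrite eq_le h cp2.
    apply: (@squeeze_cvgr _ _ _ _ (cst 0) (fun j => trig_step j (p.2 - c))).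
    - apply: nearW => j; have /andP[-> _] := f01 j p.
      by rewrite /f ler_piMl//; have /andP[] := trig_step01 j (p.2 - c);
        have /andP[] := trig_step01 j (p.1 - a).
    - exact: cvg_cst.
    - by apply: trig_step_cvg0; rewrite subr_gt0 lt_neqAle cp2 andbT eq_sym; apply/eqP.
  rewrite mem_set; last by split; exact: ltW.
  rewrite -[X in _ --> X](mulr1 1); apply: cvgM; apply: trig_step_cvg1; rewrite subr_lt0//.
have key (m : probability (R * R)%type R) :
    m [set p | p.1 = a] = 0%E -> m [set p | p.2 = c] = 0%E ->
    (\int[m]_p (f j p)%:E @[j --> \oo] --> m A)%E.
  move=> m1 m2.
  have -> : m A = (\int[m]_p (\1_A p)%:E)%E by rewrite integral_indic// setIT.
  have [|||||_ _] := @dominated_convergence _ _ R m setT measurableT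
    (fun j p => (f j p)%:E) (fun p => (\1_A p)%:E) (cst 1%E); last exact.
  - by move=> j; have [/(_ m)/integrableP[]] := trigpolyP (tf j).
  - by apply/measurable_EFinP; exact: measurable_indic.
  - exists ([set p | p.1 = a] `|` [set p | p.2 = c]); split.
    + by apply: measurableU; exact: meq.
    + by rewrite null_set_setU//; exact: meq.
    + move=> p /=; apply: contra_notP => /not_orP[p1 p2] _.
      by apply: cvg_EFin; [exact: nearW|exact: cvgf].
  - exact: finite_measure_integrable_cst.
  - apply: aeW => p j _; have /andP[f0 f1] := f01 j p.
    by rewrite abse_EFin lee_fin ger0_norm.
have := key mu mu1 mu2.
under eq_fun => j do rewrite (trigpolyP (tf j)).2.
move=> kmu; exact: cvg_unique kmu (key nu nu1 nu2).
Qed.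

End linear_forms_determine_rectangles.

(** * Sums of independent normal variables and exceedance probabilities *)

Section bivariate_normal.
Context {R : realType}.
Notation N01 := (@normal_prob R 0 1).
Notation leb := (@lebesgue_measure R).
Implicit Types (x y z a c s t al be w : R).

(** Two factorizations of the joint density of [x] and [s = al x + be y], for independent standard
    normal [x] and [y]: marginal of [x] times conditional of [s], and marginal of [s] times
    conditional of [x]. *)
Lemma normal_pdfM al be x s : 0 < be ->
  let q := Num.sqrt (al ^+ 2 + be ^+ 2) in
  normal_pdf 0 1 x * normal_pdf (al * x) be s =
  normal_pdf 0 q s * normal_pdf (al * s / q ^+ 2) (be / q) x.
Proof.
move=> b0 q.
have q2 : q ^+ 2 = al ^+ 2 + be ^+ 2 by rewrite sqr_sqrtr// addr_ge0// sqr_ge0.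
have q2_gt0 : 0 < q ^+ 2 by rewrite q2 ltr_wpDl ?sqr_ge0// exprn_gt0.
have q0 : 0 < q by rewrite lt_neqAle sqrtr_ge0 andbT eq_sym -sqrf_eq0 gt_eqF.
rewrite !normal_pdfE ?oner_neq0 ?gt_eqF ?divr_gt0// /normal_fun.
rewrite mulrACA [RHS]mulrACA -!expRD; congr (_ * expR _).
  have peakE r : 0 < r -> normal_peak r = r^-1 * normal_peak 1 :> R.
    move=> r0; rewrite /normal_peak expr1n mul1r -mulrnAr sqrtrM ?sqr_ge0//.
    by rewrite sqrtr_sqr gtr0_norm// invfM.
  rewrite (peakE be)// (peakE q)// (peakE (be / q)) ?divr_gt0//.
  by field; rewrite !gt_eqF.
rewrite subr0 expr1n expr_div_n; field: q2.
by rewrite !gt_eqF// -q2.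
Qed.

(** After exchanging the integrals, the second factorization of the joint density isolates a normal
    density in [x], which integrates to 1. The case [be = 0] has no density and is treated apart. *)
Lemma normal_convolution al be z :
  (\int[N01]_x (cprob be (z - al * x))%:E =
   (cprob (Num.sqrt (al ^+ 2 + be ^+ 2)) z)%:E)%E.
Proof.
wlog be0 : be / 0 <= be.
  move=> h; have [/h//|b0] := leP 0 be.
  have := h (- be); rewrite oppr_ge0 sqrrN => /(_ (ltW b0)) <-.
  by apply: eq_integral => x _; rewrite cprobN.
move: be0; rewrite le_eqVlt => /predU1P[<-|be0].
  rewrite expr0n/= addr0 sqrtr_sqr cprob_norm cprobE.
  rewrite -[X in _ = N01 X]setIT -integral_indic//; last exact: measurable_cprob_set.
  apply: eq_integral => x _; rewrite cprob0 subr_ge0 indicE.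
  by have [h|h] := boolP (al * x <= z); [rewrite mem_set|rewrite memNset//; apply/negP].
set q := Num.sqrt _.
have q0 : 0 < q by rewrite sqrtr_gt0 ltr_wpDl ?sqr_ge0// exprn_gt0.
have mpdf2 : measurable_fun (setT : set (R * R)%type)
    (fun p : R * R => (normal_pdf 0 1 p.1 * normal_pdf (al * p.1) be p.2)%:E).
  apply/measurable_EFinP; apply: measurable_funM.
    by apply: measurableT_comp => //; exact: measurable_normal_pdf.
  have -> : (fun p : R * R => normal_pdf (al * p.1) be p.2) =
      (fun p => normal_pdf 0 be (p.2 - al * p.1)).
    by apply/funext => p; rewrite !normal_pdfE ?gt_eqF// /normal_fun subr0.
  apply: (@measurableT_comp _ _ _ _ _ _ (normal_pdf 0 be)).
    exact: measurable_normal_pdf.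
  by apply: measurable_funB => //; exact: measurable_funM.
have mD : measurable_fun (setT : set (R * R)%type)
    (fun p : R * R => ((normal_pdf 0 1 p.1 * normal_pdf (al * p.1) be p.2)%:E
       * (\1_(`]-oo, z]%classic : set R) p.2)%:E)%E).
  apply: emeasurable_funM => //; apply/measurable_EFinP.
  by apply: measurableT_comp => //; exact: measurable_indic.
have D0 (p : R * R) : (0 <= (normal_pdf 0 1 p.1 * normal_pdf (al * p.1) be p.2)%:E
       * (\1_(`]-oo, z]%classic : set R) p.2)%:E)%E.
  by rewrite mule_ge0 ?lee_fin ?mulr_ge0 ?normal_pdf_ge0.
have pdfI m s (A : set R) : measurable A ->
    (normal_prob m s A = \int[leb]_t ((normal_pdf m s t)%:E * (\1_A t)%:E))%E.
  move=> mA; rewrite /normal_prob integral_mkcond; apply: eq_integral => t _.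
  by rewrite /patch indicE; case: ifPn; rewrite ?mule1 ?mule0.
transitivity (\int[leb]_x (\int[leb]_s ((normal_pdf 0 1 x * normal_pdf (al * x) be s)%:E
   * (\1_(`]-oo, z]%classic : set R) s)%:E)))%E.
  rewrite (ge0_integral_density (mu := leb) (p := normal_pdf 0 1))//.
  - apply: eq_integral => x _.
    rewrite cprob_gt0// -normal_prob_itv// pdfI// muleC -ge0_integralZl//.
    + by apply: eq_integral => s _; rewrite EFinM muleA.
    + apply: emeasurable_funM; apply/measurable_EFinP; first exact: measurable_normal_pdf.
      exact: measurable_indic.
    + by move=> s _; rewrite mule_ge0 ?lee_fin ?normal_pdf_ge0.
    + by rewrite lee_fin normal_pdf_ge0.
  - exact: measurable_normal_pdf.
  - by move=> x; exact: normal_pdf_ge0.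
  - apply/measurable_EFinP; have -> : (fun x => cprob be (z - al * x)) =
      (fun x => Phi ((z - al * x) / be)) by apply/funext => x; rewrite cprob_gt0.
    apply: (@measurableT_comp _ _ _ _ _ _ (@Phi R)).
      by apply: continuous_measurable_fun; exact: continuous_Phi.
    by apply: measurable_funM => //; apply: measurable_funB => //; exact: measurable_funM.
  - by move=> x; rewrite lee_fin cprob_ge0.
have := @fubini_tonelli _ _ _ _ R leb leb _ mD D0.
rewrite /fubini_F /fubini_G /= => ->.
transitivity (\int[leb]_s ((normal_pdf 0 q s)%:E * (\1_(`]-oo, z]%classic : set R) s)%:E))%E.
  apply: eq_integral => s _.
  transitivity (\int[leb]_x ((normal_pdf 0 q s * (\1_(`]-oo, z]%classic : set R) s))%:E
      * (normal_pdf (al * s / q ^+ 2) (be / q) x)%:E))%E.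
    apply: eq_integral => x _; rewrite -!EFinM; congr EFin.
    by rewrite [LHS]mulrC (normal_pdfM _ _ _ be0) -/q [LHS]mulrC mulrAC.
  rewrite ge0_integralZl//.
  - by rewrite integral_normal_pdf mule1.
  - by apply/measurable_EFinP; exact: measurable_normal_pdf.
  - by move=> x _; rewrite lee_fin normal_pdf_ge0.
  - by rewrite lee_fin mulr_ge0 ?normal_pdf_ge0.
by rewrite -pdfI// normal_prob_itv// subr0 cprob_gt0.
Qed.

End bivariate_normal.

Section exceedance.
Context {R : realType}.
Notation N01 := (@normal_prob R 0 1).
Notation leb := (@lebesgue_measure R).
Implicit Types (x y z a b c s t rho w : R).

(* Turns two independent standard normal variables into a pair with correlation
   [rho]. *)
Definition normal_pair rho (p : R * R) : R * R :=
  (p.1, rho * p.1 + Num.sqrt (1 - rho ^+ 2) * p.2).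

Lemma measurable_normal_pair rho :
  measurable_fun (setT : set (measurableTypeR R * measurableTypeR R)%type)
    (normal_pair rho : _ -> (R * R)%type).
Proof.
apply/measurable_fun_pairP; split => /=; first exact: measurable_fst.
apply: measurable_funD; apply: measurable_funM => //.
Qed.

Definition normal_pair_rv rho :
    {mfun (measurableTypeR R * measurableTypeR R)%type >-> (R * R)%type} :=
  HB.pack (normal_pair rho)
    (isMeasurableFun.Build _ _ _ _ _ (measurable_normal_pair rho)).

Definition normal_pair_law rho : probability (R * R)%type R :=
  distribution (N01 \x N01)%E (normal_pair_rv rho).

Lemma normal_pair_law_linear rho u v z : -1 <= rho <= 1 ->
  normal_pair_law rho [set p | u * p.1 + v * p.2 <= z] =
  (cprob (Num.sqrt (u ^+ 2 + v ^+ 2 + 2 * u * v * rho)) z)%:E.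
Proof.
move=> /andP[rho1 rho2]; rewrite /normal_pair_law /distribution /pushforward/=.
pose tau := Num.sqrt (1 - rho ^+ 2).
have tau2 : tau ^+ 2 = 1 - rho ^+ 2 by rewrite sqr_sqrtr//; nra.
pose al := u + v * rho; pose be := v * tau.
have -> : u ^+ 2 + v ^+ 2 + 2 * u * v * rho = al ^+ 2 + be ^+ 2.
  by rewrite /al /be exprMn tau2; ring.
rewrite -normal_convolution /product_measure1; apply: eq_integral => x _ /=.
rewrite cprobE; congr normal_prob; apply/seteqP; split => y; rewrite /xsection /=.
  by rewrite inE/= -/tau /be /al; lra.
by rewrite inE/= -/tau /be /al; lra.
Qed.

Lemma normal_pair_law_rectangle rho a c :
  normal_pair_law rho [set p | p.1 <= a /\ p.2 <= c] =
  (\int[N01]_(x in `]-oo, a]) (cprob (Num.sqrt (1 - rho ^+ 2)) (c - rho * x))%:E)%E.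
Proof.
rewrite /normal_pair_law /distribution /pushforward/= /product_measure1.
rewrite [RHS]integral_mkcond; apply: eq_integral => x _ /=.
rewrite /patch mem_setE in_itv/=; case: ifPn => xa.
  rewrite cprobE; congr normal_prob; apply/seteqP; split => y; rewrite /xsection /= inE/=.
    by move=> [_]; lra.
  by move=> h; split => //; lra.
rewrite [X in normal_prob _ _ X](_ : _ = set0) ?measure0//.
by apply/seteqP; split => y //; rewrite /xsection /= inE/= (negbTE xa) => -[].
Qed.

Lemma normal_null_point a : N01 [set a] = 0%E.
Proof.
rewrite /normal_prob; apply: null_set_integral => //.
  by apply: measurable_funTS; apply/measurable_EFinP; exact: measurable_normal_pdf.
exact: lebesgue_measure_set1.
Qed.

Lemma normal_marginal_null (m : probability (R * R)%type R) (h : R * R -> R) a :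
  measurable_fun setT h ->
  (forall z, m [set p | h p <= z] = (cprob 1 z)%:E) -> m [set p | h p = a] = 0%E.
Proof.
move=> mh hz.
have mh' : measurable_fun (setT : set (R * R)%type) (h : _ -> measurableTypeR R) by exact: mh.
rewrite -(normal_null_point a).
apply: (@measure_itvNy_unique R (image_measure m mh') N01) => //.
- move=> z; transitivity (m [set p | h p <= z]).
    by rewrite image_measureE; congr (m _); apply/seteqP; split => p /=; rewrite in_itv.
  rewrite hz cprobE; congr normal_prob.
  by apply/seteqP; split => y /=; rewrite in_itv/= mul1r.
- move=> z; rewrite image_measureE (@le_lt_trans _ _ 1%E) ?ltry//.
  by apply: probability_le1; rewrite -[X in measurable X]setTI; exact: mh'.
Qed.

(** [m] is known only through linear forms, so it is replaced by [normal_pair_law rho], where Fubini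
    conditions on the first coordinate. The integral of the conditional probability over the whole
    line is [cprob 1 c], which turns the part below [a] into the part above it. *)
Lemma bivariate_normal_exceedance (m : probability (R * R)%type R) rho a c :
  -1 <= rho <= 1 ->
  (forall u v z, m [set p | u * p.1 + v * p.2 <= z] =
    (cprob (Num.sqrt (u ^+ 2 + v ^+ 2 + 2 * u * v * rho)) z)%:E) ->
  (1 - m [set p | (p.1 <= a)%R /\ (p.2 <= c)%R] = N01 `]c, +oo[%classic +
   \int[N01]_(x in `]a, +oo[) (cprob (Num.sqrt (1 - rho ^+ 2)) (c - rho * x))%:E)%E.
Proof.
move=> rho1 mlin.
pose nu := normal_pair_law rho.
have nulin u v z := normal_pair_law_linear u v z rho1.
have marg1 (m' : probability (R * R)%type R) z : (forall u v z, m' [set p | u * p.1 + v * p.2 <= z] =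
    (cprob (Num.sqrt (u ^+ 2 + v ^+ 2 + 2 * u * v * rho)) z)%:E) ->
    m' [set p | p.1 <= z] = (cprob 1 z)%:E.
  move=> /(_ 1 0 z); rewrite expr1n expr0n/= !mulr0 mul0r !addr0 sqrtr1 => <-.
  by congr (m' _); apply/seteqP; split => p /=; rewrite mul1r mul0r addr0.
have marg2 (m' : probability (R * R)%type R) z : (forall u v z, m' [set p | u * p.1 + v * p.2 <= z] =
    (cprob (Num.sqrt (u ^+ 2 + v ^+ 2 + 2 * u * v * rho)) z)%:E) ->
    m' [set p | p.2 <= z] = (cprob 1 z)%:E.
  move=> /(_ 0 1 z); rewrite expr1n expr0n/= mulr0 !mul0r addr0 add0r sqrtr1 => <-.
  by congr (m' _); apply/seteqP; split => p /=; rewrite mul1r mul0r add0r.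
rewrite (@linear_forms_rectangle R m nu); last 5 first.
- by move=> u v z; rewrite mlin nulin.
- by apply: normal_marginal_null => // z; exact: marg1.
- by apply: normal_marginal_null => // z; exact: marg2.
- by apply: normal_marginal_null => // z; exact: marg1.
- by apply: normal_marginal_null => // z; exact: marg2.
pose g x := (cprob (Num.sqrt (1 - rho ^+ 2)) (c - rho * x))%:E.
have mg (D : set R) : measurable_fun D g.
  apply: measurable_funTS; apply/measurable_EFinP.
  apply: (@measurableT_comp _ _ _ _ _ _ (cprob (Num.sqrt (1 - rho ^+ 2)))); last first.
    by apply: measurable_funB => //; exact: measurable_funM.
  apply: nondecreasing_measurable => // w w' ww'.
  rewrite -lee_fin !cprobE le_measure ?inE//; [exact: measurable_cprob_set..|].
  by move=> z /= /le_trans; apply.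
have g0 x : (0 <= g x)%E by rewrite lee_fin cprob_ge0.
have gT : (\int[N01]_x g x = (cprob 1 c)%:E)%E.
  rewrite -(marg2 nu c nulin) /nu /normal_pair_law /distribution /pushforward/= /product_measure1.
  apply: eq_integral => x _; rewrite /g cprobE; congr normal_prob.
  by apply/seteqP; split => y; rewrite /xsection /= inE/=; lra.
have split_g : (\int[N01]_(x in `]-oo, a]) g x + \int[N01]_(x in `]a, +oo[) g x = (cprob 1 c)%:E)%E.
  rewrite -gT -ge0_integral_setU//; [by congr (integral _ _ _); exact: itv_setU_setT|exact: mg|].
  apply/disj_setPS => t /= []; rewrite !in_itv/= andbT => ta.
  by rewrite ltNge ta.
rewrite normal_pair_law_rectangle -/g.
have -> : N01 `]c, +oo[%classic = (1 - (cprob 1 c)%:E)%E.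
  rewrite -setCitvl probability_setC//; congr (1 - _)%E; rewrite cprobE.
  by congr normal_prob; apply/seteqP; split => y /=; rewrite in_itv/= mul1r.
have fin D : measurable D -> (\int[N01]_(x in D) g x)%E \is a fin_num.
  move=> mD; rewrite ge0_fin_numE ?integral_ge0//.
  apply: (@le_lt_trans _ _ (\int[N01]_x g x)%E); last by rewrite gT ltry.
  by apply: ge0_subset_integral => //; exact: mg.
have f1 := fin _ (measurable_itv `]-oo, a]).
have f2 := fin _ (measurable_itv `]a, +oo[).
rewrite -split_g -(fineK f1) -(fineK f2); move: (fine _) (fine _) => v w.
change ((1 - w)%:E = (1 - (w + v) + v)%:E); congr EFin; ring.
Qed.

(** Substitution [s = b + t / b]. The equation [b = n phi(b)] makes the constant [(n / b) phi(b)]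
    equal to 1, so the factor [n] is absorbed exactly, not just asymptotically. *)
Lemma integral_normal_tail b (n : R) x (g : R -> R) : 0 < b ->
  b = n * normal_pdf 0 1 b -> measurable_fun setT g -> (forall t, 0 <= g t) ->
  (n%:E * \int[N01]_(s in `](b + x / b)%R, +oo[) (g s)%:E =
   \int[leb]_(t in `]x, +oo[) (hr_weight (b ^- 2) t * g (b + t / b)%R)%:E)%E.
Proof.
move=> b0 bE mg g0.
pose f s := ((fun s => (g s)%:E) \_ `](b + x / b)%R, +oo[ s * (normal_pdf 0 1 s)%:E)%E.
have mgE : measurable_fun setT ((fun s => (g s)%:E) \_ `](b + x / b)%R, +oo[).
  by apply/(measurable_restrictT _ _).1 => //; apply: measurable_funTS; apply/measurable_EFinP.
have gE0 s : (0 <= ((fun s => (g s)%:E) \_ `](b + x / b)%R, +oo[) s)%E.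
  by rewrite /patch; case: ifPn => //; rewrite lee_fin.
have mf : measurable_fun setT f.
  by apply: emeasurable_funM => //; apply/measurable_EFinP; exact: measurable_normal_pdf.
have f0 s : (0 <= f s)%E by rewrite mule_ge0// lee_fin normal_pdf_ge0.
have bi0 : 0 < b^-1 by rewrite invr_gt0.
rewrite integral_mkcond (ge0_integral_density (mu := leb) (p := normal_pdf 0 1))//; last 2 first.
- exact: measurable_normal_pdf.
- by move=> t; exact: normal_pdf_ge0.
have := ge0_integral_affine b bi0 mf f0; rewrite invrK => /(congr1 (fun e => (n / b)%:E * e)%E).
rewrite muleA -EFinM divfK ?gt_eqF// => <-.
have n0 : 0 < n.
  move: b0; rewrite bE pmulr_lgt0// normal_pdfE ?oner_neq0//.
  by rewrite mulr_gt0 ?normal_peak_gt0 ?oner_neq0// expR_gt0.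
rewrite -ge0_integralZl//; last 2 first.
- apply: (@measurableT_comp _ _ _ _ _ _ _ _ (fun t => b + b^-1 * t)) mf _.
  by apply: measurable_funD => //; exact: measurable_funM.
- by rewrite lee_fin divr_ge0// ltW.
rewrite [RHS]integral_mkcond; apply: eq_integral => t _.
rewrite /f /patch !mem_setE !in_itv/= !andbT ltrD2l [b^-1 * t]mulrC ltr_pM2r//.
case: ifPn => _; last by rewrite mul0e mule0.
rewrite -!EFinM; congr EFin; rewrite mulrCA [RHS]mulrC; congr (_ * _).
rewrite /hr_weight; move: bE; rewrite !normal_pdfE ?oner_neq0//.
rewrite /normal_fun !subr0 expr1n => bE.
have pk : n / b * normal_peak 1 = expR (b ^+ 2 / 2).
  apply: (mulIf (lt0r_neq0 (expR_gt0 (- b ^+ 2 / (1 *+ 2))))).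
  rewrite -expRD -[1 *+ 2]/(2%:R : R) mulNr subrr expR0 -mulNr.
  move: (normal_peak 1) (expR _) bE => p1 e1 bE.
  have -> : n / b * p1 * e1 = n * (p1 * e1) / b by ring.
  by rewrite -bE divff// gt_eqF.
rewrite mulrA pk -expRD; congr expR.
by rewrite -[1 *+ 2]/(2%:R : R); field; rewrite gt_eqF.
Qed.

(** Given first coordinate [b + t / b], the second is normal with mean [rho (b + t / b)] and
    variance [1 - rho^2]. Multiplying threshold and deviation by [b] gives the arguments in
    [hr_kernel]; the next identity treats the variance. *)
Let scaled_threshold b y r t : b != 0 ->
  b * (b + y / b - (1 - 2 * r ^+ 2 / b ^+ 2) * (b + t / b)) =
  y - t + 2 * r ^+ 2 * (1 + b ^- 2 * t).
Proof. by move=> b0; field. Qed.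

Let scaled_variance b r : b != 0 ->
  1 - (1 - 2 * r ^+ 2 / b ^+ 2) ^+ 2 = (2 * r / b) ^+ 2 * (1 - b ^- 2 * r ^+ 2).
Proof. by move=> b0; field. Qed.

Lemma normal_exceedance_hr (m : probability (R * R)%type R) b (n : R) (l : ennreal R) r x y :
  let rho := 1 - 2 * r ^+ 2 / b ^+ 2 in
  ennval l = r%:E -> 0 < b -> b = n * normal_pdf 0 1 b -> -1 <= rho <= 1 ->
  (forall u v z, m [set p | u * p.1 + v * p.2 <= z] =
    (cprob (Num.sqrt (u ^+ 2 + v ^+ 2 + 2 * u * v * rho)) z)%:E) ->
  (n%:E * (1 - m [set p | (p.1 <= b + x / b)%R /\ (p.2 <= b + y / b)%R]) =
   hr_exponent (b ^- 2) l x y)%E.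
Proof.
move=> rho lr b0 bE rho1 mlin; rewrite (bivariate_normal_exceedance _ _ rho1 mlin).
have r0 : 0 <= r by rewrite -lee_fin -lr; exact: ennval_ge0.
rewrite ge0_muleDr//; last by apply: integral_ge0 => t _; rewrite lee_fin cprob_ge0.
congr (_ + _)%E.
  rewrite /hr_tail -[RHS](_ : \int[leb]_(t in `]y, +oo[)
    (hr_weight (b ^- 2) t * cst 1 (b + t / b)%R)%:E = _)%E; last first.
    by apply: eq_integral => t _; rewrite mulr1.
  rewrite -(@integral_normal_tail b n y (cst 1))//; congr (_ * _)%E.
  by rewrite (_ : (fun s => (cst 1 s)%:E) = cst 1%E)// integral_cst// mul1e.
pose g s := cprob (Num.sqrt (1 - rho ^+ 2)) (b + y / b - rho * s).
rewrite -[LHS]/(n%:E * \int[N01]_(s in `](b + x / b)%R, +oo[) (g s)%:E)%E.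
rewrite integral_normal_tail//; last 2 first.
- apply: (@measurableT_comp _ _ _ _ _ _ (cprob (Num.sqrt (1 - rho ^+ 2)))); last first.
    by apply: measurable_funB => //; exact: measurable_funM.
  apply: nondecreasing_measurable => // w w' ww'.
  rewrite -lee_fin !cprobE le_measure ?inE//; [exact: measurable_cprob_set..|].
  by move=> z /= /le_trans; apply.
- by move=> s; exact: cprob_ge0.
apply: eq_integral => t _; rewrite /hr_kernel lr /g; congr (_ * _)%:E.
have cprobZ c w : cprob (b * c) (b * w) = cprob c w.
  by congr (fine (normal_prob _ _ _)); apply/seteqP; split => z /=; rewrite -mulrA ler_pM2l.
have bn0 : b != 0 by rewrite gt_eqF.
rewrite -(cprobZ (Num.sqrt (1 - rho ^+ 2))) /rho scaled_threshold// scaled_variance//.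
rewrite sqrtrM ?sqr_ge0// sqrtr_sqr ger0_norm; last first.
  by apply: divr_ge0; [exact: mulr_ge0|exact: ltW].
by rewrite mulrA mulrCA divff// mulr1.
Qed.

End exceedance.

(** * Compactness of the half line and regularity of the integrand *)

Section compactified_half_line.
Context {R : realType}.

Lemma continuous_expN : continuous (@expN R).
Proof. by move=> l; apply: (@cvg_expN R (ennreal R) (nbhs l) _ id l); exact: cvg_id. Qed.

Lemma measurable_expN : measurable_fun setT (@expN R).
Proof.
suff : measurable_fun setT (@expN R : _ -> measurableTypeR R) by [].
apply: (measurability (RGenOInfty.G (R:=R))).
  exact: RGenOInfty.measurableE.
move=> _ [_ [x ->] <-]; rewrite setTI; apply: sub_sigma_algebra.
have /continuousP := continuous_expN; apply.
exact: interval_open.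
Qed.

Lemma ennval_proof (e : R) :
  (0 <= if (e <= 0)%R then +oo else if (1 <= e)%R then 0 else (- ln e)%:E)%E.
Proof.
case: ifPn => // e0; case: ifPn => //; rewrite -ltNge => e1.
rewrite lee_fin oppr_ge0 -ln1 ler_ln ?posrE ?ltW//.
by rewrite ltNge.
Qed.

(* The inverse of [expN], from [0, 1] clamped to the line. *)
Definition expN_inv (e : R) : ennreal R := Ennreal (ennval_proof e).

Lemma expN_invK (e : R) : expN (expN_inv e) = Num.max 0 (Num.min 1 e).
Proof.
rewrite /expN/=; case: (leP e 0) => [e0|e0].
  by rewrite /= min_r ?(le_trans e0)// max_l.
case: (leP 1 e) => [e1|e1] /=; first by rewrite oppr0 expR0 max_r.
by rewrite opprK lnK ?posrE// max_r// ltW.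
Qed.

Lemma expN_inj : injective (@expN R).
Proof.
move=> l l' ll'; apply: val_inj => /=.
by rewrite !ennvalE ll'.
Qed.

Lemma continuous_expN_inv : continuous expN_inv.
Proof.
move=> e A; rewrite -nbhs_ballE => -[d /= d0 dA].
have : \forall e' \near e, `|Num.max 0 (Num.min 1 e) - Num.max 0 (Num.min 1 e')| < d.
  have : Num.max 0 (Num.min 1 e') @[e' --> e] --> Num.max 0 (Num.min 1 e).
    apply: (@continuous_max _ _ (cst 0) (fun e' : R => Num.min 1 e')).
      exact: cvg_cst.
    apply: (@continuous_min _ _ (cst 1) idfun); first exact: cvg_cst.
    exact: cvg_id.
  by move=> /cvgrPdist_lt; apply.
by apply: filterS => e' he'; apply: dA; rewrite ball_ennreal !expN_invK.
Qed.

(** The half line is the image of [[0, 1]] under the continuous inverse of [expN]. *)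
Lemma compact_ennreal : compact [set: ennreal R].
Proof.
have -> : [set: ennreal R] = expN_inv @` `[0, 1].
  apply/seteqP; split => // l _; exists (expN l).
    by rewrite /= in_itv/= expN_ge0 expN_le1.
  by apply: expN_inj; rewrite expN_invK min_r ?expN_le1// max_r// expN_ge0.
apply: continuous_compact; last exact: segment_compact.
by apply: continuous_subspaceT; exact: continuous_expN_inv.
Qed.

End compactified_half_line.

(** If the property failed, points at distance less than [1 / (k+1)] from [z] with indices at least
    [k] would form a counterexample sequence. This turns sequential limits, as dominated convergence
    provides them, into statements about neighbourhoods. *)
Lemma near_of_seq (R : realType) (T : pseudoMetricType R) (P : nat -> T -> Prop) (z : T) :
  (forall (m : nat -> nat) (u : nat -> T), (forall k, (k <= m k)%N) ->
    u k @[k --> \oo] --> z -> exists k, P (m k) (u k)) ->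
  \forall z' \near z & n \near \oo, P n z'.
Proof.
move=> H; apply: contrapT => nP.
have /choice[s sP] : forall k : nat, exists p : nat * T,
    [/\ (k <= p.1)%N, ball z k.+1%:R^-1 p.2 & ~ P p.1 p.2].
  move=> k; apply: contrapT => nk; apply: nP.
  exists (ball z k.+1%:R^-1, [set n | (k <= n)%N]); first split => /=.
  - by apply: nbhsx_ballx; rewrite invr_gt0 ltr0n.
  - by exists k.
  - move=> [z' n] /= [zz' kn]; apply: contrapT => nP'; apply: nk.
    by exists (n, z').
have mk k : (k <= (s k).1)%N by have [] := sP k.
have [|k] := H (fun k => (s k).1) (fun k => (s k).2) mk.
  apply/cvg_ballP => e e0; near=> k.
  have [_ zk _] := sP k; apply: le_ball zk.
  have : 1 <= k.+1%:R * e by near: k; exact: near_natr_ge.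
  by rewrite -ler_pdivrMl ?ltr0n// mulr1.
by have [_ _] := sP k.
Unshelve. all: by end_near. Qed.

Section integrandF_regularity.
Context {R : realType}.
Notation T := (ennreal R * (R * R))%type.
Implicit Types (x y : R).

Lemma cvg_triple (u : nat -> T) (z : T) : u k @[k --> \oo] --> z ->
  [/\ (u k).1 @[k --> \oo] --> z.1, (u k).2.1 @[k --> \oo] --> z.2.1 &
   (u k).2.2 @[k --> \oo] --> z.2.2].
Proof.
move=> uz.
have c21 : continuous (fun p : T => p.2.1).
  by move=> p; apply: (@continuous_comp _ _ _ snd fst); [exact: cvg_snd|exact: cvg_fst].
have c22 : continuous (fun p : T => p.2.2).
  by move=> p; apply: (@continuous_comp _ _ _ snd snd); [exact: cvg_snd|exact: cvg_snd].
have c1 : continuous (fun p : T => p.1) by move=> p; exact: cvg_fst.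
by split; [exact: (continuous_cvg _ (c1 z) uz)|exact: (continuous_cvg _ (c21 z) uz)|
  exact: (continuous_cvg _ (c22 z) uz)].
Qed.

Lemma integrandF_seq (k : R^nat) (u : nat -> T) (x' y' : nat -> R) (x0 y0 : R) (z : T) :
  (forall n, 0 <= k n) ->
  (forall n r, ennval (u n).1 = r%:E -> k n * r ^+ 2 <= 1) ->
  k n @[n --> \oo] --> (0 : R) -> u n @[n --> \oo] --> z ->
  x' n @[n --> \oo] --> x0 - z.2.1 -> y' n @[n --> \oo] --> y0 - z.2.2 ->
  fine (hr_exponent (k n) (u n).1 (x' n) (y' n)) @[n --> \oo] --> integrandF x0 y0 z.
Proof.
move=> k0 ku kcvg /cvg_triple[u1 _ _] xcvg ycvg.
have := hr_exponent_cvg k0 ku kcvg xcvg ycvg u1.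
by rewrite -integrandFE => /fine_cvg.
Qed.

(** The case of [k] constantly 0 in the convergence of [hr_exponent]; the points [lambda = 0] and
    [lambda = +oo] need no separate limits. *)
Lemma continuous_integrandF x y : continuous (@integrandF R x y).
Proof.
move=> z; apply/cvgrPdist_lt => e e0.
have : \forall z' \near z & n \near \oo, `|integrandF x y z - integrandF x y z'| < e.
  apply: (@near_of_seq R T (fun _ z' => _ < e)) => m u _ uz.
  have [_ u1 u2] := cvg_triple uz.
  have := @integrandF_seq (cst 0) u (fun n => x - (u n).2.1)
    (fun n => y - (u n).2.2) x y z (fun=> lexx _) _ (cvg_cst _) uz _ _.
  have eq0 : (fun n => fine (hr_exponent (cst 0 n) (u n).1 (x - (u n).2.1) (y - (u n).2.2))) =
      (fun n => integrandF x y (u n)) by apply/funext => n; rewrite -integrandFE.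
  move=> h; have /cvgrPdist_lt/(_ e e0)[N _ NP] : integrandF x y (u n) @[n --> \oo] --> integrandF x y z.
    rewrite -eq0; apply: h.
    - by move=> n r _; rewrite mul0r ler01.
    - by apply: cvgB => //; exact: cvg_cst.
    - by apply: cvgB => //; exact: cvg_cst.
  by exists N; apply: NP => /=.
move=> [[A B] [/= zA [N _ BN]] AB].
by apply: filterS zA => z' Az'; apply: (AB (z', N)); split => //; apply: BN => /=; exact: leqnn.
Qed.

Lemma measurable_integrandF x y : measurable_fun setT (@integrandF R x y).
Proof.
pose e (z : T) := expN z.1; pose r (z : T) := - ln (e z).
have me : measurable_fun setT e by apply: measurableT_comp => //; exact: measurable_expN.
have mr : measurable_fun setT r.
  by apply: measurableT_comp => //; apply: measurableT_comp => //; exact: measurable_ln.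
have m1 : measurable_fun setT (fun z : T => z.2.1) by exact: measurableT_comp.
have m2 : measurable_fun setT (fun z : T => z.2.2) by exact: measurableT_comp.
have mx : measurable_fun setT (fun z : T => x - z.2.1) by exact: measurable_funB.
have my : measurable_fun setT (fun z : T => y - z.2.2) by exact: measurable_funB.
have mex : measurable_fun setT (fun z : T => expR (- (x - z.2.1))).
  by apply: measurableT_comp => //; exact: measurableT_comp.
have mey : measurable_fun setT (fun z : T => expR (- (y - z.2.2))).
  by apply: measurableT_comp => //; exact: measurableT_comp.
have mPhi : measurable_fun setT (@Phi R).
  by apply: continuous_measurable_fun; exact: continuous_Phi.
(* Division by [2 r] is written with [exp (- ln (2 r))], a composition of measurable functions; the
   two agree in the only branch that uses it, where [2 r > 0]. *)
have mq : measurable_fun setT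
    (fun z : T => (y - x + z.2.1 - z.2.2) * expR (- ln (2 * r z))).
  apply: measurable_funM.
    by apply: measurable_funB => //; exact: measurable_funD.
  apply: measurableT_comp => //; apply: measurableT_comp => //.
  by apply: measurableT_comp; [exact: measurable_ln|exact: measurable_funM].
have -> : @integrandF R x y = (fun z : T => if e z == 0 then
    expR (- (x - z.2.1)) + expR (- (y - z.2.2)) else if r z == 0 then
    expR (- Num.min (x - z.2.1) (y - z.2.2)) else
    Phi (r z + (y - x + z.2.1 - z.2.2) * expR (- ln (2 * r z))) * expR (- (x - z.2.1))
       + Phi (r z - (y - x + z.2.1 - z.2.2) * expR (- ln (2 * r z))) * expR (- (y - z.2.2))).
  apply/funext => z; rewrite /integrandF ennvalE -/(e z) -/(r z).
  case: ifPn => // ez; case: ifPn => // rz.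
  have r0 : 0 < 2 * r z.
    rewrite pmulr_rgt0// lt0r rz /r oppr_ge0 -ln1.
    by rewrite ler_ln ?posrE// ?expN_le1// lt0r ez expN_ge0.
  by have -> : expR (- ln (2 * r z)) = (2 * r z)^-1 by rewrite expRN lnK.
apply: measurable_fun_ifT; [exact: measurable_fun_eqr|exact: measurable_funD|].
apply: measurable_fun_ifT; [exact: measurable_fun_eqr| |].
  apply: measurableT_comp => //; apply: measurableT_comp => //.
  exact: measurable_minr.
by apply: measurable_funD; apply: measurable_funM => //; apply: (measurableT_comp mPhi);
  [exact: measurable_funD|exact: measurable_funB].
Qed.

End integrandF_regularity.

(** * Averages of varying functions *)

Section averages.
Context d (T : topMeasurableType d) {R : realType}.

Lemma integral_empirical n (z : 'I_n.+1 -> T) (g : T -> R) :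
  measurable_fun setT g -> (forall t, 0 <= g t) ->
  (\int[empirical R z]_t (g t)%:E = (n.+1%:R^-1 * \sum_(i < n.+1) g (z i))%:E)%E.
Proof.
move=> mg g0.
have mg' : measurable_fun setT (EFin \o g) by exact/measurable_EFinP.
transitivity (\int[mscale ((n.+1%:R^-1)%:nng : {nonneg R})%R
    (msum (fun k => \d_(z (inord k))) n.+1)]_t (g t)%:E)%E.
  apply: eq_measure_integral => A mA _.
  rewrite /= /empirical /mscale /msum/=; congr (_ * _)%E.
  by apply: eq_bigr => i _; rewrite inord_val.
rewrite ge0_integral_mscale//; last by move=> t _; rewrite lee_fin.
rewrite ge0_integral_measure_sum//; last by move=> t _; rewrite lee_fin.
rewrite /= EFinM -sumEFin; congr (_ * _)%E; apply: eq_bigr => i _.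
by rewrite integral_dirac// diracT mul1e inord_val.
Qed.

(** Weak convergence is applied only to the bounded functions [F * chi M] and [chi M]. Where [chi M]
    is positive, [f] is uniformly close to [F]; the rest of the average is at most that of
    [(A + k w) (1 - chi M)], hence small since [chi M] has [eta] mass close to 1 and [w] has bounded
    averages. *)
Lemma varying_average_cvg (z : forall n, 'I_n.+1 -> T) (eta : probability T R)
    (f w : forall n, 'I_n.+1 -> R) (F : T -> R) (chi : nat -> T -> R) (S : R) :
  weak_cvg (fun n => empirical R (z n)) eta ->
  continuous F -> measurable_fun setT F -> (forall t, 0 <= F t) ->
  (forall M, continuous (chi M)) -> (forall M, measurable_fun setT (chi M)) ->
  (forall M t, 0 <= chi M t <= 1) ->
  (forall t, nondecreasing_seq (chi ^~ t)) ->
  (forall t, chi M t @[M --> \oo] --> (1 : R)) ->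
  (forall M, exists B, forall t, F t * chi M t <= B) ->
  (forall n i, 0 <= f n i) ->
  (forall (e : R) M, 0 < e -> \forall n \near \oo, forall i,
     chi M (z n i) != 0 -> `|f n i - F (z n i)| <= e) ->
  (forall k : R, 0 < k -> exists2 A : R, 0 <= A &
     \forall n \near \oo, forall i, f n i <= A + k * w n i) ->
  (forall n i, 0 <= w n i) ->
  (forall n, n.+1%:R^-1 * \sum_(i < n.+1) w n i <= S) ->
  (\int[eta]_t (F t)%:E)%E \is a fin_num /\
  n.+1%:R^-1 * \sum_(i < n.+1) f n i @[n --> \oo] --> fine (\int[eta]_t (F t)%:E)%E.
Proof.
move=> cvgeta cF mF F0 cchi mchi chi01 ndchi chi1 FB f0 unif tail w0 wS.
pose avg (g : forall n, 'I_n.+1 -> R) n := n.+1%:R^-1 * \sum_(i < n.+1) g n i.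
have avgD g h n : avg (fun n i => g n i + h n i) n = avg g n + avg h n.
  by rewrite /avg big_split mulrDr.
have avgZ c g n : avg (fun n i => c * g n i) n = c * avg g n.
  by rewrite /avg -mulr_sumr mulrCA.
have avgc c n : avg (fun n i => c) n = c.
  by rewrite /avg sumr_const card_ord -[c *+ _]mulr_natl mulKf// pnatr_eq0.
have avg_le g h n : (forall i, g n i <= h n i) -> avg g n <= avg h n.
  by move=> gh; rewrite ler_pM2l ?invr_gt0 ?ltr0n//; exact: ler_sum.
pose I M := fine (\int[eta]_t (F t * chi M t)%:E)%E.
pose c M := fine (\int[eta]_t (chi M t)%:E)%E.
have chi0 M t : 0 <= chi M t by have /andP[] := chi01 M t.
have chile M t : chi M t <= 1 by have /andP[] := chi01 M t.
have Fchi0 M t : 0 <= F t * chi M t by rewrite mulr_ge0.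
have cvg_avg (g : T -> R) : continuous g -> measurable_fun setT g -> (forall t, 0 <= g t) ->
    (exists B, forall t, g t <= B) -> (\int[eta]_t (g t)%:E)%E \is a fin_num /\
    avg (fun n i => g (z n i)) n @[n --> \oo] --> fine (\int[eta]_t (g t)%:E)%E.
  move=> cg mg g0 [B gB].
  have fin : (\int[eta]_t (g t)%:E)%E \is a fin_num.
    rewrite ge0_fin_numE; last by apply: integral_ge0 => t _; rewrite lee_fin.
    apply: (@le_lt_trans _ _ (\int[eta]_t (cst B%:E t))%E).
      apply: ge0_le_integral => //.
      - by move=> t _; rewrite lee_fin.
      - exact/measurable_EFinP.
      - by move=> t _; rewrite lee_fin.
    by rewrite integral_cst//= probability_setT mule1 ltry.
  split=> //.
  have : (\int[empirical R (z n)]_t (g t)%:E)%E @[n --> \oo] --> (\int[eta]_t (g t)%:E)%E.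
    by apply: cvgeta => //; exists B => t; rewrite ger0_norm.
  rewrite -{1}(fineK fin) => /fine_cvg.
  by under eq_fun do rewrite /= integral_empirical//.
have [Ifin cvgI] : (forall M, (\int[eta]_t (F t * chi M t)%:E)%E \is a fin_num) /\
    (forall M, avg (fun n i => F (z n i) * chi M (z n i)) n @[n --> \oo] --> I M).
  have H M := cvg_avg (fun t => F t * chi M t)
    (fun t => cvgM (cF t) (cchi M t)) (measurable_funM mF (mchi M)) (Fchi0 M) (FB M).
  by split => M; have [] := H _ M.
have [cfin cvgc] : (forall M, (\int[eta]_t (chi M t)%:E)%E \is a fin_num) /\
    (forall M, avg (fun n i => chi M (z n i)) n @[n --> \oo] --> c M).
  have H M := cvg_avg (chi M) (cchi M) (mchi M) (chi0 M) (ex_intro _ 1 (chile M)).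
  by split => M; have [] := H M.
have c1 : c M @[M --> \oo] --> (1 : R).
  have : (\int[eta]_t (chi M t)%:E)%E @[M --> \oo] --> (\int[eta]_t (cst 1%:E t))%E.
    rewrite (_ : cst 1%:E = fun t => limn (fun M => (chi M t)%:E)).
      apply: cvg_monotone_convergence => //.
      - by move=> M; exact/measurable_EFinP.
      - by move=> M t _; rewrite lee_fin.
      - by move=> t _ M N MN; rewrite lee_fin; exact: ndchi.
    apply/funext => t; apply/esym/cvg_lim => //.
    by apply: cvg_EFin; [exact: nearW|exact: chi1].
  by rewrite integral_cst//= probability_setT mule1 => /fine_cvg.
have Icvg : (\int[eta]_t (F t * chi M t)%:E)%E @[M --> \oo] --> (\int[eta]_t (F t)%:E)%E.
  rewrite (_ : (fun t => (F t)%:E) = fun t => limn (fun M => (F t * chi M t)%:E)).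
    apply: cvg_monotone_convergence => //.
    - by move=> M; apply/measurable_EFinP; exact: measurable_funM.
    - by move=> M t _; rewrite lee_fin.
    - by move=> t _ M N MN; rewrite lee_fin ler_wpM2l//; exact: ndchi.
  apply/funext => t; apply/esym/cvg_lim => //.
  apply: cvg_EFin; first exact: nearW.
  by rewrite -[X in _ --> X]mulr1; apply: cvgM; [exact: cvg_cst|exact: chi1].
have lower e M : 0 < e -> \forall n \near \oo, I M - e <= avg f n.
  move=> e0; have e20 : 0 < e / 2 by rewrite divr_gt0.
  have /cvgrPdist_le/(_ _ e20) H := cvgI M.
  near=> n; have /ler_distlDr : `|I M - avg (fun n i => F (z n i) * chi M (z n i)) n| <= e / 2.
    by near: n.
  suff : avg (fun n i => F (z n i) * chi M (z n i)) n <= avg f n + e / 2 by lra.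
  rewrite -(avgc (e / 2) n) -avgD; apply: avg_le => i.
  have [chiz|chiz] := eqVneq (chi M (z n i)) 0.
    by rewrite chiz mulr0 addr_ge0// ltW.
  have : `|f n i - F (z n i)| <= e / 2.
    by move: (i) chiz; near: n; exact: unif.
  have := chile M (z n i); have := F0 (z n i) => F0z le1 /ler_normlP[]; rewrite opprB => h _.
  by apply: (@le_trans _ _ (F (z n i))); [rewrite ler_piMr|lra].
have upper e k A M : 0 < e -> 0 < k -> 0 <= A ->
    (\forall n \near \oo, forall i, f n i <= A + k * w n i) ->
    \forall n \near \oo, avg f n <= I M + A * (1 - c M) + k * S + e.
  move=> e0 k0 A0 fA; have e20 : 0 < e / 3 by rewrite divr_gt0.
  have /cvgrPdist_le/(_ _ e20) H := cvgI M.
  have /cvgrPdist_le/(_ _ e20) H' : A * avg (fun n i => chi M (z n i)) n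
      @[n --> \oo] --> A * c M by apply: cvgM; [exact: cvg_cst|exact: cvgc].
  near=> n.
  have : `|I M - avg (fun n i => F (z n i) * chi M (z n i)) n| <= e / 3 by near: n.
  have : `|A * c M - A * avg (fun n i => chi M (z n i)) n| <= e / 3 by near: n.
  move=> /ler_normlP[_ h1] /ler_normlP[+ _]; rewrite opprB => h2.
  have h3 : k * avg w n <= k * S by rewrite ler_pM2l //; exact: wS.
  suff : avg f n <= avg (fun n i => F (z n i) * chi M (z n i)) n + e / 3
      + A * (1 - avg (fun n i => chi M (z n i)) n) + k * avg w n by lra.
  have -> : A * (1 - avg (fun n i => chi M (z n i)) n) =
      A + (- A) * avg (fun n i => chi M (z n i)) n by ring.
  rewrite -[X in _ + X](avgZ k) -(avgZ (- A)) -[X in _ + (X + _)](avgc A n).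
  rewrite -(avgc (e / 3) n) -!avgD; apply: avg_le => i.
  have fi : f n i <= A + k * w n i by move: (i); near: n.
  have [chiz|chiz] := eqVneq (chi M (z n i)) 0.
    by rewrite chiz !mulr0 add0r addr0; lra.
  have /ler_normlP[_ h] : `|f n i - F (z n i)| <= e / 3.
    by move: (i) chiz; near: n; exact: unif.
  have le1 := chile M (z n i); have ge0 := chi0 M (z n i).
  have kw : 0 <= k * w n i by rewrite mulr_ge0// ltW.
  (* [f] is split as [f chi + f (1 - chi)]: closeness to [F] bounds the first part, the tail
     hypothesis the second. *)
  have a1 : f n i * chi M (z n i) <= (F (z n i) + e / 3) * chi M (z n i).
    by rewrite ler_wpM2r//; lra.
  have a2 : f n i * (1 - chi M (z n i)) <= (A + k * w n i) * (1 - chi M (z n i)).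
    by rewrite ler_wpM2r// subr_ge0.
  have a3 : e / 3 * chi M (z n i) <= e / 3 by rewrite ler_piMr// ltW.
  have a4 : 0 <= k * w n i * chi M (z n i) by rewrite mulr_ge0.
  by lra.
(* Each truncated integral is within 1 of a row average, itself at most [A + S]; this bound does not
   depend on [M]. *)
have fin : (\int[eta]_t (F t)%:E)%E \is a fin_num.
  rewrite ge0_fin_numE; last by apply: integral_ge0 => t _; rewrite lee_fin.
  have [A A0 fA] := tail 1 ltr01.
  suff : (\int[eta]_t (F t)%:E <= (A + 1 * S + 1)%:E)%E.
    by move/le_lt_trans; apply; exact: ltry.
  rewrite -(cvg_lim _ Icvg)//; apply: lime_le; first by apply/cvg_ex; eexists; exact: Icvg.
  apply: nearW => M; rewrite -(fineK (Ifin M)) lee_fin.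
  have [n [h1 h2]] : exists n, I M - 1 <= avg f n /\ forall i, f n i <= A + 1 * w n i.
    have [N _ H] : \forall n \near \oo, I M - 1 <= avg f n /\ forall i, f n i <= A + 1 * w n i.
      by near=> n; split; near: n; [exact: lower|exact: fA].
    by exists N; apply: H => /=.
  suff : avg f n <= A + 1 * S by move: h1; rewrite /I; lra.
  have : avg f n <= avg (fun n i => A + 1 * w n i) n by exact: avg_le.
  by rewrite avgD avgZ avgc => /le_trans; apply; rewrite lerD2l ler_pM2l //; exact: wS.
split=> //; move: Icvg; rewrite -{1}(fineK fin) => /fine_cvg Icvg.
apply/cvgrPdist_le => e e0; have e40 : 0 < e / 4 by rewrite divr_gt0.
(* The order of choices matters: [k] depends on [S], then [A] on [k], then the cutoff level [M] on
   [A], and finally n on all of them. *)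
pose k := e / 4 / (`|S| + 1).
have S1 : 0 < `|S| + 1 by rewrite ltr_wpDl.
have k0 : 0 < k by rewrite divr_gt0.
have kS : k * S <= e / 4.
  rewrite /k mulrAC -mulrA ler_piMr ?(ltW e40)// ler_pdivrMr// mul1r.
  by rewrite (le_trans (ler_norm _))// lerDl.
have [A A0 fA] := tail k k0.
have [M [IM AM]] : exists M, `|fine (\int[eta]_t (F t)%:E)%E - I M| <= e / 4 /\
    A * (1 - c M) <= e / 4.
  have /cvgrPdist_le/(_ _ e40) H := Icvg.
  have /cvgr_le/(_ (e / 4)) H' : A * (1 - c M) @[M --> \oo] --> (0 : R).
    rewrite -(mulr0 A) -(subrr (1 : R)); apply: cvgM; first exact: cvg_cst.
    by apply: cvgB; [exact: cvg_cst|exact: c1].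
  have [N _ HN] : \forall M \near \oo, `|fine (\int[eta]_t (F t)%:E)%E - I M| <= e / 4 /\
      A * (1 - c M) <= e / 4 by near=> M; split; near: M; [exact: H|exact: H'].
  by exists N; apply: HN => /=.
near=> n.
have h1 : I M - e / 4 <= avg f n by near: n; exact: lower.
have h2 : avg f n <= I M + A * (1 - c M) + k * S + e / 4 by near: n; exact: upper.
rewrite -/(avg f n); apply/ler_normlP; move/ler_normlP: IM => [].
by move: AM kS h1 h2; clear; move: (fine _) (avg f n) (I M) => ? ? ?; split; lra.
Unshelve. all: by end_near. Qed.

End averages.

(** * Cutoff functions and exponential interpolation *)

Section cutoff.
Context {R : realType}.
Implicit Types (M : nat) (t : R).

Definition cutoff M t : R := Num.max 0 (Num.min 1 (M.+1%:R - `|t|)).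

Lemma cutoff01 M t : 0 <= cutoff M t <= 1.
Proof. by rewrite /cutoff le_max lexx/= ge_max ler01 ge_min lexx. Qed.

Lemma nondecreasing_cutoff t : nondecreasing_seq (cutoff ^~ t).
Proof.
move=> M N MN; rewrite /cutoff; apply: (le_max2 (lexx _)).
by apply: (le_min2 (lexx _)); rewrite lerD2r ler_nat.
Qed.

Lemma cutoff_cvg t : cutoff M t @[M --> \oo] --> (1 : R).
Proof.
apply: cvg_near_cst; near=> M.
have : 1 + `|t| <= M.+1%:R * 1 by near: M; exact: near_natr_ge.
move=> tM; rewrite /cutoff min_l ?max_r//.
by rewrite lerBrDr; rewrite mulr1 in tM.
Unshelve. all: by end_near. Qed.

Lemma continuous_cutoff M : continuous (cutoff M).
Proof.
move=> t; apply: (@continuous_max _ _ (cst 0) (fun t => Num.min 1 (M.+1%:R - `|t|))).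
  exact: cvg_cst.
apply: (@continuous_min _ _ (cst 1) (fun t => M.+1%:R - `|t|)); first exact: cvg_cst.
by apply: cvgB; [exact: cvg_cst|exact: norm_continuous].
Qed.

Lemma cutoff_neq0 M t : cutoff M t != 0 -> `|t| <= M.+1%:R.
Proof.
rewrite /cutoff => t0; rewrite leNgt; apply/negP => tM; case/eqP: t0.
by apply: max_l; rewrite ge_min subr_le0 (ltW tM) orbT.
Qed.

End cutoff.

(** Up to [t0] the first term suffices. Beyond it, [q t <= (1 + eps) t - (eps / 2) t], and the last
    term is at least [t0 (eps / 2)]. Thus large [t0] makes the coefficient of the moment small,
    uniformly in [q]. *)
Lemma expR_interpolation (R : realType) (eps q t0 t : R) :
  0 < eps -> 0 <= q <= 1 + eps / 2 -> 0 <= t0 ->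
  expR (q * t) <= expR (t0 * (1 + eps)) + expR (- (t0 * (eps / 2))) * expR (t * (1 + eps)).
Proof.
move=> e0 /andP[q0 q1] t00; have [tt0|tt0] := leP t t0.
  apply: (@le_trans _ _ (expR (t0 * (1 + eps)))); last first.
    by rewrite lerDl mulr_ge0// expR_ge0.
  rewrite ler_expR (@le_trans _ _ (q * t0))//; first exact: ler_wpM2l.
  by rewrite mulrC ler_wpM2l//; lra.
apply: (@le_trans _ _ (expR (- (t0 * (eps / 2))) * expR (t * (1 + eps)))); last first.
  by rewrite lerDr expR_ge0.
rewrite -expRD ler_expR.
have h1 : t0 * (eps / 2) <= t * (eps / 2) by rewrite ler_wpM2r ?ltW// divr_gt0.
have h2 : q * t <= (1 + eps / 2) * t by rewrite ler_wpM2r// (le_trans t00)// ltW.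
by move: h1 h2; clear; lra.
Qed.

(** * Convergence of the row averages of the exponents *)

Section hr_average.
Context {R : realType}.
Notation T := (ennreal R * (R * R))%type.

(* With k = b^-2 and theta = b^2 (1 - 1/sigma), the threshold (b + x / b) / sigma
   is b + x' / b for x' = x - theta - k x theta. *)
Definition perturbed_exponent (k x y : R) (t : T) : R :=
  fine (hr_exponent k t.1 (x - t.2.1 - k * x * t.2.1) (y - t.2.2 - k * y * t.2.2)).

(** With [k = b^-2] and [lambda^2 = b^2 (1 - rho) / 2] this says that [rho >= -1]. *)
Definition admissible (k : R) (t : T) :=
  forall r, ennval t.1 = r%:E -> k * r ^+ 2 <= 1.

Lemma perturbed_exponent_ge0 k x y t : 0 <= perturbed_exponent k x y t.
Proof. by apply: fine_ge0; exact: hr_exponent_ge0. Qed.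

(** Along any sequence tending to [z], both functions converge to [integrandF x y z]. Compactness of
    [K], which contains every [lambda] including infinity, upgrades this to uniformity. *)
Lemma perturbed_exponent_uniform (k : R^nat) (x y e : R) (M : nat) :
  (forall n, 0 <= k n) -> k n @[n --> \oo] --> (0 : R) -> 0 < e ->
  \forall n \near \oo, forall t : T, `|t.2.1| <= M%:R -> `|t.2.2| <= M%:R ->
    admissible (k n) t -> `|perturbed_exponent (k n) x y t - integrandF x y t| <= e.
Proof.
move=> k0 kcvg e0.
pose K : set T := setT `*` (`[- M%:R, M%:R] `*` `[- M%:R, M%:R]).
have /compact_near_coveringP cK : compact K.
  by apply: compact_setX; [exact: compact_ennreal|
    apply: compact_setX; exact: segment_compact].
pose Q n (t : T) := admissible (k n) t ->
  `|perturbed_exponent (k n) x y t - integrandF x y t| <= e.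
have : \forall n \near \oo, K `<=` Q n.
  apply: cK => z _; apply: near_of_seq => m u mk uz.
  apply: contrapT => nQ.
  have {nQ} nQ j : admissible (k (m j)) (u j) /\
      e < `|perturbed_exponent (k (m j)) x y (u j) - integrandF x y (u j)|.
    apply: contrapT => h; apply: nQ; exists j => adm; rewrite leNgt; apply/negP => le.
    by apply: h.
  have moo : m j @[j --> \oo] --> \oo.
    apply/cvgnyPge => A; near=> j; apply: leq_trans (mk j).
    by near: j; exact: nbhs_infty_ge.
  have kcvg' : k (m j) @[j --> \oo] --> (0 : R) by exact: (cvg_comp _ _ moo kcvg).
  have [_ u1 u2] := cvg_triple uz.
  have c1 (a b : R) (v : nat -> R) : v j @[j --> \oo] --> b ->
      a - v j - k (m j) * a * v j @[j --> \oo] --> a - b.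
    move=> vb; rewrite -[X in _ --> X]subr0; apply: cvgB.
      by apply: cvgB => //; exact: cvg_cst.
    rewrite -(mul0r b) -(mul0r a); apply: cvgM => //.
    by apply: cvgM => //; exact: cvg_cst.
  have h := @integrandF_seq R (k \o m) u _ _ x y z (fun j => k0 (m j))
    (fun j r => (nQ j).1 r) kcvg' uz (c1 x _ _ u1) (c1 y _ _ u2).
  have h' : integrandF x y (u j) @[j --> \oo] --> integrandF x y z.
    exact: (continuous_cvg _ (@continuous_integrandF R x y z) uz).
  have : perturbed_exponent (k (m j)) x y (u j) - integrandF x y (u j)
      @[j --> \oo] --> (0 : R).
    by rewrite -(subrr (integrandF x y z)); exact: cvgB.
  move/cvgrPdist_lt => /(_ e e0)[N _ /(_ N (leqnn N))].
  rewrite sub0r normrN => le.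
  by have := lt_trans le (nQ N).2; rewrite ltxx.
apply: filterS => n KQ t t1 t2; apply: KQ.
by split => //; split => /=; rewrite in_itv/= -ler_norml.
Unshelve. all: by end_near. Qed.

Lemma perturbed_exponent_le (eps k x y t0 : R) (t : T) : 0 < eps -> 0 <= k ->
  `|k * x| <= Num.min 1 (eps / 2) -> `|k * y| <= Num.min 1 (eps / 2) -> 0 <= t0 ->
  perturbed_exponent k x y t <= (expR (- x) + expR (- y)) *
   (expR (t0 * (1 + eps)) + expR (- (t0 * (eps / 2))) *
     (expR (t.2.1 * (1 + eps)) + expR (t.2.2 * (1 + eps)))).
Proof.
move=> e0 k0 kx ky t00.
have hk (a : R) : `|k * a| <= Num.min 1 (eps / 2) -> 0 <= 1 + k * a <= 1 + eps / 2.
  by rewrite le_min => /andP[/ler_normlP[h1 h2] /ler_normlP[h3 h4]]; apply/andP; split; lra.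
have h a s : `|k * a| <= Num.min 1 (eps / 2) -> expR (- (a - s - k * a * s)) <=
    expR (- a) * (expR (t0 * (1 + eps)) + expR (- (t0 * (eps / 2))) * expR (s * (1 + eps))).
  move=> ka; rewrite (_ : - _ = - a + (1 + k * a) * s); last by ring.
  rewrite expRD ler_wpM2l ?expR_ge0//.
  by apply: expR_interpolation => //; exact: hk.
have := @hr_exponent_le R k t.1 (x - t.2.1 - k * x * t.2.1) (y - t.2.2 - k * y * t.2.2) k0.
rewrite -(fineK (hr_exponent_fin_num _ _ _ k0)) lee_fin => /le_trans; apply.
apply: le_trans (lerD (h x t.2.1 kx) (h y t.2.2 ky)) _.
rewrite [leRHS]mulrDl; apply: lerD; rewrite ler_wpM2l ?expR_ge0//.
  by rewrite lerD2l ler_wpM2l ?expR_ge0// lerDl expR_ge0.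
by rewrite lerD2l ler_wpM2l ?expR_ge0// lerDr expR_ge0.
Qed.

Lemma hr_average_cvg (z : forall n, 'I_n.+1 -> T) (eta : probability T R)
    (k : R^nat) (eps S x y : R) :
  weak_cvg (fun n => empirical R (z n)) eta -> 0 < eps ->
  (forall n, 0 <= k n) -> k n @[n --> \oo] --> (0 : R) ->
  (forall n i, admissible (k n) (z n i)) ->
  (forall n, n.+1%:R^-1 * \sum_(i < n.+1)
     (expR ((z n i).2.1 * (1 + eps)) + expR ((z n i).2.2 * (1 + eps))) <= S) ->
  [/\ (\int[eta]_t (integrandF x y t)%:E)%E \is a fin_num,
   n.+1%:R^-1 * \sum_(i < n.+1) perturbed_exponent (k n) x y (z n i) @[n --> \oo] -->
     fine (\int[eta]_t (integrandF x y t)%:E)%E &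
   forall e : R, 0 < e -> \forall n \near \oo, forall i,
     n.+1%:R^-1 * perturbed_exponent (k n) x y (z n i) <= e].
Proof.
move=> zeta e0 k0 kcvg adm momS.
pose w n (i : 'I_n.+1) := expR ((z n i).2.1 * (1 + eps)) + expR ((z n i).2.2 * (1 + eps)).
have w0 n i : 0 <= w n i by rewrite addr_ge0 ?expR_ge0.
have knear (a : R) : \forall n \near \oo, `|k n * a| <= Num.min 1 (eps / 2).
  have : k n * a @[n --> \oo] --> (0 : R).
    by rewrite -(mul0r a); apply: cvgM => //; exact: cvg_cst.
  move/cvgrPdist_le/(_ (Num.min 1 (eps / 2))).
  rewrite lt_min ltr01 divr_gt0// => /(_ erefl); apply: filterS => n.
  by rewrite sub0r normrN.
have tail : forall kap : R, 0 < kap -> exists2 A : R, 0 <= A & \forall n \near \oo,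
    forall i, perturbed_exponent (k n) x y (z n i) <= A + kap * w n i.
  move=> kap kap0; pose C := expR (- x) + expR (- y).
  have C0 : 0 < C by rewrite addr_gt0 ?expR_gt0.
  (* Solves [C exp (- t0 eps / 2) <= kap], so that the interpolated bound has weight at most [kap]
     on the moment term. *)
  pose t0 := Num.max 0 (- ln (kap / C) / (eps / 2)).
  have t00 : 0 <= t0 by rewrite le_max lexx.
  have e20 : 0 < eps / 2 by rewrite divr_gt0.
  have t0P : C * expR (- (t0 * (eps / 2))) <= kap.
    rewrite mulrC -ler_pdivlMr// -[leRHS]lnK ?posrE ?divr_gt0// ler_expR.
    by rewrite lerNl -ler_pdivrMr// le_max lexx orbT.
  exists (C * expR (t0 * (1 + eps))); first by rewrite mulr_ge0 ?expR_ge0// ltW.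
  near=> n => i.
  have := @perturbed_exponent_le eps (k n) x y t0 (z n i) e0 (k0 n) _ _ t00.
  move=> h; apply: le_trans (h _ _) _; [by near: n|by near: n|].
  by rewrite -/C -/(w n i) mulrDr lerD2l mulrA ler_wpM2r.
have [fin cvg] : (\int[eta]_t (integrandF x y t)%:E)%E \is a fin_num /\
   n.+1%:R^-1 * \sum_(i < n.+1) perturbed_exponent (k n) x y (z n i) @[n --> \oo] -->
     fine (\int[eta]_t (integrandF x y t)%:E)%E.
  apply: (@varying_average_cvg _ _ R z eta
    (fun n i => perturbed_exponent (k n) x y (z n i)) w (integrandF x y)
    (fun M t => cutoff M t.2.1 * cutoff M t.2.2) S) => //.
  - exact: continuous_integrandF.
  - exact: measurable_integrandF.
  - by move=> t; exact: integrandF_ge0.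
  - move=> M t; apply: cvgM.
      apply: (@continuous_comp _ _ _ (fun t : T => t.2.1) (cutoff M)).
        by apply: (@continuous_comp _ _ _ snd fst); [exact: cvg_snd|exact: cvg_fst].
      exact: continuous_cutoff.
    apply: (@continuous_comp _ _ _ (fun t : T => t.2.2) (cutoff M)).
      by apply: (@continuous_comp _ _ _ snd snd); [exact: cvg_snd|exact: cvg_snd].
    exact: continuous_cutoff.
  - move=> M; apply: measurable_funM.
      apply: (@measurableT_comp _ _ _ _ _ _ (cutoff M)); last exact: measurableT_comp.
      by apply: continuous_measurable_fun; exact: continuous_cutoff.
    apply: (@measurableT_comp _ _ _ _ _ _ (cutoff M)); last exact: measurableT_comp.
    by apply: continuous_measurable_fun; exact: continuous_cutoff.
  - move=> M t; have /andP[a0 a1] := cutoff01 M t.2.1.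
    have /andP[b0 b1] := cutoff01 M t.2.2.
    by rewrite mulr_ge0//= mulr_ile1.
  - move=> t M N MN; apply: ler_pM.
    + by have /andP[] := cutoff01 M t.2.1.
    + by have /andP[] := cutoff01 M t.2.2.
    + exact: nondecreasing_cutoff.
    + exact: nondecreasing_cutoff.
  - by move=> t; rewrite -[X in _ --> X]mulr1; apply: cvgM; exact: cutoff_cvg.
  - move=> M; exists (expR (- (x - M.+1%:R)) + expR (- (y - M.+1%:R))) => t.
    have [->|] := eqVneq (cutoff M t.2.1 * cutoff M t.2.2) 0.
      by rewrite mulr0 addr_ge0 ?expR_ge0.
    rewrite mulf_eq0 negb_or => /andP[/cutoff_neq0 z1 /cutoff_neq0 z2].
    have /andP[a0 a1] := cutoff01 M t.2.1; have /andP[b0 b1] := cutoff01 M t.2.2.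
    apply: (@le_trans _ _ (integrandF x y t)).
      by rewrite ler_piMr ?integrandF_ge0// mulr_ile1.
    apply: le_trans (integrandF_le x y t) _.
    move/ler_normlP: z1 => [_ z1]; move/ler_normlP: z2 => [_ z2].
    by apply: lerD; rewrite ler_expR lerN2 lerD2l lerN2.
  - by move=> n i; exact: perturbed_exponent_ge0.
  - move=> e M e1; have := @perturbed_exponent_uniform k x y e M.+1 k0 kcvg e1.
    apply: filterS => n H i; rewrite mulf_eq0 negb_or => /andP[/cutoff_neq0 z1 /cutoff_neq0 z2].
    exact: H.
(* One weight [w n i] can be as large as the whole sum, at most [(n+1) S]. The small factor [kap],
   with [kap S <= e / 2], is what makes a single term negligible after division by [n+1]. *)
split=> // e e1; pose kap := e / 2 / (`|S| + 1).
have S1 : 0 < `|S| + 1 by rewrite ltr_wpDl.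
have kap0 : 0 < kap by rewrite !divr_gt0.
have kapS : kap * S <= e / 2.
  have e20 : 0 <= e / 2 by rewrite divr_ge0// ltW.
  rewrite /kap mulrAC -mulrA ler_piMr// ler_pdivrMr// mul1r.
  by rewrite (le_trans (ler_norm _))// lerDl.
have [A A0 fA] := tail kap kap0; near=> n => i.
have h1 : perturbed_exponent (k n) x y (z n i) <= A + kap * w n i by move: (i); near: n.
have h2 : A <= n.+1%:R * (e / 2) by near: n; apply: near_natr_ge; rewrite divr_gt0.
have h3 : kap * w n i <= n.+1%:R * (e / 2).
  apply: le_trans (_ : kap * (n.+1%:R * S) <= _); last first.
    by rewrite mulrCA ler_wpM2l.
  rewrite ler_wpM2l ?(ltW kap0)//; apply: le_trans (_ : \sum_(i < n.+1) w n i <= _).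
    by rewrite (bigD1 i)//= lerDl sumr_ge0.
  by rewrite -ler_pdivrMl ?ltr0n//; exact: momS.
rewrite ler_pdivrMl ?ltr0n//; apply: le_trans h1 _.
by apply: le_trans (lerD h2 h3) _; rewrite -mulrDr -splitr.
Unshelve. all: by end_near. Qed.

End hr_average.

(** * Measures on the plane from distribution functions *)

Section rectangle_semiring.
Context d1 d2 (T1 : semiRingOfSetsType d1) (T2 : semiRingOfSetsType d2).

(** A copy of the product, to carry the semiring of rectangles instead of the product
    sigma-algebra. *)
Definition rectangle_type : Type := (T1 * T2)%type.

Definition rectangle : set (set rectangle_type) :=
  [set A `*` B | A in measurable & B in measurable].

Let rectangle0 : rectangle set0.
Proof. by exists set0 => //; exists set0 => //; rewrite setX0. Qed.

Let rectangleI : setI_closed rectangle.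
Proof.
move=> _ _ [A mA [B mB <-]] [A' mA' [B' mB' <-]]; rewrite -setXI.
by exists (A `&` A'); [exact: measurableI|exists (B `&` B') => //; exact: measurableI].
Qed.

Let rectangleD : semi_setD_closed rectangle.
Proof.
move=> _ _ [A mA [B mB <-]] [A' mA' [B' mB' <-]].
have [D [finD mD AD tD]] := semi_measurableD _ _ mA mA'.
have [E [finE mE BE tE]] := semi_measurableD _ _ mB mB'.
(* [(A x B) \ (A' x B')] is the disjoint union of [(A \ A') x B] and [(A & A') x (B \ B')]; each
   difference is then decomposed in its own semiring. *)
exists ([set X `*` B | X in D] `|` [set (A `&` A') `*` Y | Y in E]); split.
- by rewrite finite_setU; split; exact: finite_image.
- move=> _ [[X DX <-]|[Y EY <-]].
    by exists X; [exact: mD|exists B].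
  by exists (A `&` A'); [exact: measurableI|exists Y => //; exact: mE].
- apply/seteqP; split => [[p q] [[/= Ap Bq] nAB]|].
    have [A'p|A'p] := pselect (A' p).
      have : (B `\` B') q by split => // B'q; apply: nAB.
      rewrite BE => -[Y EY Yq]; exists ((A `&` A') `*` Y) => //.
      by right; exists Y.
    have : (A `\` A') p by [].
    by rewrite AD => -[X DX Xp]; exists (X `*` B) => //; left; exists X.
  move=> [p q] [_ [[X DX <-]|[Y EY <-]] [/= h1 h2]].
    have : (A `\` A') p by rewrite AD; exists X.
    by move=> [Ap A'p]; split => // -[].
  have : (B `\` B') q by rewrite BE; exists Y.
  by move=> [Bq B'q]; split; [split => //; exact: h1.1|move=> -[]].
- have DP X p : D X -> X p -> A p /\ ~ A' p.
    by move=> DX Xp; have : (A `\` A') p by rewrite AD; exists X.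
  move=> _ _ [[X DX <-]|[Y EY <-]] [[X' DX' <-]|[Y' EY' <-]] [[p q] [[/= h1 h2] [h3 h4]]].
  + by rewrite (tD X X' DX DX') //; exists p.
  + by have [_ /(_ h3.2)] := DP _ _ DX h1.
  + by have [_ /(_ h1.2)] := DP _ _ DX' h3.
  + by rewrite (tE Y Y' EY EY') //; exists q.
Qed.

HB.instance Definition _ := Pointed.on rectangle_type.
HB.instance Definition _ := isSemiRingOfSets.Build
  (measure_prod_display (d1, d2)) rectangle_type rectangle0 rectangleI rectangleD.

End rectangle_semiring.

Section quadrant.
Context {R : realType}.
Implicit Types (m : probability (R * R)%type R) (a b c d x y : R).

Definition quadrant x y : set (R * R) := `]-oo, x] `*` `]-oo, y].
Definition box a b c d : set (R * R) := `]a, b] `*` `]c, d].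

Lemma measurable_quadrant x y : measurable (quadrant x y).
Proof. by apply: measurableX; exact: measurable_itv. Qed.

Lemma measurable_box a b c d : measurable (box a b c d).
Proof. by apply: measurableX; exact: measurable_itv. Qed.

Lemma le_quadrant m x y x' y' : x <= x' -> y <= y' ->
  (m (quadrant x y) <= m (quadrant x' y'))%E.
Proof.
move=> xx' yy'; apply: le_measure; rewrite ?inE; [exact: measurable_quadrant|exact: measurable_quadrant|].
move=> [p q] [/=]; rewrite !in_itv/= => px qy; split => /=; rewrite in_itv/=.
  exact: le_trans xx'.
exact: le_trans yy'.
Qed.

Lemma probability_box m a b c d : a <= b -> c <= d ->
  let F x y := fine (m (quadrant x y)) in
  m (box a b c d) = (F b d - F a d - F b c + F a c)%:E.
Proof.
move=> ab cd F.
have FE x y : m (quadrant x y) = (F x y)%:E.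
  by rewrite fineK// fin_num_measure//; exact: measurable_quadrant.
pose strip y : set (R * R) := `]a, b] `*` `]-oo, y].
have mstrip y : measurable (strip y) by apply: measurableX; exact: measurable_itv.
have stripE y : m (strip y) = (F b y - F a y)%:E.
  have : m (quadrant b y) = (m (quadrant a y) + m (strip y))%E.
    rewrite -measureU//.
    - congr (m _); apply/seteqP; split => [[p q]|[p q]].
        move=> [/=]; rewrite !in_itv/= => pb qy.
        have [pa|pa] := leP p a; first by left; split; rewrite /= in_itv.
        by right; split; rewrite /= in_itv//= pa.
      move=> [] [/=]; rewrite !in_itv/=.
        by move=> pa qy; split; rewrite /= in_itv//= (le_trans pa).
      by move=> /andP[_ pb] qy; split; rewrite /= in_itv.
    - exact: measurable_quadrant.
    - apply/seteqP; split => // -[p q] [[/= + _] [/= + _]]; rewrite !in_itv/=.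
      by move=> pa /andP[/lt_le_trans/(_ pa)]; rewrite ltxx.
  rewrite !FE; have : m (strip y) \is a fin_num by exact: fin_num_measure.
  case: (m (strip y)) => // s _; rewrite -EFinD => -[->].
  by rewrite addrC addKr.
have : m (strip d) = (m (strip c) + m (box a b c d))%E.
  rewrite -measureU//.
  - congr (m _); apply/seteqP; split => [[p q]|[p q]].
      move=> [/=]; rewrite !in_itv/= => pb qy.
      have [pa|pa] := leP q c; first by left; split; rewrite /= in_itv.
      by right; split; rewrite /= in_itv//= pa.
    move=> [] [/=]; rewrite !in_itv/=.
      by move=> pa qy; split; rewrite /= in_itv//= (le_trans qy).
    by move=> pb /andP[_ qy]; split; rewrite /= in_itv.
  - exact: measurable_box.
  - apply/seteqP; split => // -[p q] [[/= _ +] [/= _ +]]; rewrite !in_itv/=.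
    by move=> pa /andP[/lt_le_trans/(_ pa)]; rewrite ltxx.
rewrite !stripE; have : m (box a b c d) \is a fin_num.
  by apply: fin_num_measure; exact: measurable_box.
case: (m (box a b c d)) => // s _; rewrite -EFinD => -[h].
by congr (_%:E); move: h; clear; lra.
Qed.

Lemma box0 a b c d : (b <= a) || (d <= c) -> box a b c d = set0.
Proof.
move=> h; apply/seteqP; split => // -[p q] [/=]; rewrite !in_itv/=.
move=> /andP[ap pb] /andP[cq qd]; case/orP: h.
  by move=> /(lt_le_trans (lt_le_trans ap pb)); rewrite ltxx.
by move=> /(lt_le_trans (lt_le_trans cq qd)); rewrite ltxx.
Qed.

End quadrant.

Lemma open_rectangle (T1 T2 : topologicalType) (A : set T1) (B : set T2) :
  open A -> open B -> open (A `*` B).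
Proof.
move=> oA oB; rewrite openE => -[p q] [/= Ap Bq]; exists (A, B) => //.
by split; exact: open_nbhs_nbhs.
Qed.

(** * A probability measure from limits of quadrant probabilities *)

Section limit_content.
Local Open Scope ereal_scope.
Context {R : realType}.
Variables (P : nat -> probability (R * R)%type R) (G : R -> R -> R).
Hypothesis PG : forall x y, P n (quadrant x y) @[n --> \oo] --> (G x y)%:E.
(** Right continuity along the diagonal; by monotonicity it controls each coordinate, and it fits
    the homogeneity of the limiting exponent. *)
Hypothesis G_right : forall x y : R, G (x + t)%R (y + t)%R @[t --> 0^'+] --> G x y.

Lemma limit_cdf_nondecreasing x y x' y' : (x <= x')%R -> (y <= y')%R -> (G x y <= G x' y')%R.
Proof.
move=> xx' yy'; rewrite -lee_fin; apply: (lee_cvg_to (@PG x y) (@PG x' y')).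
by apply: nearW => n; exact: le_quadrant.
Qed.

Notation T := (rectangle_type (ocitv_type R) (ocitv_type R)).

(** The upper limit is defined for every set; on the semiring it is a true limit, so additivity is
    inherited from [P n]. *)
Definition limit_content (A : set T) : \bar R := limn_esup (fun n => P n A).

Lemma limit_content_ge0 A : 0 <= limit_content A.
Proof.
apply: limf_esup_ge0; last by move=> n; exact: measure_ge0.
by move=> [N _ /(_ N (leqnn N))].
Qed.

Lemma limit_contentE A l : P n A @[n --> \oo] --> l -> limit_content A = l.
Proof. by move=> /cvg_limn_einf_sup[]. Qed.

Lemma cvg_box a b c d : (a <= b)%R -> (c <= d)%R ->
  P n (box a b c d) @[n --> \oo] --> (G b d - G a d - G b c + G a c)%:E.
Proof.
move=> ab cd; under eq_fun do rewrite probability_box//.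
have cG x y : fine (P n (quadrant x y)) @[n --> \oo] --> G x y.
  by have := @PG x y => /fine_cvg.
apply: cvg_EFin; first exact: nearW.
by apply: cvgD => //; apply: cvgB => //; apply: cvgB.
Qed.

Lemma ocitv_box (A : set T) : measurable A -> exists a b c d, A = box a b c d.
Proof.
by move=> [_ [x _ <-] [_ [y _ <-] <-]]; exists x.1, x.2, y.1, y.2.
Qed.

Lemma box_ocitv a b c d : measurable (box a b c d : set T).
Proof.
by exists `]a, b]%classic; [exists (a, b)|exists `]c, d]%classic => //; exists (c, d)].
Qed.

Lemma boxP (A : set T) : measurable A -> A = set0 \/
  exists a b c d, [/\ (a < b)%R, (c < d)%R & A = box a b c d].
Proof.
move=> /ocitv_box[a [b [c [d ->]]]].
have [ba|ab] := leP b a; first by left; rewrite box0// ba.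
have [dc|cd] := leP d c; first by left; rewrite box0// dc orbT.
by right; exists a, b, c, d.
Qed.

Lemma limit_content_cvg (A : set T) : measurable A ->
  limit_content A \is a fin_num /\ P n A @[n --> \oo] --> limit_content A.
Proof.
move=> /boxP[->|[a [b [c [d [/ltW ab /ltW cd ->]]]]]].
  have h : P n set0 @[n --> \oo] --> 0.
    by under eq_fun do rewrite measure0; exact: cvg_cst.
  by rewrite (limit_contentE h).
have h := cvg_box ab cd; by rewrite (limit_contentE h).
Qed.

Lemma limit_content_semi_additive : measure_function.semi_additive limit_content.
Proof.
move=> F n mF tF mU; apply: limit_contentE.
have mF' k : @measurable _ (R * R)%type (F k).
  by have [a [b [c [d ->]]]] := ocitv_box (mF k); exact: measurable_box.
have -> : (fun m => P m (\big[setU/set0]_(i < n) F i)) = (fun m => \sum_(i < n) P m (F i)).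
  apply/funext => m; apply: measure_semi_additive_ord_I => //.
    exact: sub_trivIset tF.
  by apply: bigsetU_measurable => i _; exact: mF'.
apply: cvg_nnesum => i _; first by apply: nearW => m; exact: measure_ge0.
by have [] := limit_content_cvg (mF i).
Qed.

HB.instance Definition _ := isContent.Build _ T R limit_content
  limit_content_ge0 limit_content_semi_additive.

(** The box is shrunk by [t] at its lower and left sides. Monotonicity bounds [G (a + t) d] by
    [G (a + t) (d + t)], and likewise for the other mixed corner, so right continuity on the
    diagonal limits the loss to [e / 2] each. *)
Lemma limit_content_inner (A : set T) (e : R) : measurable A -> (0 < e)%R ->
  exists (K : set (R * R)) (A' : set T), [/\ compact K, measurable A', A' `<=` K, K `<=` A
    & limit_content A <= limit_content A' + e%:E].
Proof.
move=> /boxP[->|[a [b [c [d [ab cd ->]]]]]] e0.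
  exists set0, set0; split => //; first exact: compact0.
  by rewrite leeDl// lee_fin ltW.
have e20 : (0 < e / 2)%R by rewrite divr_gt0.
have [t [t0 tb td h1 h2]] : exists t, [/\ (0 < t)%R, (a + t <= b)%R, (c + t <= d)%R,
    (G (a + t) (d + t) <= G a d + e / 2)%R & (G (b + t) (c + t) <= G b c + e / 2)%R].
  have h x y : \forall t \near 0^'+, (G (x + t) (y + t) <= G x y + e / 2)%R.
    have /cvgr_le := G_right (x := x) (y := y); apply.
    by rewrite ltrDl.
  apply: (@filter_ex _ (0^'+)%R); near=> t; split.
  - by near: t; exact: nbhs_right_gt.
  - rewrite -lerBrDl; near: t; apply: nbhs_right_le; by rewrite subr_gt0.
  - rewrite -lerBrDl; near: t; apply: nbhs_right_le; by rewrite subr_gt0.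
  - by near: t; exact: h.
  - by near: t; exact: h.
exists (`[(a + t)%R, b] `*` `[(c + t)%R, d])%classic, (box (a + t) b (c + t) d); split.
- by apply: compact_setX; exact: segment_compact.
- exact: box_ocitv.
- move=> [p q] [/=]; rewrite !in_itv/= => /andP[/ltW ? ?] /andP[/ltW ? ?].
  by split; apply/andP.
- move=> [p q] [/=]; rewrite !in_itv/= => /andP[ap pb] /andP[cq qd].
  by split; rewrite /= in_itv/= ?pb ?qd andbT; [apply: lt_le_trans ap|apply: lt_le_trans cq];
    rewrite ltrDl.
- rewrite (limit_contentE (cvg_box (ltW ab) (ltW cd))).
  rewrite (limit_contentE (cvg_box tb td)) -EFinD lee_fin.
  have h3 : (G (a + t) d <= G (a + t) (d + t))%R.
    by apply: limit_cdf_nondecreasing => //; rewrite lerDl ltW.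
  have h4 : (G b (c + t) <= G (b + t) (c + t))%R.
    by apply: limit_cdf_nondecreasing => //; rewrite lerDl ltW.
  have h5 : (G a c <= G (a + t) (c + t))%R.
    by apply: limit_cdf_nondecreasing => //; rewrite lerDl ltW.
  by move: h1 h2 h3 h4 h5; clear; lra.
Unshelve. all: by end_near. Qed.

Lemma limit_content_outer (A : set T) (e : R) : measurable A -> (0 < e)%R ->
  exists (O : set (R * R)) (A' : set T), [/\ open O, measurable A', A `<=` O, O `<=` A'
    & limit_content A' <= limit_content A + e%:E].
Proof.
move=> /boxP[->|[a [b [c [d [ab cd ->]]]]]] e0.
  exists set0, set0; split; [exact: open0|exact: measurable0|by []|by []|].
  by rewrite leeDl// lee_fin ltW.
have [t [t0 h1]] : exists t, (0 < t)%R /\ (G (b + t) (d + t) <= G b d + e)%R.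
  apply: (@filter_ex _ (0^'+)%R); near=> t; split.
    by near: t; exact: nbhs_right_gt.
  near: t; have /cvgr_le := G_right (x := b) (y := d); apply.
  by rewrite ltrDl.
exists (`]a, (b + t)%R[ `*` `]c, (d + t)%R[)%classic, (box a (b + t) c (d + t)); split.
- by apply: open_rectangle; exact: interval_open.
- exact: box_ocitv.
- move=> [p q] [/=]; rewrite !in_itv/= => /andP[ap pb] /andP[cq qd].
  by split; rewrite ?ap ?cq/=; [apply: le_lt_trans pb _|apply: le_lt_trans qd _];
    rewrite ltrDl.
- move=> [p q] [/=]; rewrite !in_itv/= => /andP[ap pb] /andP[cq qd].
  by split; rewrite /= in_itv/= ?ap ?cq ltW.
- have bt : (b <= b + t)%R by rewrite lerDl ltW.
  have dt : (d <= d + t)%R by rewrite lerDl ltW.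
  rewrite (limit_contentE (cvg_box (ltW ab) (ltW cd))).
  rewrite (limit_contentE (cvg_box (le_trans (ltW ab) bt) (le_trans (ltW cd) dt))).
  rewrite -EFinD lee_fin.
  have h3 : (G a d <= G a (d + t))%R by exact: limit_cdf_nondecreasing.
  have h4 : (G b c <= G (b + t) c)%R by exact: limit_cdf_nondecreasing.
  by move: h1 h3 h4; clear; lra.
Unshelve. all: by end_near. Qed.

(** A compact set inside [A] and open sets around the [F i] reduce the countable cover to a finite
    one. Finite subadditivity of [P n] then passes to the limit, the error [e] being shared between
    the inner set and a geometric series. *)
Lemma limit_content_sigma_subadditive : measurable_subset_sigma_subadditive limit_content.
Proof.
move=> A F mF mA AF; apply/lee_addgt0Pr => e e0.
have e20 : (0 < e / 2)%R by rewrite divr_gt0.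
have [K [A' [cK mA' A'K KA LA]]] := limit_content_inner mA e20.
have /choice[U HU] : forall i, exists OA : set (R * R) * set T,
    [/\ open OA.1, measurable OA.2, F i `<=` OA.1, OA.1 `<=` OA.2
    & limit_content OA.2 <= limit_content (F i) + (e / 2 / (2 ^ i.+1)%:R)%:E].
  move=> i; have [|U [B HUB]] := @limit_content_outer (F i) (e / 2 / (2 ^ i.+1)%:R) (mF i).
    by rewrite divr_gt0// ltr0n expn_gt0.
  by exists (U, B).
have [N KN] : exists N, K `<=` \big[setU/set0]_(i < N) (U i).1.
  have /compact_near_coveringP := cK.
  move=> /(_ nat \oo (fun N w => exists2 i, (i < N)%N & (U i).1 w)) H.
  have : \forall N \near \oo, K `<=` (fun w => exists2 i, (i < N)%N & (U i).1 w).
    apply: H => w Kw; have [i _ Fw] := AF w (KA w Kw).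
    have [oO _ FO _ _] := HU i.
    exists ((U i).1, [set N | (i < N)%N]); first split => /=.
    - by apply: open_nbhs_nbhs; split => //; exact: FO.
    - by exists i.+1.
    - by move=> [w' N] /= [Ow' iN]; exists i.
  move=> [N _ /(_ N (leqnn N)) H']; exists N => w /H'[i iN Uw].
  by rewrite -(bigcup_mkord N (fun i => (U i).1)); exists i.
have mT (B : set T) : measurable B -> @measurable _ (R * R)%type B.
  by move=> /ocitv_box[a [b [c [d ->]]]]; exact: measurable_box.
have LA' : limit_content A' <= \sum_(i < N) limit_content (U i).2.
  have [_ cA'] := limit_content_cvg mA'.
  have cS : \sum_(i < N) P n (U i).2 @[n --> \oo] --> \sum_(i < N) limit_content (U i).2.
    apply: cvg_nnesum => i _; first by apply: nearW => n; exact: measure_ge0.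
    by have [_ mU _ _ _] := HU i; have [] := limit_content_cvg mU.
  apply: (lee_cvg_to cA' cS); apply: nearW => n.
  apply: (@content_subadditive _ _ _ (P n) A' (fun i => (U i).2) N).
  - by move=> i _; have [_ mU _ _ _] := HU i; exact: mT.
  - exact: mT.
  - apply: subset_trans A'K _; apply: subset_trans KN _.
    rewrite -(bigcup_mkord N (fun i => (U i).1)) -(bigcup_mkord N (fun i => (U i).2)).
    by apply: subset_bigcup => i _; have [] := HU i.
apply: le_trans LA _; rewrite [in leRHS](splitr e) EFinD addeA leeD2r//.
apply: le_trans LA' _.
have := @epsilon_trick R (fun i => limit_content (F i)) (e / 2)%R xpredT
  (fun i => limit_content_ge0 _) (ltW e20).
apply: le_trans; apply: le_trans (nneseries_lim_ge N _); last first.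
  by move=> i _ _; rewrite adde_ge0 ?limit_content_ge0// lee_fin divr_ge0// ltW.
rewrite big_mkord; apply: lee_sum => i _; by have [] := HU i.
Qed.

HB.instance Definition _ := Content_SigmaSubAdditive_isMeasure.Build _ _ _
  limit_content limit_content_sigma_subadditive.

Let I : measurableType _ := g_sigma_algebraType (@measurable _ T).

Lemma natr_ge (x : R) : exists k : nat, (x <= k%:R)%R.
Proof.
have [N _ /(_ N (leqnn N))] := @near_natr_ge R x 1 ltr01.
by rewrite mulr1 => xN; exists N.+1.
Qed.

(** The extension lives on the sigma-algebra generated by half-open boxes. Open half planes are
    countable unions of boxes, so the product sigma-algebra is contained in it. *)
Lemma measurable_id_rectangle : measurable_fun setT (idfun : I -> (R * R)%type).
Proof.
have mE (E : set I) (a b c d : nat -> R) :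
    E = \bigcup_k box (a k) (b k) (c k) (d k) -> measurable E.
  by move=> ->; apply: bigcup_measurable => k _; apply: sub_sigma_algebra; exact: box_ocitv.
apply/measurable_fun_pairP; split.
- suff : measurable_fun setT (fst : I -> measurableTypeR R) by [].
  apply: (measurability (RGenOInfty.G (R:=R))); first exact: RGenOInfty.measurableE.
  move=> _ [_ [x ->] <-]; rewrite setTI.
  apply: (mE _ (fun=> x) (fun k => k%:R) (fun k => - k%:R) (fun k => k%:R))%R.
  apply/seteqP; split => [[p q] /=|[p q] [k _ [/=]]]; rewrite !in_itv/= ?andbT.
    move=> xp; have [k pk] := natr_ge (`|p| + `|q| + 1)%R; exists k => //.
    have := ler_norm p; have := ler_norm q; have := ler_norm (- q)%R; rewrite normrN.
    have := normr_ge0 p; have := normr_ge0 q => *.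
    by split; rewrite /= in_itv/=; apply/andP; split => //; lra.
  by move=> /andP[].
- suff : measurable_fun setT (snd : I -> measurableTypeR R) by [].
  apply: (measurability (RGenOInfty.G (R:=R))); first exact: RGenOInfty.measurableE.
  move=> _ [_ [x ->] <-]; rewrite setTI.
  apply: (mE _ (fun k => - k%:R) (fun k => k%:R) (fun=> x) (fun k => k%:R))%R.
  apply/seteqP; split => [[p q] /=|[p q] [k _ [/= _]]]; rewrite !in_itv/= ?andbT.
    move=> xp; have [k pk] := natr_ge (`|p| + `|q| + 1)%R; exists k => //.
    have := ler_norm p; have := ler_norm q; have := ler_norm (- p)%R; rewrite normrN.
    have := normr_ge0 p; have := normr_ge0 q => *.
    by split; rewrite /= in_itv/=; apply/andP; split => //; lra.
  by move=> /andP[].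
Qed.

Definition limit_measure : {measure set (R * R)%type -> \bar R} :=
  image_measure (measure_extension limit_content) measurable_id_rectangle.

Lemma limit_measure_box a b c d : (a <= b)%R -> (c <= d)%R ->
  limit_measure (box a b c d) = (G b d - G a d - G b c + G a c)%:E.
Proof.
move=> ab cd; rewrite -(limit_contentE (cvg_box ab cd)).
rewrite /limit_measure image_measureE /= /measure_extension.
by rewrite measurable_mu_extE//; exact: box_ocitv.
Qed.

Hypothesis G_Ny : forall y : R, G (- k%:R)%R y @[k --> \oo] --> (0 : R)%R.
Hypothesis G_yN : forall x : R, G x (- k%:R)%R @[k --> \oo] --> (0 : R)%R.
Hypothesis G_y : G k%:R k%:R @[k --> \oo] --> (1 : R)%R.

Lemma limit_measure_quadrant x y : limit_measure (quadrant x y) = (G x y)%:E.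
Proof.
have E : quadrant x y = \bigcup_k box (- k%:R)%R x (- k%:R)%R y.
  apply/seteqP; split => [[p q] [/=]|[p q] [k _ [/=]]]; rewrite !in_itv/=.
    move=> px qy; have [k pk] := natr_ge (`|p| + `|q| + 1)%R; exists k => //.
    have := ler_norm (- p)%R; have := ler_norm (- q)%R; rewrite !normrN.
    have := normr_ge0 p; have := normr_ge0 q => *.
    by split; rewrite /= in_itv/=; apply/andP; split => //; lra.
  by move=> /andP[_ ?] /andP[_ ?]; split; rewrite /= in_itv.
(* The corner term that inclusion-exclusion adds back is dominated by [G (- k) 0]. *)
have G_NN : G (- k%:R)%R (- k%:R)%R @[k --> \oo] --> (0 : R)%R.
  have G0 x' y' : (0 <= G x' y')%R.
    rewrite -lee_fin; apply: (lee_cvg_to (@cvg_cst _ (0 : \bar R) _ \oo _) (@PG x' y')).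
    exact: nearW.
  apply: (squeeze_cvgr _ (cvg_cst _) (@G_Ny 0)); apply: nearW => k.
  by rewrite G0/=; apply: limit_cdf_nondecreasing; rewrite ?oppr_le0.
have c1 : limit_measure (box (- k%:R)%R x (- k%:R)%R y) @[k --> \oo] -->
    limit_measure (quadrant x y).
  rewrite E; apply: nondecreasing_cvg_mu.
  - by move=> k; exact: measurable_box.
  - by rewrite -E; exact: measurable_quadrant.
  - move=> k l kl; apply/subsetPset => -[p q] [/=]; rewrite !in_itv/=.
    have kl' : (- l%:R <= - k%:R :> R)%R by rewrite lerN2 ler_nat.
    move=> /andP[? ?] /andP[? ?]; split; rewrite /= in_itv/=; apply/andP; split => //;
      exact: le_lt_trans kl' _.
have c2 : limit_measure (box (- k%:R)%R x (- k%:R)%R y) @[k --> \oo] --> (G x y)%:E.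
  have c3 : (G x y - G (- k%:R) y - G x (- k%:R) + G (- k%:R) (- k%:R))%:E
      @[k --> \oo] --> (G x y)%:E.
    apply: cvg_EFin; first exact: nearW.
    rewrite -[X in _ --> X]addr0 -[X in _ --> (X + _)%R]subr0 -[X in _ --> (X - _ + _)%R]subr0.
    apply: cvgD => //; apply: cvgB => //; apply: cvgB => //; exact: cvg_cst.
  apply: cvg_trans c3; apply: near_eq_cvg; near=> k.
  have h (z : R) : (- z <= k%:R)%R -> (- k%:R <= z)%R by rewrite lerNl.
  rewrite limit_measure_box//; apply: h; near: k; exact: nbhs_infty_ger.
exact: cvg_unique c1 c2.
Unshelve. all: by end_near. Qed.

Lemma limit_measure_setT : limit_measure setT = 1.
Proof.
have E : [set: (R * R)%type] = \bigcup_k quadrant k%:R k%:R.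
  apply/seteqP; split => // -[p q] _; have [k pk] := natr_ge (`|p| + `|q|)%R; exists k => //.
  have := ler_norm p; have := ler_norm q; have := normr_ge0 p; have := normr_ge0 q => *.
  by split; rewrite /= in_itv/=; lra.
have c1 : limit_measure (quadrant k%:R k%:R) @[k --> \oo] --> limit_measure setT.
  rewrite E; apply: nondecreasing_cvg_mu.
  - by move=> k; exact: measurable_quadrant.
  - by rewrite -E.
  - move=> k l kl; apply/subsetPset => -[p q] [/=]; rewrite !in_itv/=.
    have kl' : (k%:R <= l%:R :> R)%R by rewrite ler_nat.
    by move=> ? ?; split; rewrite /= in_itv/=; exact: le_trans kl'.
have c2 : limit_measure (quadrant k%:R k%:R) @[k --> \oo] --> 1.
  have -> : (fun k : nat => limit_measure (quadrant k%:R k%:R)) = (fun k => (G k%:R k%:R)%:E).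
    by apply/funext => k; exact: limit_measure_quadrant.
  by apply: cvg_EFin; first exact: nearW.
exact: cvg_unique c1 c2.
Qed.

Let limit_law : set (R * R)%type -> \bar R := limit_measure.

HB.instance Definition _ := isMeasure.Build _ _ _ limit_law
  (measure0 limit_measure) (measure_ge0 limit_measure)
  (@measure_semi_sigma_additive _ _ _ limit_measure).

HB.instance Definition _ := Measure_isProbability.Build _ _ _ limit_law limit_measure_setT.

Lemma limit_probability : exists nu : probability (R * R)%type R,
  forall x y, nu (quadrant x y) = (G x y)%:E.
Proof.
by exists limit_law; exact: limit_measure_quadrant.
Qed.

End limit_content.

(** * Convergence of distribution functions implies weak convergence *)

Section bounded_integral.
Context d (T : measurableType d) {R : realType}.
Implicit Types (m : probability T R) (f g : T -> R).

Definition bounded_measurable f :=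
  measurable_fun setT f /\ exists B, forall w, `|f w| <= B.

Lemma bounded_measurable_integrable m f : bounded_measurable f ->
  m.-integrable setT (EFin \o f).
Proof.
move=> [mf [B fB]]; apply: (@le_integrable _ _ _ m setT measurableT _ (cst B%:E)).
- exact/measurable_EFinP.
- move=> w _; rewrite /= lee_fin (le_trans (fB w))//; exact: ler_norm.
- by apply: finite_measure_integrable_cst.
Qed.

Definition mean m f := fine (\int[m]_w (f w)%:E)%E.

Lemma meanE m f : bounded_measurable f -> (\int[m]_w (f w)%:E = (mean m f)%:E)%E.
Proof.
by move=> bf; rewrite fineK//; apply: integrable_fin_num => //; exact: bounded_measurable_integrable.
Qed.

Lemma bounded_measurableD f g : bounded_measurable f -> bounded_measurable g ->
  bounded_measurable (f \+ g).
Proof.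
move=> [mf [B fB]] [mg [C gC]]; split; first exact: measurable_funD.
by exists (B + C) => w; rewrite (le_trans (ler_normD _ _))// lerD.
Qed.

Lemma bounded_measurableZ c f : bounded_measurable f ->
  bounded_measurable (fun w => c * f w).
Proof.
move=> [mf [B fB]]; split; first exact: measurable_funM.
by exists (`|c| * B) => w; rewrite normrM ler_wpM2l.
Qed.

Lemma bounded_measurable_indic (A : set T) : measurable A ->
  bounded_measurable (\1_A : T -> R).
Proof.
move=> mA; split; first exact: measurable_indic.
by exists 1 => w; rewrite indicE; case: (_ \in _); rewrite ?normr1 ?normr0.
Qed.

Lemma meanD m f g : bounded_measurable f -> bounded_measurable g ->
  mean m (f \+ g) = mean m f + mean m g.
Proof.
move=> bf bg; apply: EFin_inj; rewrite EFinD -!meanE//; last exact: bounded_measurableD.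
by rewrite -integralD//; exact: bounded_measurable_integrable.
Qed.

Lemma meanZ m c f : bounded_measurable f -> mean m (fun w => c * f w) = c * mean m f.
Proof.
move=> bf; apply: EFin_inj; rewrite EFinM -!meanE//; last exact: bounded_measurableZ.
by rewrite -integralZl//; exact: bounded_measurable_integrable.
Qed.

Lemma mean_indic m (A : set T) : measurable A -> mean m (\1_A) = fine (m A).
Proof. by move=> mA; rewrite /mean integral_indic// setIT. Qed.

Lemma le_mean m f g : bounded_measurable f -> bounded_measurable g ->
  (forall w, f w <= g w) -> mean m f <= mean m g.
Proof.
move=> bf bg fg; rewrite -lee_fin -!meanE//.
by apply: le_integral => //; [exact: bounded_measurable_integrable|
  exact: bounded_measurable_integrable|move=> w _; rewrite lee_fin].
Qed.

Lemma mean_cst m c : mean m (cst c) = c.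
Proof.
rewrite /mean; transitivity (fine (\int[m]_w (cst c%:E w))%E); first by [].
by rewrite integral_cst//= probability_setT mule1.
Qed.

Lemma bounded_measurable_cst c : bounded_measurable (cst c : T -> R).
Proof. by split => //; exists `|c|. Qed.

Lemma mean_dist m f g c B (Q : set T) : measurable Q -> 0 <= c -> 0 <= B ->
  bounded_measurable f -> bounded_measurable g ->
  (forall w, Q w -> `|f w - g w| <= c) -> (forall w, ~ Q w -> `|f w - g w| <= B) ->
  `|mean m f - mean m g| <= c + B * (1 - fine (m Q)).
Proof.
move=> mQ c0 B0 bf bg fgc fgB.
pose h := cst c \+ (fun w => B * (cst 1 \+ (fun w => (-1) * \1_Q w)) w) : T -> R.
have bQ := bounded_measurable_indic mQ.
have bh1 : bounded_measurable (cst 1 \+ (fun w => (-1) * \1_Q w)).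
  by apply: bounded_measurableD; [exact: bounded_measurable_cst|exact: bounded_measurableZ].
have bh : bounded_measurable h.
  by apply: bounded_measurableD; [exact: bounded_measurable_cst|exact: bounded_measurableZ].
have hE : mean m h = c + B * (1 - fine (m Q)).
  rewrite meanD; [|exact: bounded_measurable_cst|exact: bounded_measurableZ].
  rewrite meanZ// meanD; [|exact: bounded_measurable_cst|exact: bounded_measurableZ].
  by rewrite !mean_cst meanZ// mean_indic// mulN1r.
have fgh w : `|f w - g w| <= h w.
  rewrite /h /= indicE; have [Qw|Qw] := pselect (Q w).
    by rewrite mem_set//= mulN1r subrr mulr0 addr0; exact: fgc.
  rewrite memNset//= mulr0 addr0 mulr1; apply: le_trans (fgB _ Qw) _.
  by rewrite lerDr.
rewrite -hE ler_norml; apply/andP; split.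
  rewrite lerNl opprB lerBlDr -meanD//.
  apply: le_mean => //; first exact: bounded_measurableD.
  by move=> w /=; have := fgh w; rewrite ler_norml => /andP[]; lra.
rewrite lerBlDr -meanD//; apply: le_mean => //; first exact: bounded_measurableD.
by move=> w /=; have := fgh w; rewrite ler_norml => /andP[]; lra.
Qed.

End bounded_integral.

Section grid.
Context {R : realType}.
Implicit Types (f : R * R -> R) (m : probability (R * R)%type R).

Lemma grid_locate (p : nat -> R) (L : nat) (x : R) : p 0%N < x <= p L ->
  exists2 i, (i < L)%N & p i < x <= p i.+1.
Proof.
elim: L => [|L IH] /andP[x0 xL]; first by have := lt_le_trans x0 xL; rewrite ltxx.
have [xL'|xL'] := leP x (p L).
  by have [|i iL ix] := IH; [rewrite x0|exists i => //; exact: ltnW].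
by exists L => //; rewrite xL'.
Qed.

(** Mesh [1 / (M+1)] starting at [- K], so that [2 K (M+1)] steps reach [K]. *)
Definition grid_point (K M i : nat) : R := i%:R / M.+1%:R - K%:R.

Definition grid_cell (K M i j : nat) : set (R * R) :=
  box (grid_point K M i) (grid_point K M i.+1) (grid_point K M j) (grid_point K M j.+1).

Definition grid_fun f (K M : nat) (w : R * R) : R :=
  \sum_(i < (2 * K) * M.+1) \sum_(j < (2 * K) * M.+1)
    f (grid_point K M i, grid_point K M j) * \1_(grid_cell K M i j) w.

Lemma le_grid_point K M i j : (i <= j)%N -> grid_point K M i <= grid_point K M j.
Proof. by move=> ij; rewrite lerD2r ler_pM2r ?invr_gt0 ?ltr0n// ler_nat. Qed.

Lemma grid_point0 K M : grid_point K M 0 = - K%:R.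
Proof. by rewrite /grid_point mul0r sub0r. Qed.

Lemma grid_pointS K M i : grid_point K M i.+1 = grid_point K M i + M.+1%:R^-1.
Proof. by rewrite /grid_point -natr1 mulrDl mul1r addrAC. Qed.

Lemma grid_point_last K M : grid_point K M ((2 * K) * M.+1) = K%:R.
Proof. by rewrite /grid_point natrM mulfK ?pnatr_eq0// natrM; ring. Qed.

Lemma grid_cell_uniq K M i j i' j' w :
  grid_cell K M i j w -> grid_cell K M i' j' w -> i = i' /\ j = j'.
Proof.
have H (x : R) k l : grid_point K M k < x <= grid_point K M k.+1 ->
    grid_point K M l < x <= grid_point K M l.+1 -> (k <= l)%N.
  move=> /andP[kx _] /andP[_ xl]; rewrite leqNgt; apply/negP => lk.
  by have := lt_le_trans kx (le_trans xl (le_grid_point K M lk)); rewrite ltxx.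
move=> [/=]; rewrite !in_itv/= => h1 h2 [/=]; rewrite !in_itv/= => h3 h4.
by split; apply/eqP; rewrite eqn_leq; apply/andP; split; apply: H; eassumption.
Qed.

Lemma grid_fun_in f K M (w : R * R) : box (- K%:R) K%:R (- K%:R) K%:R w ->
  exists u : R * R, [/\ grid_fun f K M w = f u, u.1 < w.1 <= u.1 + M.+1%:R^-1 &
    u.2 < w.2 <= u.2 + M.+1%:R^-1].
Proof.
move=> [/=]; rewrite !in_itv/= -{1 2}(grid_point0 K M) -{1 2}(grid_point_last K M).
move=> /grid_locate[i iL iw] /grid_locate[j jL jw].
have ijw : grid_cell K M i j w by split; rewrite /= in_itv.
exists (grid_point K M i, grid_point K M j); split; [|by rewrite -grid_pointS|by rewrite -grid_pointS].
rewrite /grid_fun (bigD1 (Ordinal iL))//= (bigD1 (Ordinal jL))//=.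
rewrite indicE mem_set// mulr1 big1 ?addr0; last first.
  move=> j' jj'; rewrite indicE memNset ?mulr0// => h.
  by have [_ e] := grid_cell_uniq h ijw; case/eqP: jj'; apply: val_inj.
rewrite big1 ?addr0// => i' ii'; rewrite big1// => j' _.
rewrite indicE memNset ?mulr0// => h.
by have [e _] := grid_cell_uniq h ijw; case/eqP: ii'; apply: val_inj.
Qed.

Lemma grid_fun_out f K M (w : R * R) : ~ box (- K%:R) K%:R (- K%:R) K%:R w ->
  grid_fun f K M w = 0.
Proof.
move=> nw; rewrite /grid_fun big1// => i _; rewrite big1// => j _.
rewrite indicE memNset ?mulr0// => -[/=]; rewrite !in_itv/= => /andP[h1 h2] /andP[h3 h4].
have l k : - K%:R <= grid_point K M k by rewrite -(grid_point0 K M); exact: le_grid_point.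
have u (k : 'I_((2 * K) * M.+1)) : grid_point K M k.+1 <= K%:R.
  by rewrite -[leRHS](grid_point_last K M); exact: le_grid_point.
by apply: nw; split; rewrite /= in_itv/=; apply/andP; split;
  [exact: le_lt_trans h1|exact: le_trans (u i)|exact: le_lt_trans h3|exact: le_trans (u j)].
Qed.

Lemma bounded_measurable_sum (I : Type) (r : seq I) (h : I -> R * R -> R) :
  (forall i, bounded_measurable (h i)) ->
  bounded_measurable (fun w => \sum_(i <- r) h i w).
Proof.
move=> bh; elim: r => [|i r IH].
  by under eq_fun do rewrite big_nil; exact: bounded_measurable_cst.
by under eq_fun do rewrite big_cons; exact: bounded_measurableD.
Qed.

Lemma mean_sum m (I : Type) (r : seq I) (h : I -> R * R -> R) :
  (forall i, bounded_measurable (h i)) ->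
  mean m (fun w => \sum_(i <- r) h i w) = \sum_(i <- r) mean m (h i).
Proof.
move=> bh; elim: r => [|i r IH].
  rewrite big_nil; under eq_fun do rewrite big_nil.
  exact: (mean_cst m 0).
rewrite big_cons -IH -meanD//; last exact: bounded_measurable_sum.
by congr mean; apply/funext => w; rewrite big_cons.
Qed.

Lemma measurable_grid_cell K M i j : measurable (grid_cell K M i j).
Proof. exact: measurable_box. Qed.

Lemma bounded_measurable_grid_term f K M i j : bounded_measurable
  (fun w => f (grid_point K M i, grid_point K M j) * \1_(grid_cell K M i j) w).
Proof.
apply: bounded_measurableZ; apply: bounded_measurable_indic.
exact: measurable_grid_cell.
Qed.

Lemma bounded_measurable_grid f K M : bounded_measurable (grid_fun f K M).
Proof.
apply: bounded_measurable_sum => i; apply: bounded_measurable_sum => j.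
exact: bounded_measurable_grid_term.
Qed.

Lemma mean_grid m f K M : mean m (grid_fun f K M) =
  \sum_(i < (2 * K) * M.+1) \sum_(j < (2 * K) * M.+1)
    f (grid_point K M i, grid_point K M j) * fine (m (grid_cell K M i j)).
Proof.
rewrite /grid_fun mean_sum; last first.
  by move=> i; apply: bounded_measurable_sum => j; exact: bounded_measurable_grid_term.
apply: eq_bigr => i _; rewrite mean_sum; last first.
  by move=> j; exact: bounded_measurable_grid_term.
apply: eq_bigr => j _; rewrite meanZ ?mean_indic//; first exact: measurable_grid_cell.
by apply: bounded_measurable_indic; exact: measurable_grid_cell.
Qed.

(** Grid step functions on growing squares with shrinking mesh converge pointwise to [f], and they
    are measurable for the product sigma-algebra. *)
Lemma continuous_measurable_plane f : continuous f -> measurable_fun setT f.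
Proof.
move=> cf.
apply: (@measurable_fun_cvg _ _ _ _ (fun M => grid_fun f M.+1 M)).
  by move=> M; have [] := bounded_measurable_grid f M.+1 M.
move=> w _; apply/cvgrPdist_lt => e e0.
have /cvgrPdist_lt/(_ e e0) := cf w; rewrite -nbhs_ballE => -[r /= r0 rw].
near=> M.
have [|u [-> u1 u2]] := @grid_fun_in f M.+1 M w.
  have h1 : `|w.1| + 1 <= M.+1%:R * 1 by near: M; exact: near_natr_ge.
  have h2 : `|w.2| + 1 <= M.+1%:R * 1 by near: M; exact: near_natr_ge.
  rewrite mulr1 in h1 h2.
  have := ler_norm w.1; have := ler_norm w.2.
  have := ler_norm (- w.1); have := ler_norm (- w.2); rewrite !normrN => *.
  by split; rewrite /= in_itv/=; apply/andP; split; lra.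
have hr : M.+1%:R^-1 < r.
  have : 2 <= M.+1%:R * r by near: M; exact: near_natr_ge.
  by rewrite -ler_pdivrMl ?ltr0n// => /(lt_le_trans _); apply; rewrite ltr_pMr ?invr_gt0 ?ltr0n// ltr1n.
apply: rw; split; rewrite /ball/= ltr_norml.
  by move: u1 hr; clear => /andP[]; move: (_^-1) => *; apply/andP; split; lra.
by move: u2 hr; clear => /andP[]; move: (_^-1) => *; apply/andP; split; lra.
Unshelve. all: by end_near. Qed.

Lemma uniform_continuity f (K : R) (e : R) : continuous f -> 0 < e ->
  exists2 del, 0 < del & forall w u : R * R, `|w.1| <= K -> `|w.2| <= K ->
    `|w.1 - u.1| < del -> `|w.2 - u.2| < del -> `|f w - f u| <= e.
Proof.
move=> cf e0.
pose S : set (R * R) := `[- K, K] `*` `[- K, K].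
have /compact_near_coveringP cS : compact S by apply: compact_setX; exact: segment_compact.
pose Q del (w : R * R) := forall u : R * R, `|w.1 - u.1| < del -> `|w.2 - u.2| < del ->
  `|f w - f u| <= e.
have : \forall del \near (0:R)^'+, S `<=` Q del.
  apply: cS => z _; have e20 : 0 < e / 2 by rewrite divr_gt0.
  have /cvgrPdist_lt/(_ _ e20) := cf z; rewrite -nbhs_ballE => -[r /= r0 rz].
  have r20 : 0 < r / 2 by rewrite divr_gt0.
  exists (ball z (r / 2), [set del : R | del < r / 2]); first split => /=.
  - exact: nbhsx_ballx.
  - exact: nbhs_right_lt.
  - move=> [w del] /= [[zw1 zw2] dr] u wu1 wu2.
    have h1 : `|f z - f w| < e / 2.
      by apply: rz; split; [apply: le_ball zw1|apply: le_ball zw2]; lra.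
    have h2 : `|f z - f u| < e / 2.
      apply: rz; split; rewrite /ball/=.
        have := ler_distD w.1 z.1 u.1; move: zw1; rewrite /ball/=; lra.
      have := ler_distD w.2 z.2 u.2; move: zw2; rewrite /ball/=; lra.
    have := ler_distD (f z) (f w) (f u); rewrite (distrC (f w) (f z)); lra.
move=> H; have [del [del0 dS]] : exists del : R, 0 < del /\ S `<=` Q del.
  apply: (@filter_ex _ ((0:R)^'+)); near=> del; split; last by near: del.
  by near: del; exact: nbhs_right_gt.
exists del => // w u w1 w2; apply: dS.
by split; rewrite /= in_itv/= -ler_norml.
Unshelve. all: by end_near. Qed.

End grid.

Lemma cvg_sumr (R : realType) (I : Type) (r : seq I) (u : I -> nat -> R) (l : I -> R) :
  (forall i, u i n @[n --> \oo] --> l i) ->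
  \sum_(i <- r) u i n @[n --> \oo] --> \sum_(i <- r) l i.
Proof.
move=> ul; elim: r => [|i r IH].
  by under eq_fun do rewrite big_nil; rewrite big_nil; exact: cvg_cst.
by under eq_fun do rewrite big_cons; rewrite big_cons; exact: cvgD.
Qed.

(** [f] is replaced by a step function on a fine grid over a square carrying almost all of [nu]. Its
    mean is a finite combination of box probabilities, which converge; convergence on the square
    itself also bounds the mass that [P n] puts outside, so tightness is not assumed. *)
Lemma weak_cvg_quadrant (R : realType) (P : nat -> probability (R * R)%type R)
    (nu : probability (R * R)%type R) :
  (forall x y, P n (quadrant x y) @[n --> \oo] --> nu (quadrant x y)) ->
  weak_cvg P nu.
Proof.
move=> Pnu f cf [B fB].
have B0 : 0 <= B := le_trans (normr_ge0 (f (0, 0))) (fB (0, 0)).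
have bf : bounded_measurable f.
  by split; [exact: continuous_measurable_plane|exists B].
pose G x y := fine (nu (quadrant x y)).
have PG x y : P n (quadrant x y) @[n --> \oo] --> (G x y)%:E.
  rewrite fineK//; apply: fin_num_measure; exact: measurable_quadrant.
have cbox a b c d : a <= b -> c <= d ->
    fine (P n (box a b c d)) @[n --> \oo] --> fine (nu (box a b c d)).
  move=> ab cd; have := cvg_box PG ab cd.
  rewrite -probability_box// -[X in _ --> X]fineK.
    by move=> /fine_cvg.
  by apply: fin_num_measure; exact: measurable_box.
have cgrid K M : mean (P n) (grid_fun f K M) @[n --> \oo] --> mean nu (grid_fun f K M).
  under eq_fun do rewrite mean_grid; rewrite mean_grid.
  apply: cvg_sumr => i; apply: cvg_sumr => j; apply: cvgM; first exact: cvg_cst.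
  by apply: cbox; exact: le_grid_point.
pose Q (K : nat) : set (R * R) := box (- K%:R) K%:R (- K%:R) K%:R.
have mQ K : measurable (Q K) by exact: measurable_box.
have nuQ : fine (nu (Q K)) @[K --> \oo] --> (1 : R).
  have E : [set: (R * R)%type] = \bigcup_K Q K.
    apply/seteqP; split => // -[p q] _; have [k pk] := @natr_ge R (`|p| + `|q| + 1); exists k => //.
    have := ler_norm (- p); have := ler_norm (- q); rewrite !normrN.
    have := ler_norm p; have := ler_norm q; have := normr_ge0 p; have := normr_ge0 q => *.
    by split; rewrite /= in_itv/=; apply/andP; split; lra.
  have : nu (Q K) @[K --> \oo] --> nu setT.
    rewrite E; apply: nondecreasing_cvg_mu => //.
    - by rewrite -E.
    - move=> k l kl; apply/subsetPset => -[p q] [/=]; rewrite !in_itv/=.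
      have kl' : k%:R <= l%:R :> R by rewrite ler_nat.
      have kl'' : - l%:R <= - k%:R :> R by rewrite lerN2.
      move=> /andP[h1 h2] /andP[h3 h4]; split; rewrite /= in_itv/=; apply/andP; split.
      + exact: le_lt_trans h1.
      + exact: le_trans kl'.
      + exact: le_lt_trans h3.
      + exact: le_trans kl'.
  by rewrite probability_setT => /fine_cvg.
rewrite meanE//; under eq_fun do rewrite meanE//.
apply: cvg_EFin; first exact: nearW.
apply/cvgrPdist_le => e e0.
have B1 : 0 < B + 1 by rewrite ltr_wpDl.
(* Five errors arise: discretization under [nu] and [P n] and convergence of the step means cost
   [e / 8] each, the mass outside the square [e / 8] under [nu] and [e / 4] under [P n]. *)
pose e' := e / 8 / (B + 1).
have e'0 : 0 < e' by rewrite !divr_gt0.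
have e'B : B * e' <= e / 8.
  rewrite /e' mulrA ler_pdivrMr// mulrC ler_wpM2l//; last by rewrite lerDl.
  by rewrite divr_ge0 ?ltW.
have [K KP] : exists K, 1 - fine (nu (Q K)) <= e'.
  have /cvgrPdist_le/(_ _ e'0)[K _ /(_ K (leqnn K)) /=] := nuQ.
  by move=> /ler_normlP[_ h]; exists K.
have e80 : 0 < e / 8 by rewrite divr_gt0.
have [del del0 unif] := @uniform_continuity R f K%:R (e / 8) cf e80.
have [M hM] : exists M : nat, M.+1%:R^-1 < del.
  have [M _ /(_ M (leqnn M))/=] := @near_natr_ge R 2 del del0.
  rewrite -ler_pdivrMl ?ltr0n// => /(lt_le_trans _) h; exists M; apply: h.
  by rewrite ltr_pMr ?invr_gt0 ?ltr0n// ltr1n.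
have close m : `|mean m f - mean m (grid_fun f K M)| <= e / 8 + B * (1 - fine (m (Q K))).
  apply: mean_dist => //; [exact: ltW|exact: bounded_measurable_grid| |].
    move=> w Qw; have [u [-> u1 u2]] := grid_fun_in f M Qw.
    move: Qw => [/=]; rewrite !in_itv/= => /andP[h1 h2] /andP[h3 h4].
    apply: unif.
    - by rewrite ler_norml h2 ltW.
    - by rewrite ler_norml h4 ltW.
    - rewrite ltr_norml; move: u1 hM; clear => /andP[]; move: (_^-1) => *.
      by apply/andP; split; lra.
    - rewrite ltr_norml; move: u2 hM; clear => /andP[]; move: (_^-1) => *.
      by apply/andP; split; lra.
  by move=> w nQw; rewrite grid_fun_out// subr0.
have /cvgrPdist_le/(_ _ e80) H1 := cgrid K M.
have K0 : - K%:R <= K%:R :> R by rewrite (@le_trans _ _ 0)// oppr_le0.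
have /cvgrPdist_le/(_ _ e'0) H2 := cbox _ _ _ _ K0 K0.
near=> n.
have h1 : `|mean nu (grid_fun f K M) - mean (P n) (grid_fun f K M)| <= e / 8 by near: n.
have h2 : `|fine (nu (Q K)) - fine (P n (Q K))| <= e' by near: n.
have c1 := close nu; have c2 := close (P n).
have b1 : B * (1 - fine (nu (Q K))) <= e / 8.
  by apply: le_trans e'B; rewrite ler_wpM2l.
have b2 : B * (1 - fine (P n (Q K))) <= e / 4.
  have : 1 - fine (P n (Q K)) <= e' + e'.
    by move/ler_normlP: h2 => [_ h2]; move: h2 KP; clear; lra.
  move=> /(ler_wpM2l B0)/le_trans; apply; rewrite mulrDr.
  by move: e'B; clear; lra.
move: e0 h1 c1 c2 b1 b2; clear; rewrite /= !ler_norml => ? /andP[? ?] /andP[? ?] /andP[? ?] ? ?.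
by apply/andP; split; lra.
Unshelve. all: by end_near. Qed.

(** * The row probabilities and the limit law *)

Section row.
Context d (T : measurableType d) (R : realType) (P : probability T R).
Variables (X : {mfun T >-> (R * R)%type}) (s1 s2 s12 b n : R).
Hypothesis X_gauss : gaussian_vector P X.
Hypotheses (X_mean1 : ('E_P[fst \o X] = 0)%E) (X_mean2 : ('E_P[snd \o X] = 0)%E).
Hypotheses (X_var1 : ('V_P[fst \o X] = (s1 ^+ 2)%:E)%E)
  (X_var2 : ('V_P[snd \o X] = (s2 ^+ 2)%:E)%E).
Hypothesis X_cov : covariance P (fst \o X) (snd \o X) = s12%:E.
Hypotheses (s1_gt0 : 0 < s1) (s2_gt0 : 0 < s2) (b_gt0 : 0 < b).
Hypothesis b_def : b = n * normal_pdf 0 1 b.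

Let rho := corr s1 s2 s12.
Let z : (ennreal R * (R * R))%type :=
  (ennreal_of (sqrtr_ge0 (b ^+ 2 * (1 - rho) / 2)),
   (b ^+ 2 * (1 - s1^-1), b ^+ 2 * (1 - s2^-1))).

Let rho1 : -1 <= rho <= 1.
Proof. exact: (corr_le1 X_gauss). Qed.

Let lam2 : Num.sqrt (b ^+ 2 * (1 - rho) / 2) ^+ 2 = b ^+ 2 * (1 - rho) / 2.
Proof.
rewrite sqr_sqrtr// divr_ge0// mulr_ge0 ?sqr_ge0//.
by have /andP[_] := rho1; rewrite subr_ge0.
Qed.

Lemma row_admissible : admissible (b ^- 2) z.
Proof.
move=> r [<-]; rewrite lam2 -mulrA mulrA mulVf ?mul1r ?expf_neq0 ?gt_eqF//.
by have /andP[] := rho1; lra.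
Qed.

Definition standardized (w : T) : R * R := ((X w).1 / s1, (X w).2 / s2).

Let measurable_standardized : measurable_fun setT standardized.
Proof.
by apply/measurable_fun_pairP; split; apply: measurable_funM => //;
  apply: measurableT_comp => //; exact: measurable_funPT.
Qed.

HB.instance Definition _ := isMeasurableFun.Build _ _ _ _ standardized measurable_standardized.

Let threshold (s x : R) : 0 < s ->
  s * (b + (x - b ^+ 2 * (1 - s^-1) - b ^- 2 * x * (b ^+ 2 * (1 - s^-1))) / b) = b + x / b.
Proof. by move=> s0; field; rewrite !gt_eqF. Qed.

Lemma row_exceedance x y :
  n * (1 - fine (P (X @^-1` quadrant (b + x / b) (b + y / b)))) =
  perturbed_exponent (b ^- 2) x y z.
Proof.
have mX : measurable (X @^-1` quadrant (b + x / b) (b + y / b)).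
  by rewrite -[X in measurable X]setTI; apply: measurable_funPT => //; exact: measurable_quadrant.
have := @normal_exceedance_hr R (distribution P standardized) b n z.1
  (Num.sqrt (b ^+ 2 * (1 - rho) / 2))
  (x - z.2.1 - b ^- 2 * x * z.2.1) (y - z.2.2 - b ^- 2 * y * z.2.2) erefl b_gt0 b_def.
have -> : 1 - 2 * Num.sqrt (b ^+ 2 * (1 - rho) / 2) ^+ 2 / b ^+ 2 = rho.
  by rewrite lam2; field; rewrite gt_eqF.
move=> /(_ rho1) H; rewrite /perturbed_exponent -H; last first.
  move=> u v t; exact: (standardized_pair_cdf X_gauss).
rewrite [X in (1 - X)%E](_ : _ = P (X @^-1` quadrant (b + x / b) (b + y / b))); last first.
  congr (P _); apply/seteqP; split => w; rewrite /quadrant /standardized /= !in_itv/=;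
    by rewrite !ler_pdivrMr// ![_ * s1]mulrC ![_ * s2]mulrC !threshold.
by rewrite -(fineK (fin_num_measure P _ mX)).
Qed.

End row.

(** Each factor lies between [exp (- p (1 + 2 p))] and [exp (- p)]. Bounding the inner [p] by the
    row maximum, which tends to 0, makes the correction uniform over the row. *)
Lemma prod_onem_cvg (R : realType) (p : forall n, 'I_n.+1 -> R) (v : R) :
  (forall n i, 0 <= p n i) -> (forall e : R, 0 < e -> \forall n \near \oo, forall i, p n i <= e) ->
  \sum_(i < n.+1) p n i @[n --> \oo] --> v ->
  \prod_(i < n.+1) (1 - p n i) @[n --> \oo] --> expR (- v).
Proof.
move=> p0 psmall psum.
pose c n := \big[Num.max/0]_(i < n.+1) p n i.
have c0 n : 0 <= c n by exact: bigmax_ge_id.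
have pc n i : p n i <= c n by exact: le_bigmax.
have ccvg : c n @[n --> \oo] --> (0 : R).
  apply/cvgrPdist_le => e e0; apply: filterS (psmall e e0) => n pe.
  by rewrite sub0r normrN ger0_norm//; apply/bigmax_leP; split; [exact: ltW|].
have ch : \forall n \near \oo, c n <= 1 / 2.
  by have /cvgr_le := ccvg; apply; rewrite divr_gt0.
have lo : expR (- ((1 + 2 * c n) * \sum_(i < n.+1) p n i)) @[n --> \oo] --> expR (- v).
  apply: continuous_cvg; first exact: continuous_expR.
  apply: cvgN; rewrite -[X in _ --> X]mul1r; apply: cvgM => //.
  rewrite -[X in _ --> X]addr0; apply: cvgD; first exact: cvg_cst.
  by rewrite -(mulr0 (2 : R)); apply: cvgM => //; exact: cvg_cst.
have hi : expR (- (\sum_(i < n.+1) p n i)) @[n --> \oo] --> expR (- v).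
  by apply: continuous_cvg; [exact: continuous_expR|exact: cvgN].
apply: (squeeze_cvgr _ lo hi); near=> n.
have cn : c n <= 1 / 2 by near: n.
rewrite mulr_sumr -!sumrN !expR_sum; apply/andP; split.
  apply: ler_prod => i _; rewrite expR_ge0/=.
  (* 1 - p >= exp (- p (1 + 2 p)) for 0 <= p <= 1/2 *)
  apply: (@le_trans _ _ (expR (- (p n i * (1 + 2 * p n i))))).
    rewrite ler_expR lerN2 mulrC ler_wpM2r// lerD2l ler_pM2l//.
  have p1 : 0 < 1 - p n i by have := pc n i; lra.
  rewrite expRN -[leRHS]invrK lef_pV2 ?posrE ?invr_gt0 ?expR_gt0//.
  apply: le_trans (expR_ge1Dx _); rewrite -div1r ler_pdivrMr// -subr_ge0.
  rewrite (_ : _ - 1 = p n i ^+ 2 * (1 - 2 * p n i)); last by ring.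
  by rewrite mulr_ge0 ?sqr_ge0//; have := pc n i; lra.
apply: ler_prod => i _; have := pc n i => pi; rewrite subr_ge0 (le_trans pi)/=; last by lra.
exact: expR_ge1Dx.
Unshelve. all: by end_near. Qed.

(** * Growth of the normalizing constants *)

Section normal_scaling.
Context {R : realType} (b : nat -> R).
Hypothesis b_def : forall n, b n = n.+1%:R * normal_pdf 0 1 (b n).

Let pdf_gt0 (x : R) : 0 < normal_pdf 0 1 x.
Proof.
by rewrite normal_pdfE ?oner_neq0// mulr_gt0 ?normal_peak_gt0 ?oner_neq0// /normal_fun expR_gt0.
Qed.

Lemma scaling_gt0 n : 0 < b n.
Proof. by rewrite b_def mulr_gt0 ?ltr0n. Qed.

(** If [b n < M], monotonicity of the density on the positive axis gives [b n >= (n+1) phi(M)],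
    which exceeds [M] once n is large. *)
Lemma scaling_ge M : \forall n \near \oo, M <= b n.
Proof.
near=> n; rewrite leNgt; apply/negP => bM.
have M0 : 0 < M := lt_trans (scaling_gt0 n) bM.
have : M <= n.+1%:R * normal_pdf 0 1 M.
  by near: n; apply: near_natr_ge; exact: pdf_gt0.
apply/negP; rewrite -ltNge; apply: le_lt_trans (bM).
rewrite [leRHS]b_def ler_wpM2l// !normal_pdfE ?oner_neq0// ler_wpM2l ?normal_peak_ge0//.
rewrite /normal_fun ler_expR !subr0 ler_wpM2r//.
by rewrite lerN2 ler_sqr ?nnegrE ?(ltW bM) ?(ltW M0)// ltW// scaling_gt0.
Unshelve. all: by end_near. Qed.

Lemma scaling_cvg : b n ^- 2 @[n --> \oo] --> (0 : R).
Proof.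
apply/cvgrPdist_le => e e0; near=> n.
have b0 := scaling_gt0 n.
rewrite sub0r normrN ger0_norm; last by rewrite invr_ge0 sqr_ge0.
have h1 : 1 <= b n by near: n; exact: scaling_ge.
have h2 : e^-1 <= b n by near: n; exact: scaling_ge.
rewrite -[leRHS]invrK lef_pV2 ?posrE ?invr_gt0 ?exprn_gt0//.
by rewrite (le_trans h2)// expr2 ler_peMr// ltW.
Unshelve. all: by end_near. Qed.

End normal_scaling.

Lemma integral_gt0 d (T : measurableType d) (R : realType) (m : probability T R) (f : T -> R) :
  measurable_fun setT f -> (forall t, 0 < f t) -> (0 < \int[m]_t (f t)%:E)%E.
Proof.
move=> mf f0; rewrite lt0e; apply/andP; split; last first.
  by apply: integral_ge0 => t _; rewrite lee_fin ltW.
apply/eqP => int0.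
have [] := @ae_eq_integral_abs _ _ _ m setT measurableT (EFin \o f).
  exact/measurable_EFinP.
move=> /(_ _)[].
  by rewrite -[RHS]int0; apply: eq_integral => t _; rewrite /= gtr0_norm.
move=> N [mN N0 fN] _.
have NT : N = setT.
  apply/seteqP; split => // t _; apply: fN => /= /(_ I) [] ft.
  by have := f0 t; rewrite ft ltxx.
by move: N0; rewrite NT probability_setT => -[]/eqP; rewrite oner_eq0.
Qed.

(** * The limiting distribution function and its law *)

Section limit_distribution.
Context {R : realType}.
Notation T := (ennreal R * (R * R))%type.
Variable eta : probability T R.
Hypothesis fin : forall x y, (\int[eta]_t (integrandF x y t)%:E)%E \is a fin_num.

Let V x y := fine (\int[eta]_t (integrandF x y t)%:E)%E.

Let VE x y : (\int[eta]_t (integrandF x y t)%:E)%E = (V x y)%:E.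
Proof. by rewrite fineK. Qed.

Let mF x y : measurable_fun (setT : set T) (fun t => (integrandF x y t)%:E).
Proof. by apply/measurable_EFinP; exact: measurable_integrandF. Qed.

Let VD x y h : V (x + h) (y + h) = expR (- h) * V x y.
Proof.
apply: EFin_inj; rewrite EFinM -!VE -ge0_integralZl//.
- by apply: eq_integral => t _; rewrite integrandFD EFinM.
by move=> t _; rewrite lee_fin integrandF_ge0.
Qed.

Let m_expR (h : T -> R) : measurable_fun setT h ->
  measurable_fun setT (fun t => expR (h t)).
Proof. by move=> mh; apply: measurableT_comp => //; exact: measurable_expR. Qed.

(** The constant is the integral of [exp h], positive and independent of the thresholds; [h] will be
    theta or gamma. The bound drives [V] to infinity as the corresponding threshold goes to minus
    infinity. *)
Let V_lower (h : T -> R) : measurable_fun setT h ->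
  exists2 c : R, 0 < c & forall a x y,
    (forall t, expR (- (a - h t)) <= integrandF x y t) -> expR (- a) * c <= V x y.
Proof.
move=> mh; have mexp := m_expR mh.
have c0 := integral_gt0 eta mexp (fun t => expR_gt0 _).
have le a x y : (forall t, expR (- (a - h t)) <= integrandF x y t) ->
    ((expR (- a))%:E * \int[eta]_t (expR (h t))%:E <= (V x y)%:E)%E.
  move=> H; rewrite -VE -ge0_integralZl//; [|exact/measurable_EFinP|by move=> t _; rewrite lee_fin expR_ge0..].
  apply: ge0_le_integral => //.
  - by apply/measurable_EFinP; exact: measurable_funM.
  - by move=> t _; rewrite -EFinM lee_fin -expRD (_ : - a + h t = - (a - h t))//; rewrite opprB addrC.
case cE : (\int[eta]_t (expR (h t))%:E)%E c0 le => [c| |] // c0 le.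
  by exists c => // a x y H; rewrite -lee_fin EFinM; exact: le.
(* If that integral were infinite, the pointwise bound would force the finite [V x y] to be
   infinite; the claim is then vacuous and any positive constant will do. *)
exists 1 => // a x y /le; rewrite mulry gtr0_sg ?expR_gt0// mul1e.
by rewrite leye_eq.
Qed.

Lemma limit_law_existence (P : nat -> probability (R * R)%type R) :
  (forall x y, P n (quadrant x y) @[n --> \oo] --> (expR (- V x y))%:E) ->
  exists nu : probability (R * R)%type R, weak_cvg P nu /\
    forall x y, nu (quadrant x y) = (expR (- V x y))%:E.
Proof.
move=> PV.
have expN_cvg : expR (- k%:R) @[k --> \oo] --> (0 : R) by exact: cvgn_expR.
(* From [exp u >= u] follows [exp (- u k) <= 1 / (c exp k)]. *)
have small (u : nat -> R) (c : R) : 0 < c -> (forall k : nat, expR k%:R * c <= u k) ->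
    expR (- u k) @[k --> \oo] --> (0 : R).
  move=> c0 uk; have c1 : expR (- k%:R) / c @[k --> \oo] --> (0 : R).
    by rewrite -(mul0r c^-1); apply: cvgM => //; exact: cvg_cst.
  apply: (squeeze_cvgr _ (cvg_cst (0 : R)) c1); apply: nearW => k.
  have e0 : 0 < expR k%:R * c by rewrite mulr_gt0// expR_gt0.
  rewrite expR_ge0 !expRN -invfM lef_pV2 ?posrE ?expR_gt0//.
  by rewrite (le_trans (uk k))// (le_trans _ (expR_ge1Dx _))// lerDr.
have [c1 c10 V1] := V_lower (measurableT_comp measurable_fst measurable_snd).
have [c2 c20 V2] := V_lower (measurableT_comp measurable_snd measurable_snd).
have [nu nuE] : exists nu : probability (R * R)%type R,
    forall x y, nu (quadrant x y) = (expR (- V x y))%:E.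
  apply: (limit_probability PV).
  - move=> x y; apply: continuous_cvg; first exact: continuous_expR.
    apply: cvgN; under eq_fun do rewrite VD.
    suff : expR (- t) * V x y @[t --> 0^'+] --> 1 * V x y by rewrite mul1r.
    apply: cvgM; last exact: cvg_cst.
    apply: cvg_at_right_filter; rewrite -expR0 -{2}oppr0.
    by apply: continuous_cvg; [exact: continuous_expR|apply: cvgN; exact: cvg_id].
  - move=> y; apply: (small _ c1 c10) => k; have := V1 (- k%:R) (- k%:R) y; rewrite opprK.
    by apply=> t; exact: integrandF_ge1.
  - move=> x; apply: (small _ c2 c20) => k; have := V2 (- k%:R) x (- k%:R); rewrite opprK.
    by apply=> t; exact: integrandF_ge2.
  - suff : expR (- V k%:R k%:R) @[k --> \oo] --> expR (- (0 : R)) by rewrite oppr0 expR0.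
    apply: continuous_cvg; first exact: continuous_expR.
    apply: cvgN; have VE0 k : V k%:R k%:R = expR (- k%:R) * V 0 0 by rewrite -VD !add0r.
    have : expR (- k%:R) * V 0 0 @[k --> \oo] --> 0 * V 0 0.
      by apply: cvgM => //; exact: cvg_cst.
    by rewrite mul0r; under eq_fun do rewrite -VE0.
exists nu; split=> //; apply: weak_cvg_quadrant => x y; rewrite nuE; exact: PV.
Qed.

End limit_distribution.

(** * From row probabilities to the componentwise maximum *)

Lemma normalized_max_quadrant d (T : measurableType d) (R : realType) (n : nat) (b : R)
    (X : 'I_n.+1 -> {mfun T >-> (R * R)%type}) (x y : R) : 0 < b ->
  normalized_max b X @^-1` quadrant x y =
  \bigcap_(i in [set` [set: 'I_n.+1]%SET]) (X i @^-1` quadrant (b + x / b) (b + y / b)).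
Proof.
move=> b0.
have scale (u v : R) : (b * (u - b) <= v) = (u <= b + v / b).
  by rewrite mulrC -ler_pdivlMr// lerBlDl.
apply/seteqP; split => [w [/=]|w wX].
  rewrite !in_itv/= => /bigmax_leP[_ h1] /bigmax_leP[_ h2] i _.
  by split; rewrite /= in_itv/= -scale; [exact: h1|exact: h2].
have wXi i : (X i w).1 <= b + x / b /\ (X i w).2 <= b + y / b.
  by have [|/=] := wX i; rewrite /= ?inE// !in_itv/=.
by split; rewrite /= in_itv/=; apply/bigmax_leP; split => [|i _];
  rewrite scale; have [] := wXi ord0; try have [] := wXi i.
Qed.

Theorem theorem2p1 (R : realType)
  (d : nat -> measure_display) (Omega : forall n, measurableType (d n))
  (P : forall n, probability (Omega n) R)
  (X : forall n, 'I_n.+1 -> {mfun Omega n >-> (R * R)%type})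
  (sigma1 sigma2 sigma12 : forall n, 'I_n.+1 -> R)
  (b : nat -> R)
  (X_indep : forall n,
     mutually_independent (P n) (fun i => X n i : Omega n -> (R * R)%type))
  (X_gauss : forall n i, gaussian_vector (P n) (X n i))
  (X_mean1 : forall n i, ('E_(P n)[fst \o X n i] = 0)%E)
  (X_mean2 : forall n i, ('E_(P n)[snd \o X n i] = 0)%E)
  (X_var1 : forall n i, ('V_(P n)[fst \o X n i] = (sigma1 n i ^+ 2)%:E)%E)
  (X_var2 : forall n i, ('V_(P n)[snd \o X n i] = (sigma2 n i ^+ 2)%:E)%E)
  (X_cov : forall n i,
     covariance (P n) (fst \o X n i) (snd \o X n i) = (sigma12 n i)%:E)
  (sigma1_gt0 : forall n i, 0 < sigma1 n i)
  (sigma2_gt0 : forall n i, 0 < sigma2 n i)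
  (b_def : forall n, b n = n.+1%:R * normal_pdf 0 1 (b n))
  (eps : R) (eps_gt0 : 0 < eps)
  (eta_moment : (ereal_sup (range (fun n => \int[eta_row (b n) (sigma1 n) (sigma2 n) (sigma12 n)]_z
     (expR (z.2.1 * (1 + eps)) + expR (z.2.2 * (1 + eps)))%:E)) < +oo)%E)
  (eta : probability (ennreal R * (R * R))%type R)
  (eta_cvg : 
     weak_cvg (fun n => eta_row (b n) (sigma1 n) (sigma2 n) (sigma12 n)) eta) :
  exists nu : probability (R * R)%type R,
    weak_cvg (fun n => distribution (P n) (normalized_max (b n) (X n))) nu /\
    forall x y : R,
      (- lne (nu (`]-oo, x] `*` `]-oo, y])) = \int[eta]_z (integrandF x y z)%:E)%E.
Proof.
have b0 n : 0 < b n by exact: scaling_gt0.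
pose z n i : (ennreal R * (R * R))%type :=
  (ennreal_of (sqrtr_ge0
     (b n ^+ 2 * (1 - corr (sigma1 n i) (sigma2 n i) (sigma12 n i)) / 2)),
   (b n ^+ 2 * (1 - (sigma1 n i)^-1), b n ^+ 2 * (1 - (sigma2 n i)^-1))).
have [S momS] : exists S, forall n, n.+1%:R^-1 * \sum_(i < n.+1)
    (expR ((z n i).2.1 * (1 + eps)) + expR ((z n i).2.2 * (1 + eps))) <= S.
  pose W (t : (ennreal R * (R * R))%type) := expR (t.2.1 * (1 + eps)) + expR (t.2.2 * (1 + eps)).
  have mW : measurable_fun setT W.
    apply: measurable_funD; apply: measurableT_comp => //; apply: measurable_funM => //;
      exact: measurableT_comp.
  have WE n : (\int[eta_row (b n) (sigma1 n) (sigma2 n) (sigma12 n)]_t (W t)%:E =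
      (n.+1%:R^-1 * \sum_(i < n.+1) W (z n i))%:E)%E.
    by rewrite integral_empirical// => t; rewrite addr_ge0 ?expR_ge0.
  move: eta_moment; set s := ereal_sup _ => s_lt.
  have le_s n : ((n.+1%:R^-1 * \sum_(i < n.+1) W (z n i))%:E <= s)%E.
    by rewrite -WE; apply: ereal_sup_ubound; exists n.
  exists (fine s) => n; rewrite -lee_fin fineK//.
  by rewrite fin_real// s_lt andbT; exact: lt_le_trans (ltNyr _) (le_s 0%N).
have limits x y := @hr_average_cvg R z eta (fun n => b n ^- 2) eps S x y eta_cvg eps_gt0
  (fun n => ltac:(by rewrite invr_ge0 sqr_ge0)) (scaling_cvg b_def)
  (fun n i => row_admissible (X_gauss n i) (X_mean1 n i) (X_mean2 n i) (X_var1 n i)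
     (X_var2 n i) (X_cov n i) (sigma1_gt0 n i) (sigma2_gt0 n i) (b0 n)) momS.
have fin x y : (\int[eta]_t (integrandF x y t)%:E)%E \is a fin_num by have [] := limits x y.
have [|nu [cvg_nu nuE]] := limit_law_existence fin
    (P := fun n => distribution (P n) (normalized_max (b n) (X n))).
  move=> x y; pose q n i := P n (X n i @^-1` quadrant (b n + x / b n) (b n + y / b n)).
  have q_fin n i : q n i \is a fin_num.
    apply: fin_num_measure; rewrite -[X in measurable X]setTI.
    by apply: measurable_funPT => //; exact: measurable_quadrant.
  have [_ sum_cvg max_cvg] := limits x y.
  pose p n i := 1 - fine (q n i).
  have pE n i : p n i = n.+1%:R^-1 * perturbed_exponent (b n ^- 2) x y (z n i).
    rewrite -(row_exceedance (X_gauss n i) (X_mean1 n i) (X_mean2 n i) (X_var1 n i)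
     (X_var2 n i) (X_cov n i) (sigma1_gt0 n i) (sigma2_gt0 n i) (b0 n) (b_def n)).
    by rewrite mulKf// pnatr_eq0.
  (* The maximum stays in a quadrant exactly when every vector does, so independence gives a product
     of [1 - p n i], with [p n i] the exceedance probability of a single vector. *)
  have -> : (fun n => distribution (P n) (normalized_max (b n) (X n)) (quadrant x y)) =
      (fun n => (\prod_(i < n.+1) (1 - p n i))%:E).
    apply/funext => n; rewrite /= /distribution /pushforward normalized_max_quadrant//.
    rewrite (X_indep n [set: 'I_n.+1]%SET (fun=> quadrant (b n + x / b n) (b n + y / b n))).
      rewrite -prodEFin; apply: eq_big => i; first by rewrite inE.
      by move=> _; rewrite /p subKr fineK//; exact: q_fin.
    by move=> i; exact: measurable_quadrant.
  apply: cvg_EFin; first exact: nearW.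
  apply: prod_onem_cvg.
  - by move=> n i; rewrite pE mulr_ge0 ?invr_ge0// perturbed_exponent_ge0.
  - by move=> e e0; apply: filterS (max_cvg e e0) => n H i; rewrite pE; exact: H.
  - have -> // : (fun n => \sum_(i < n.+1) p n i) = (fun n => n.+1%:R^-1 *
        \sum_(i < n.+1) perturbed_exponent (b n ^- 2) x y (z n i)).
    by apply/funext => n; rewrite mulr_sumr; apply: eq_bigr => i _; exact: pE.
exists nu; split=> // x y.
have -> : nu (`]-oo, x] `*` `]-oo, y]) = (expR (- fine (\int[eta]_t (integrandF x y t)%:E)%E))%:E.
  exact: nuE.
by rewrite /lne leNgt expR_gt0/= expRK opprK fineK.
Qed.
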